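(* Let $(C,\eta,\mu)$ be a $2$-monad on $\mathbf{Cat}$ such that the underlying $2$-functor $C$ preserves pullbacks, and let $\phi_0 : R_0 \to \mathcal{T}_0$ be a basic higher operad. Let $R=\mathbf{Cat}(R_0)$ be the associated $2$-monad on $[\mathbb{G}^{\mathrm{op}},\mathbf{Cat}]$, and let $C_{\mathbb{G}}$ be the $2$-monad on $[\mathbb{G}^{\mathrm{op}},\mathbf{Cat}]$ given by composition with $C$. Then $C_{\mathbb{G}}$ distributes with $R$; that is, there exists a distributive law of $2$-monads $R\,C_{\mathbb{G}} \to C_{\mathbb{G}}\,R$.
   Context: $\mathbb{G}$ is the category with objects the natural numbers, generated by arrows $\sigma_n,\tau_n : n \to n+1$ ($n\in\mathbb{N}$) subject to $\sigma_{n+1}\sigma_n=\tau_{n+1}\sigma_n$ and $\tau_{n+1}\tau_n=\sigma_{n+1}\tau_n$. Objects of $[\mathbb{G}^{\mathrm{op}},\mathbf{Set}]$ are called globular sets. $\mathcal{T}_0$ denotes the monad on $[\mathbb{G}^{\mathrm{op}},\mathbf{Set}]$ whose algebras are strict $\omega$-categories (the free strict $\omega$-category monad). It is cartesian: its endofunctor preserves pullbacks and the naturality squares of its unit and multiplication are pullbacks. A basic higher operad is a cartesian monad morphism $\phi_0:R_0\to\mathcal{T}_0$: a monad $R_0$ on $[\mathbb{G}^{\mathrm{op}},\mathbf{Set}]$ together with a natural transformation $\phi_0$ from its endofunctor to that of $\mathcal{T}_0$ which is compatible with units and multiplications and all of whose naturality squares are pullbacks. (In particular $R_0$ preserves pullbacks.)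 For a category $\mathcal{E}$ with pullbacks, $\mathbf{Cat}(\mathcal{E})$ is the $2$-category of categories internal to $\mathcal{E}$. This is the object map of a $2$-functor $\mathbf{Cat}(-)$ from the $2$-category of categories with pullbacks, pullback-preserving functors and natural transformations to the $2$-category of $2$-categories, $2$-functors and $2$-natural transformations. Since $\mathbf{Cat}([\mathbb{G}^{\mathrm{op}},\mathbf{Set}])\cong[\mathbb{G}^{\mathrm{op}},\mathbf{Cat}]$, applying it to $R_0$ gives a $2$-monad $R=\mathbf{Cat}(R_0)$ on $[\mathbb{G}^{\mathrm{op}},\mathbf{Cat}]$. A $2$-monad is a $\mathbf{Cat}$-enriched monad (a $2$-functor with $2$-natural unit and multiplication satisfying the strict monad axioms). For a $2$-monad $(C,\eta,\mu)$ on $\mathbf{Cat}$, the $2$-monad $(C_{\mathbb{G}},\eta_{\mathbb{G}},\mu_{\mathbb{G}})$ on $[\mathbb{G}^{\mathrm{op}},\mathbf{Cat}]$ is defined by $C_{\mathbb{G}}(X)=C\circ X$, with unit and multiplication at $X$ given by the whiskerings $\eta X$ and $\mu X$. A distributive law between $2$-monads $S$ and $T$ on the same $2$-category is a $2$-natural transformation $\lambda:TS\to ST$ satisfying the usual (strict) distributive law axioms with respect to the units and multiplications of $S$ and $T$. When such a $\lambda:TS\to ST$ exists, one says that $S$ distributes with $T$. *)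

(* Defs.v *)
(* Classical mathematics on top of the Rocq standard library: "sets" are types,
   equality is Leibniz equality, with function extensionality, proof
   irrelevance and unique choice. *)
From Stdlib Require Import FunctionalExtensionality ProofIrrelevance.
From Stdlib Require Import IndefiniteDescription.

Set Implicit Arguments.
Unset Strict Implicit.
Set Primitive Projections.

Record category := Category {
  ob : Type;
  hom : ob -> ob -> Type;
  cid : forall X, hom X X;
  ccomp : forall X Y Z, hom Y Z -> hom X Y -> hom X Z;
  ccomp_idl : forall X Y (f : hom X Y), ccomp (cid Y) f = f;
  ccomp_idr : forall X Y (f : hom X Y), ccomp f (cid X) = f;
  ccomp_assoc : forall X Y Z W (h : hom Z W) (g : hom Y Z) (f : hom X Y),
    ccomp h (ccomp g f) = ccomp (ccomp h g) f }.

Arguments hom : clear implicits.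
Arguments cid {c} X.
Arguments ccomp {c X Y Z} g f.

Declare Scope cat_scope.
Delimit Scope cat_scope with cat.
Local Open Scope cat_scope.
Notation "g ∘ f" := (ccomp g f) (at level 40, left associativity) : cat_scope.

Record functor (C D : category) := Functor {
  fob : ob C -> ob D;
  fmap : forall X Y, hom C X Y -> hom D (fob X) (fob Y);
  fmap_id : forall X, fmap (cid X) = cid (fob X);
  fmap_comp : forall X Y Z (g : hom C Y Z) (f : hom C X Y),
    fmap (g ∘ f) = fmap g ∘ fmap f }.

Arguments fob {C D} F X : rename.
Arguments fmap {C D} F {X Y} f : rename.

Definition functor_id (C : category) : functor C C :=
  {| fob := fun X => X; fmap := fun X Y f => f;
     fmap_id := fun X => eq_refl; fmap_comp := fun X Y Z g f => eq_refl |}.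

Definition functor_comp (C D E : category) (G : functor D E) (F : functor C D) :
  functor C E.
Proof.
refine {| fob := fun X => fob G (fob F X);
          fmap := fun X Y f => fmap G (fmap F f) |}.
- intros X; rewrite !fmap_id; reflexivity.
- intros X Y Z g f; rewrite !fmap_comp; reflexivity.
Defined.

Record nattrans (C D : category) (F G : functor C D) := Nattrans {
  nt_app : forall X, hom D (fob F X) (fob G X);
  nt_nat : forall X Y (f : hom C X Y),
    nt_app Y ∘ fmap F f = fmap G f ∘ nt_app X }.

Arguments nt_app {C D F G} phi X : rename.

Record monad (C : category) := Monad {
  mfun : functor C C;
  munit : nattrans (functor_id C) mfun;
  mmult : nattrans (functor_comp mfun mfun) mfun;
  munit_l : forall X, nt_app mmult X ∘ nt_app munit (fob mfun X) = cid (fob mfun X);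
  munit_r : forall X, nt_app mmult X ∘ fmap mfun (nt_app munit X) = cid (fob mfun X);
  mmult_assoc : forall X,
    nt_app mmult X ∘ nt_app mmult (fob mfun X)
    = nt_app mmult X ∘ fmap mfun (nt_app mmult X) }.

Record left_adjoint (D E : category) (U : functor D E) := LeftAdjoint {
  ladj : functor E D;
  adj_unit : nattrans (functor_id E) (functor_comp U ladj);
  adj_counit : nattrans (functor_comp ladj U) (functor_id D);
  adj_triangle_l : forall X,
    nt_app adj_counit (fob ladj X) ∘ fmap ladj (nt_app adj_unit X)
    = cid (fob ladj X);
  adj_triangle_r : forall Y,
    fmap U (nt_app adj_counit Y) ∘ nt_app adj_unit (fob U Y) = cid (fob U Y) }.

Definition adjunction_mult (D E : category) (U : functor D E)
  (L : left_adjoint U) :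
  nattrans (functor_comp (functor_comp U (ladj L)) (functor_comp U (ladj L)))
           (functor_comp U (ladj L)).
Proof.
refine (@Nattrans E E
  (functor_comp (functor_comp U (ladj L)) (functor_comp U (ladj L)))
  (functor_comp U (ladj L))
  (fun X => fmap U (nt_app (adj_counit L) (fob (ladj L) X))) _).
intros X Y f; cbn. rewrite <- !fmap_comp; f_equal.
exact (nt_nat (adj_counit L) (fmap (ladj L) f)).
Defined.

Definition adjunction_monad (D E : category) (U : functor D E)
  (L : left_adjoint U) : monad E.
Proof.
refine {| mfun := functor_comp U (ladj L);
          munit := adj_unit L;
          mmult := adjunction_mult L |}.
- intros X; cbn. exact (adj_triangle_r L (fob (ladj L) X)).
- intros X; cbn. etransitivity; [symmetry; apply fmap_comp|].
  etransitivity; [|apply fmap_id]. f_equal. exact (adj_triangle_l L X).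
- intros X; cbn. rewrite <- !fmap_comp; f_equal. symmetry.
  exact (nt_nat (adj_counit L) (nt_app (adj_counit L) (fob (ladj L) X))).
Defined.

(* The square  P --q--> B
               |p       |g
               A --f--> Z   is a pullback. *)
Definition is_pullback (C : category) (A B Z P : ob C)
  (f : hom C A Z) (g : hom C B Z) (p : hom C P A) (q : hom C P B) : Prop :=
  f ∘ p = g ∘ q /\
  forall (W : ob C) (a : hom C W A) (b : hom C W B), f ∘ a = g ∘ b ->
    exists! u : hom C W P, p ∘ u = a /\ q ∘ u = b.

Definition preserves_pullbacks (C D : category) (F : functor C D) : Prop :=
  forall (A B Z P : ob C)
         (f : hom C A Z) (g : hom C B Z) (p : hom C P A) (q : hom C P B),
    is_pullback f g p q ->
    is_pullback (fmap F f) (fmap F g) (fmap F p) (fmap F q).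

Definition cartesian_nattrans (C D : category) (F G : functor C D)
  (phi : nattrans F G) : Prop :=
  forall X Y (f : hom C X Y),
    is_pullback (nt_app phi Y) (fmap G f) (fmap F f) (nt_app phi X).

Record cartesian_monad_morphism (C : category) (R T : monad C) := {
  mm_nat : nattrans (mfun R) (mfun T);
  mm_unit : forall X, nt_app mm_nat X ∘ nt_app (munit R) X = nt_app (munit T) X;
  mm_mult : forall X,
    nt_app mm_nat X ∘ nt_app (mmult R) X
    = nt_app (mmult T) X ∘ (nt_app mm_nat (fob (mfun T) X)
                            ∘ fmap (mfun R) (nt_app mm_nat X));
  mm_cartesian : cartesian_nattrans mm_nat }.

(* Presheaves on  G,  the category on [nat] generated by
   sigma_n, tau_n : n -> n + 1  with  sigma_(n+1) sigma_n = tau_(n+1) sigma_n  and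
   tau_(n+1) tau_n = sigma_(n+1) tau_n : a functor out of  G^op  is determined by
   the images of the generators, subject to the reversed relations. *)
Record gset := GSet {
  cell : nat -> Type;
  gs : forall n, cell (S n) -> cell n;
  gt : forall n, cell (S n) -> cell n;
  gs_glob : forall n (x : cell (S (S n))), gs (gs x) = gs (gt x);
  gt_glob : forall n (x : cell (S (S n))), gt (gt x) = gt (gs x) }.

Arguments gs {X n} x : rename.
Arguments gt {X n} x : rename.

Record ghom (X Y : gset) := GHom {
  gmap : forall n, cell X n -> cell Y n;
  gmap_s : forall n (x : cell X (S n)), gs (gmap x) = gmap (gs x);
  gmap_t : forall n (x : cell X (S n)), gt (gmap x) = gmap (gt x) }.

Arguments gmap {X Y} f {n} x : rename.

Lemma ghom_eq (X Y : gset) (f g : ghom X Y) :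
  (forall n (x : cell X n), gmap f x = gmap g x) -> f = g.
Proof.
destruct f as [f fs ft], g as [g gs' gt']; cbn; intros E.
assert (f = g).
{ apply functional_extensionality_dep; intros n.
  apply functional_extensionality; intros x; apply E. }
subst; f_equal; apply proof_irrelevance.
Qed.

Definition ghom_id (X : gset) : ghom X X :=
  {| gmap := fun n x => x; gmap_s := fun n x => eq_refl;
     gmap_t := fun n x => eq_refl |}.

Definition ghom_comp (X Y Z : gset) (g : ghom Y Z) (f : ghom X Y) : ghom X Z.
Proof.
refine {| gmap := fun n x => gmap g (gmap f x) |}.
- intros n x; rewrite !gmap_s; reflexivity.
- intros n x; rewrite !gmap_t; reflexivity.
Defined.

Definition GSET : category.
Proof.
refine {| ob := gset; hom := ghom; cid := ghom_id; ccomp := ghom_comp |};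
  intros; apply ghom_eq; reflexivity.
Defined.

(* Source, target and identity iterated [d] times between dimensions [n] and
   [n - d]; truncated subtraction makes the types line up definitionally. *)
Fixpoint isrc (X : gset) (n d : nat) : cell X n -> cell X (n - d) :=
  match n, d with
  | 0, _ => fun x => x
  | S n', 0 => fun x => x
  | S n', S d' => fun x => isrc d' (gs x)
  end.

Fixpoint itgt (X : gset) (n d : nat) : cell X n -> cell X (n - d) :=
  match n, d with
  | 0, _ => fun x => x
  | S n', 0 => fun x => x
  | S n', S d' => fun x => itgt d' (gt x)
  end.

Fixpoint iid (X : gset) (i : forall n, cell X n -> cell X (S n)) (n d : nat) :
  cell X (n - d) -> cell X n :=
  match n as n, d as d return cell X (n - d) -> cell X n with
  | 0, _ => fun x => x
  | S n', 0 => fun x => x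
  | S n', S d' => fun x => i n' (@iid X i n' d' x)
  end.

Arguments iid {X} i n d x.

Unset Implicit Arguments.

(* [wcomp n d _ y x _] is the composite of the [n]-cells [y] after [x] along
   their common boundary in dimension [k = n - d < n].  Composability and range
   proofs of composites occurring in an axiom are universally quantified. *)
Record omega_cat := OmegaCat {
  wset : gset;
  wid : forall n, cell wset n -> cell wset (S n);
  wcomp : forall n d, 0 < d <= n -> forall y x : cell wset n,
    isrc d y = itgt d x -> cell wset n;
  wid_s : forall n (x : cell wset n), gs (wid n x) = x;
  wid_t : forall n (x : cell wset n), gt (wid n x) = x;
  (* composition along the boundary of codimension 1 *)
  wcomp_s1 : forall n h (y x : cell wset (S n)) e, gs (wcomp (S n) 1 h y x e) = gs x;
  wcomp_t1 : forall n h (y x : cell wset (S n)) e, gt (wcomp (S n) 1 h y x e) = gt y;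
  (* composition along a boundary of higher codimension *)
  wcomp_s : forall n d h h' (y x : cell wset (S n)) e e',
    gs (wcomp (S n) (S d) h y x e) = wcomp n d h' (gs y) (gs x) e';
  wcomp_t : forall n d h h' (y x : cell wset (S n)) e e',
    gt (wcomp (S n) (S d) h y x e) = wcomp n d h' (gt y) (gt x) e';
  wcomp_assoc : forall n d h (z y x : cell wset n) e1 e2 e3 e4,
    wcomp n d h z (wcomp n d h y x e1) e2 = wcomp n d h (wcomp n d h z y e3) x e4;
  wcomp_idl : forall n d h (x : cell wset n) e,
    wcomp n d h (iid wid n d (itgt d x)) x e = x;
  wcomp_idr : forall n d h (x : cell wset n) e,
    wcomp n d h x (iid wid n d (isrc d x)) e = x;
  wcomp_id : forall n d h h' (y x : cell wset n) e e',
    wid n (wcomp n d h y x e) = wcomp (S n) (S d) h' (wid n y) (wid n x) e';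
  winterchange : forall n d d' h h', d < d' ->
    forall (y' y x' x : cell wset n) e1 e2 e3 e4 e5 e6,
    wcomp n d' h' (wcomp n d h y' y e1) (wcomp n d h x' x e2) e3
    = wcomp n d h (wcomp n d' h' y' x' e4) (wcomp n d' h' y x e5) e6 }.

Set Implicit Arguments.
Unset Strict Implicit.

Record omega_fun (A B : omega_cat) := OmegaFun {
  wmap : ghom (wset A) (wset B);
  wmap_id : forall n (x : cell (wset A) n),
    gmap wmap (wid A n x) = wid B n (gmap wmap x);
  wmap_comp : forall n d h (y x : cell (wset A) n) e e',
    gmap wmap (wcomp A n d h y x e) = wcomp B n d h (gmap wmap y) (gmap wmap x) e' }.

Lemma omega_fun_eq (A B : omega_cat) (f g : omega_fun A B) :
  wmap f = wmap g -> f = g.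
Proof.
destruct f as [f f1 f2], g as [g g1 g2]; cbn; intros E; subst g.
f_equal; apply proof_irrelevance.
Qed.

Definition omega_fun_id (A : omega_cat) : omega_fun A A.
Proof.
refine {| wmap := ghom_id (wset A) |}.
- reflexivity.
- intros n d h y x e e'; cbn; f_equal; apply proof_irrelevance.
Defined.

Lemma gmap_isrc (X Y : gset) (f : ghom X Y) n : forall d (x : cell X n),
  isrc d (gmap f x) = gmap f (isrc d x).
Proof.
induction n as [|n IH]; intros [|d] x; try reflexivity.
cbn. rewrite gmap_s. apply IH.
Qed.

Lemma gmap_itgt (X Y : gset) (f : ghom X Y) n : forall d (x : cell X n),
  itgt d (gmap f x) = gmap f (itgt d x).
Proof.
induction n as [|n IH]; intros [|d] x; try reflexivity.
cbn. rewrite gmap_t. apply IH.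
Qed.

Definition omega_fun_comp (A B C : omega_cat) (g : omega_fun B C)
  (f : omega_fun A B) : omega_fun A C.
Proof.
refine {| wmap := ghom_comp (wmap g) (wmap f) |}.
- intros n x; cbn; rewrite !wmap_id; reflexivity.
- intros n d h y x e e'; cbn.
  assert (e1 : isrc d (gmap (wmap f) y) = itgt d (gmap (wmap f) x))
    by (rewrite gmap_isrc, gmap_itgt, e; reflexivity).
  rewrite (wmap_comp h e e1). apply wmap_comp.
Defined.

Definition OMEGA_CAT : category.
Proof.
refine {| ob := omega_cat; hom := omega_fun; cid := omega_fun_id;
          ccomp := omega_fun_comp |};
  intros; apply omega_fun_eq, ghom_eq; reflexivity.
Defined.

Definition omega_forget : functor OMEGA_CAT GSET.
Proof.
refine (@Functor OMEGA_CAT GSET wset wmap _ _); reflexivity.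
Defined.

(* The monad on globular sets induced by a left adjoint to the forgetful functor
   from strict omega-categories. *)
Definition free_omega_monad (L : left_adjoint omega_forget) : monad GSET :=
  adjunction_monad L.

(* Categories internal to sets, with a single type of arrows: strict equalities
   between functors and between 2-cells then need no transport.  [cmp g f _] is
   [g] after [f]. *)
Record cat := Cat {
  obj : Type;
  arr : Type;
  dom : arr -> obj;
  cod : arr -> obj;
  idn : obj -> arr;
  cmp : forall g f : arr, dom g = cod f -> arr;
  dom_idn : forall x, dom (idn x) = x;
  cod_idn : forall x, cod (idn x) = x;
  dom_cmp : forall g f e, dom (@cmp g f e) = dom f;
  cod_cmp : forall g f e, cod (@cmp g f e) = cod g;
  cmp_idl : forall f e, @cmp (idn (cod f)) f e = f;
  cmp_idr : forall f e, @cmp f (idn (dom f)) e = f;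
  cmp_assoc : forall h g f e1 e2 e3 e4,
    @cmp h (@cmp g f e1) e2 = @cmp (@cmp h g e3) f e4 }.

Arguments dom {c} f : rename.
Arguments cod {c} f : rename.
Arguments idn {c} x : rename.
Arguments cmp {c} g f e : rename.

Record fctor (A B : cat) := Fctor {
  fo : obj A -> obj B;
  fa : arr A -> arr B;
  fa_dom : forall f, dom (fa f) = fo (dom f);
  fa_cod : forall f, cod (fa f) = fo (cod f);
  fa_idn : forall x, fa (idn x) = idn (fo x);
  fa_cmp : forall g f e e', fa (cmp g f e) = cmp (fa g) (fa f) e' }.

Arguments fo {A B} F x : rename.
Arguments fa {A B} F f : rename.

Record nt (A B : cat) := Nt {
  nsrc : fctor A B;
  ntgt : fctor A B;
  napp : obj A -> arr B;
  napp_dom : forall x, dom (napp x) = fo nsrc x;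
  napp_cod : forall x, cod (napp x) = fo ntgt x;
  napp_nat : forall f e e',
    cmp (napp (cod f)) (fa nsrc f) e = cmp (fa ntgt f) (napp (dom f)) e' }.

Definition feq (A B : cat) (F G : fctor A B) : Prop :=
  (forall x, fo F x = fo G x) /\ (forall f, fa F f = fa G f).

(* Transparent, unlike [proj1] and [proj2]. *)
Definition feq_fo (A B : cat) (F G : fctor A B) (E : feq F G) :
  forall x, fo F x = fo G x := let (E0, _) := E in E0.
Definition feq_fa (A B : cat) (F G : fctor A B) (E : feq F G) :
  forall f, fa F f = fa G f := let (_, E1) := E in E1.

Lemma feq_eq (A B : cat) (F G : fctor A B) : feq F G -> F = G.
Proof.
destruct F as [F0 F1 Fd Fc Fi Fm], G as [G0 G1 Gd Gc Gi Gm].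
intros [E0 E1]; cbn in E0, E1.
apply functional_extensionality in E0; apply functional_extensionality in E1.
subst; f_equal; apply proof_irrelevance.
Qed.

Lemma eq_feq (A B : cat) (F G : fctor A B) : F = G -> feq F G.
Proof. intros ->; split; reflexivity. Qed.

Lemma nt_eq (A B : cat) (a b : nt A B) :
  nsrc a = nsrc b -> ntgt a = ntgt b -> (forall x, napp a x = napp b x) -> a = b.
Proof.
destruct a as [F G a ad ac an], b as [F' G' b bd bc bn]; cbn.
intros <- <- E; apply functional_extensionality in E; subst b.
f_equal; apply proof_irrelevance.
Qed.

Lemma cmp_eq (A : cat) (g g' f f' : arr A) e e' :
  g = g' -> f = f' -> cmp g f e = cmp g' f' e'.
Proof. intros -> ->; f_equal; apply proof_irrelevance. Qed.

Lemma cmp_idl' (A : cat) x (f : arr A) e : cmp (idn x) f e = f.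
Proof.
assert (x = cod f) by (rewrite <- e; symmetry; apply dom_idn).
subst x; apply cmp_idl.
Qed.

Lemma cmp_idr' (A : cat) x (f : arr A) e : cmp f (idn x) e = f.
Proof.
assert (x = dom f) by (rewrite e; symmetry; apply cod_idn).
subst x; apply cmp_idr.
Qed.

Ltac bdry := cbn; repeat first
  [ rewrite dom_cmp | rewrite cod_cmp | rewrite dom_idn | rewrite cod_idn
  | rewrite fa_dom | rewrite fa_cod | rewrite napp_dom | rewrite napp_cod ];
  cbn; try assumption; try congruence.

Lemma cmp_assocR (A : cat) (h g f : arr A) e e' :
  cmp (cmp h g e) f e'
  = cmp h (cmp g f ltac:(rewrite <- e', dom_cmp; reflexivity))
      ltac:(rewrite cod_cmp; exact e).
Proof. symmetry; apply cmp_assoc. Qed.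

Lemma cmp_assocL (A : cat) (h g f : arr A) e e' :
  cmp h (cmp g f e) e'
  = cmp (cmp h g ltac:(rewrite e', cod_cmp; reflexivity)) f
      ltac:(rewrite dom_cmp; exact e).
Proof. apply cmp_assoc. Qed.

Ltac via_cmp N :=
  etransitivity; [|etransitivity; [exact N|]];
  apply cmp_eq; try reflexivity; f_equal; bdry.

Definition fctor_id (A : cat) : fctor A A.
Proof.
refine {| fo := fun x => x; fa := fun f => f |}; try reflexivity.
intros; apply cmp_eq; reflexivity.
Defined.

Definition fctor_comp (A B C : cat) (G : fctor B C) (F : fctor A B) : fctor A C.
Proof.
refine {| fo := fun x => fo G (fo F x); fa := fun f => fa G (fa F f) |}.
- intros f; bdry.
- intros f; bdry.
- intros x; rewrite !fa_idn; reflexivity.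
- intros g f e e'.
  assert (e1 : dom (fa F g) = cod (fa F f)) by bdry.
  rewrite (fa_cmp e e1); apply fa_cmp.
Defined.

Definition nt_id (A B : cat) (F : fctor A B) : nt A B.
Proof.
refine {| nsrc := F; ntgt := F; napp := fun x => idn (fo F x) |}.
- intros; bdry.
- intros; bdry.
- intros f e e'. rewrite cmp_idl', cmp_idr'; reflexivity.
Defined.

Lemma vcomp_ok (A B : cat) (b a : nt A B) (e : nsrc b = ntgt a) x :
  dom (napp b x) = cod (napp a x).
Proof. bdry. Qed.

Definition vcomp (A B : cat) (b a : nt A B) (e : nsrc b = ntgt a) : nt A B.
Proof.
refine {| nsrc := nsrc a; ntgt := ntgt b;
          napp := fun x => cmp (napp b x) (napp a x) (vcomp_ok e x) |}.
- intros x; bdry.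
- intros x; bdry.
- intros f e1 e2.
  assert (h1 : dom (napp a (cod f)) = cod (fa (nsrc a) f)) by bdry.
  assert (h2 : dom (fa (ntgt a) f) = cod (napp a (dom f))) by bdry.
  assert (h3 : dom (napp b (cod f)) = cod (fa (nsrc b) f)) by bdry.
  assert (h4 : dom (fa (ntgt b) f) = cod (napp b (dom f))) by bdry.
  pose proof (napp_nat h1 h2) as Na; pose proof (napp_nat h3 h4) as Nb.
  rewrite cmp_assocR; etransitivity; [|symmetry; apply cmp_assocL].
  unshelve etransitivity;
    [refine (cmp (napp b (cod f)) (cmp (fa (ntgt a) f) (napp a (dom f)) h2) _); bdry
    |apply cmp_eq; [reflexivity|via_cmp Na]|].
  etransitivity; [apply cmp_assocL|].
  apply cmp_eq; [|reflexivity].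
  via_cmp Nb.
Defined.

Definition fun_cat (A B : cat) : cat.
Proof.
refine {| obj := fctor A B; arr := nt A B; dom := @nsrc A B; cod := @ntgt A B;
          idn := @nt_id A B; cmp := @vcomp A B |}; try reflexivity.
- intros f e; apply nt_eq; try reflexivity. intros x; apply cmp_idl'.
- intros f e; apply nt_eq; try reflexivity. intros x; apply cmp_idr'.
- intros h g f e1 e2 e3 e4; apply nt_eq; try reflexivity.
  intros x; apply cmp_assoc.
Defined.

Definition prod_cat (A B : cat) : cat.
Proof.
refine {| obj := obj A * obj B; arr := arr A * arr B;
  dom := fun f => (dom (fst f), dom (snd f));
  cod := fun f => (cod (fst f), cod (snd f));
  idn := fun x => (idn (fst x), idn (snd x));
  cmp := fun g f e => (cmp (fst g) (fst f) (f_equal fst e),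
                       cmp (snd g) (snd f) (f_equal snd e)) |}; cbn.
- intros [x y]; rewrite !dom_idn; reflexivity.
- intros [x y]; rewrite !cod_idn; reflexivity.
- intros; rewrite !dom_cmp; reflexivity.
- intros; rewrite !cod_cmp; reflexivity.
- intros [f f'] e; cbn; rewrite !cmp_idl; reflexivity.
- intros [f f'] e; cbn; rewrite !cmp_idr; reflexivity.
- intros [h h'] [g g'] [f f'] e1 e2 e3 e4; cbn; f_equal; apply cmp_assoc.
Defined.

(* Categories enriched in [cat]: the suffixes 1 and 2 mark the action of
   composition on 1-cells, and on 2-cells (horizontal composition). *)
Record twocat := Twocat {
  tob : Type;
  thom : tob -> tob -> cat;
  tid : forall X, obj (thom X X);
  tcmp : forall X Y Z, fctor (prod_cat (thom Y Z) (thom X Y)) (thom X Z);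
  tidl1 : forall X Y (f : obj (thom X Y)), fo (tcmp X Y Y) (tid Y, f) = f;
  tidl2 : forall X Y (a : arr (thom X Y)), fa (tcmp X Y Y) (idn (tid Y), a) = a;
  tidr1 : forall X Y (f : obj (thom X Y)), fo (tcmp X X Y) (f, tid X) = f;
  tidr2 : forall X Y (a : arr (thom X Y)), fa (tcmp X X Y) (a, idn (tid X)) = a;
  tassoc1 : forall X Y Z W
    (h : obj (thom Z W)) (g : obj (thom Y Z)) (f : obj (thom X Y)),
    fo (tcmp X Z W) (h, fo (tcmp X Y Z) (g, f))
    = fo (tcmp X Y W) (fo (tcmp Y Z W) (h, g), f);
  tassoc2 : forall X Y Z W
    (c : arr (thom Z W)) (b : arr (thom Y Z)) (a : arr (thom X Y)),
    fa (tcmp X Z W) (c, fa (tcmp X Y Z) (b, a))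
    = fa (tcmp X Y W) (fa (tcmp Y Z W) (c, b), a) }.

Arguments thom : clear implicits.
Arguments tid {t} X : rename.
Arguments tcmp {t} X Y Z : rename.

Definition c1 (K : twocat) (X Y Z : tob K)
  (g : obj (thom K Y Z)) (f : obj (thom K X Y)) : obj (thom K X Z) :=
  fo (tcmp X Y Z) (g, f).
Definition c2 (K : twocat) (X Y Z : tob K)
  (b : arr (thom K Y Z)) (a : arr (thom K X Y)) : arr (thom K X Z) :=
  fa (tcmp X Y Z) (b, a).

Notation "g ∘1 f" := (c1 g f) (at level 40, left associativity) : cat_scope.
Notation "b ∘2 a" := (c2 b a) (at level 40, left associativity) : cat_scope.

Record functor2 (K L : twocat) := Functor2 {
  f2ob : tob K -> tob L;
  f2hom : forall X Y, fctor (thom K X Y) (thom L (f2ob X) (f2ob Y));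
  f2_id : forall X, fo (f2hom X X) (tid X) = tid (f2ob X);
  f2_c1 : forall X Y Z (g : obj (thom K Y Z)) (f : obj (thom K X Y)),
    fo (f2hom X Z) (g ∘1 f) = fo (f2hom Y Z) g ∘1 fo (f2hom X Y) f;
  f2_c2 : forall X Y Z (b : arr (thom K Y Z)) (a : arr (thom K X Y)),
    fa (f2hom X Z) (b ∘2 a) = fa (f2hom Y Z) b ∘2 fa (f2hom X Y) a }.

Arguments f2ob {K L} F X : rename.
Arguments f2hom {K L} F X Y : rename.

Definition f2_1 (K L : twocat) (F : functor2 K L) X Y (f : obj (thom K X Y)) :
  obj (thom L (f2ob F X) (f2ob F Y)) := fo (f2hom F X Y) f.
Definition f2_2 (K L : twocat) (F : functor2 K L) X Y (a : arr (thom K X Y)) :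
  arr (thom L (f2ob F X) (f2ob F Y)) := fa (f2hom F X Y) a.

Arguments f2_1 {K L} F {X Y} f.
Arguments f2_2 {K L} F {X Y} a.

Definition functor2_id (K : twocat) : functor2 K K.
Proof.
refine (@Functor2 K K (fun X => X) (fun X Y => fctor_id (thom K X Y)) _ _ _);
  reflexivity.
Defined.

Definition functor2_comp (K L M : twocat) (G : functor2 L M) (F : functor2 K L) :
  functor2 K M.
Proof.
refine (@Functor2 K M (fun X => f2ob G (f2ob F X))
  (fun X Y => fctor_comp (f2hom G _ _) (f2hom F X Y)) _ _ _).
- intros X; cbn. rewrite f2_id; apply f2_id.
- intros X Y Z g f; cbn. rewrite f2_c1; apply f2_c1.
- intros X Y Z b a; cbn. rewrite f2_c2; apply f2_c2.
Defined.

Record nat2 (K L : twocat) (F G : functor2 K L) := Nat2 {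
  n2app : forall X, obj (thom L (f2ob F X) (f2ob G X));
  n2nat1 : forall X Y (f : obj (thom K X Y)),
    n2app Y ∘1 f2_1 F f = f2_1 G f ∘1 n2app X;
  n2nat2 : forall X Y (a : arr (thom K X Y)),
    idn (n2app Y) ∘2 f2_2 F a = f2_2 G a ∘2 idn (n2app X) }.

Arguments n2app {K L F G} phi X : rename.

Record monad2 (K : twocat) := Monad2 {
  m2fun : functor2 K K;
  m2unit : nat2 (functor2_id K) m2fun;
  m2mult : nat2 (functor2_comp m2fun m2fun) m2fun;
  m2unit_l : forall X,
    n2app m2mult X ∘1 n2app m2unit (f2ob m2fun X) = tid (f2ob m2fun X);
  m2unit_r : forall X,
    n2app m2mult X ∘1 f2_1 m2fun (n2app m2unit X) = tid (f2ob m2fun X);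
  m2mult_assoc : forall X,
    n2app m2mult X ∘1 n2app m2mult (f2ob m2fun X)
    = n2app m2mult X ∘1 f2_1 m2fun (n2app m2mult X) }.

(* [dl : T S -> S T]; then [S] distributes with [T]. *)
Record distributive_law (K : twocat) (S T : monad2 K) := DistributiveLaw {
  dl : nat2 (functor2_comp (m2fun T) (m2fun S)) (functor2_comp (m2fun S) (m2fun T));
  dl_unit_S : forall X,
    n2app dl X ∘1 f2_1 (m2fun T) (n2app (m2unit S) X)
    = n2app (m2unit S) (f2ob (m2fun T) X);
  dl_unit_T : forall X,
    n2app dl X ∘1 n2app (m2unit T) (f2ob (m2fun S) X)
    = f2_1 (m2fun S) (n2app (m2unit T) X);
  dl_mult_S : forall X,
    n2app dl X ∘1 f2_1 (m2fun T) (n2app (m2mult S) X)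
    = n2app (m2mult S) (f2ob (m2fun T) X)
      ∘1 (f2_1 (m2fun S) (n2app dl X) ∘1 n2app dl (f2ob (m2fun S) X));
  dl_mult_T : forall X,
    n2app dl X ∘1 n2app (m2mult T) (f2ob (m2fun S) X)
    = f2_1 (m2fun S) (n2app (m2mult T) X)
      ∘1 (n2app dl (f2ob (m2fun T) X) ∘1 f2_1 (m2fun T) (n2app dl X)) }.

(* The underlying ordinary category. *)
Definition under (K : twocat) : category.
Proof.
refine {| ob := tob K; hom := fun X Y => obj (thom K X Y);
          cid := fun X => tid X; ccomp := fun X Y Z g f => g ∘1 f |}.
- intros; apply tidl1.
- intros; apply tidr1.
- intros; apply tassoc1.
Defined.

Definition under_functor (K L : twocat) (F : functor2 K L) :
  functor (under K) (under L) :=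
  @Functor (under K) (under L) (f2ob F) (fun X Y f => f2_1 F f)
    (f2_id F) (f2_c1 F).

Lemma hcomp_ok (A B C : cat) (b : nt B C) (a : nt A B) x :
  dom (napp b (fo (ntgt a) x)) = cod (fa (nsrc b) (napp a x)).
Proof. bdry. Qed.

Definition hcomp (A B C : cat) (b : nt B C) (a : nt A B) : nt A C.
Proof.
refine {| nsrc := fctor_comp (nsrc b) (nsrc a);
          ntgt := fctor_comp (ntgt b) (ntgt a);
          napp := fun x => cmp (napp b (fo (ntgt a) x)) (fa (nsrc b) (napp a x))
                             (hcomp_ok b a x) |}.
- intros x; bdry.
- intros x; bdry.
- intros f e1 e2; cbn in *.
  assert (h1 : dom (napp a (cod f)) = cod (fa (nsrc a) f)) by bdry.
  assert (h2 : dom (fa (ntgt a) f) = cod (napp a (dom f))) by bdry.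
  assert (h3 : dom (napp b (cod (fa (ntgt a) f)))
               = cod (fa (nsrc b) (fa (ntgt a) f))) by bdry.
  assert (h4 : dom (fa (ntgt b) (fa (ntgt a) f))
               = cod (napp b (dom (fa (ntgt a) f)))) by bdry.
  assert (k1 : dom (fa (nsrc b) (napp a (cod f)))
               = cod (fa (nsrc b) (fa (nsrc a) f))) by bdry.
  assert (k2 : dom (fa (nsrc b) (fa (ntgt a) f))
               = cod (fa (nsrc b) (napp a (dom f)))) by bdry.
  pose proof (napp_nat h1 h2) as Na; pose proof (napp_nat h3 h4) as Nb.
  apply (f_equal (fa (nsrc b))) in Na.
  rewrite (fa_cmp h1 k1), (fa_cmp h2 k2) in Na.
  rewrite cmp_assocR; etransitivity; [|symmetry; apply cmp_assocL].
  unshelve etransitivity;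
    [refine (cmp (napp b (fo (ntgt a) (cod f)))
               (cmp (fa (nsrc b) (fa (ntgt a) f)) (fa (nsrc b) (napp a (dom f))) k2) _);
     bdry
    |apply cmp_eq; [reflexivity|via_cmp Na]|].
  etransitivity; [apply cmp_assocL|].
  apply cmp_eq; [|reflexivity].
  via_cmp Nb.
Defined.
Lemma cmp_swap (A : cat) (p q u v q' u' : arr A) e1 e2 e3 e1' e2' e3' d d' :
  cmp q u d = cmp q' u' d' ->
  cmp (cmp p q e1) (cmp u v e2) e3 = cmp (cmp p q' e1') (cmp u' v e2') e3'.
Proof.
intros E.
rewrite (@cmp_assocR A p q), (@cmp_assocR A p q'); apply cmp_eq; [reflexivity|].
rewrite (@cmp_assocL A q u), (@cmp_assocL A q' u'); apply cmp_eq; [|reflexivity].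
via_cmp E.
Qed.

Lemma hcomp_id (A B C : cat) (G : fctor B C) (F : fctor A B) :
  hcomp (nt_id G) (nt_id F) = nt_id (fctor_comp G F).
Proof.
apply nt_eq; try reflexivity; intros x; cbn.
rewrite cmp_idl', fa_idn; reflexivity.
Qed.

Lemma hcomp_vcomp (A B C : cat) (b' b : nt B C) (a' a : nt A B) e1 e2 e3 :
  hcomp (@vcomp B C b' b e1) (@vcomp A B a' a e2)
  = @vcomp A C (hcomp b' a') (hcomp b a) e3.
Proof.
apply nt_eq; try reflexivity; intros x; cbn.
assert (h : dom (napp a' x) = cod (napp a x)) by bdry.
assert (k : dom (fa (nsrc b) (napp a' x)) = cod (fa (nsrc b) (napp a x))) by bdry.
assert (l : dom (napp b' (fo (ntgt a') x)) = cod (napp b (fo (ntgt a') x))) by bdry.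
assert (m : dom (cmp (napp b' (fo (ntgt a') x)) (napp b (fo (ntgt a') x)) l)
            = cod (cmp (fa (nsrc b) (napp a' x)) (fa (nsrc b) (napp a x)) k)) by bdry.
transitivity (cmp (cmp (napp b' (fo (ntgt a') x)) (napp b (fo (ntgt a') x)) l)
                (cmp (fa (nsrc b) (napp a' x)) (fa (nsrc b) (napp a x)) k) m).
{ apply cmp_eq; [apply cmp_eq; reflexivity|].
  rewrite <- (fa_cmp h k); f_equal; apply cmp_eq; reflexivity. }
assert (h1 : dom (napp b (cod (napp a' x))) = cod (fa (nsrc b) (napp a' x))) by bdry.
assert (h2 : dom (fa (ntgt b) (napp a' x)) = cod (napp b (dom (napp a' x)))) by bdry.
pose proof (napp_nat h1 h2) as N.
assert (E : fa (nsrc b') (napp a' x) = fa (ntgt b) (napp a' x)) by (rewrite e1; reflexivity).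
assert (E' : fo (ntgt a) x = dom (napp a' x)) by bdry.
assert (E'' : fo (ntgt a') x = cod (napp a' x)) by bdry.
unshelve eapply cmp_swap.
- bdry.
- bdry.
- etransitivity; [|etransitivity; [exact N|]]; apply cmp_eq; congruence.
Qed.

Definition hcomp_fctor (A B C : cat) :
  fctor (prod_cat (fun_cat B C) (fun_cat A B)) (fun_cat A C).
Proof.
refine (@Fctor (prod_cat (fun_cat B C) (fun_cat A B)) (fun_cat A C)
  (fun F => fctor_comp (fst F) (snd F)) (fun a => hcomp (fst a) (snd a)) _ _ _ _);
  try reflexivity.
- intros [G F]; apply hcomp_id.
- intros [b' a'] [b a] e e'; apply hcomp_vcomp.
Defined.

Lemma fctor_comp_idl (A B : cat) (F : fctor A B) : fctor_comp (fctor_id B) F = F.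
Proof. apply feq_eq; split; reflexivity. Qed.
Lemma fctor_comp_idr (A B : cat) (F : fctor A B) : fctor_comp F (fctor_id A) = F.
Proof. apply feq_eq; split; reflexivity. Qed.
Lemma fctor_comp_assoc (A B C D : cat) (H : fctor C D) (G : fctor B C)
  (F : fctor A B) :
  fctor_comp H (fctor_comp G F) = fctor_comp (fctor_comp H G) F.
Proof. apply feq_eq; split; reflexivity. Qed.

Definition CAT : twocat.
Proof.
refine {| tob := cat; thom := fun_cat; tid := fctor_id; tcmp := hcomp_fctor |}.
- intros A B F; exact (fctor_comp_idl F).
- intros A B a; refine (@nt_eq A B _ _ _ _ _); try apply fctor_comp_idl.
  intros x; apply cmp_idl'.
- intros A B F; exact (fctor_comp_idr F).
- intros A B a; refine (@nt_eq A B _ _ _ _ _); try apply fctor_comp_idr.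
  intros x; cbn.
  assert (h : dom (napp a x) = cod (idn (fo (nsrc a) x))) by bdry.
  etransitivity; [|exact (cmp_idr' h)].
  apply cmp_eq; [reflexivity|exact (fa_idn (nsrc a) x)].
- intros A B C D H G F; exact (fctor_comp_assoc H G F).
- intros A B C D c b a; refine (@nt_eq A D _ _ _ _ _); try apply fctor_comp_assoc.
  intros x; cbn.
  assert (h : dom (fa (nsrc c) (napp b (fo (ntgt a) x)))
              = cod (fa (nsrc c) (fa (nsrc b) (napp a x)))) by bdry.
  rewrite (@cmp_assocR D); apply cmp_eq; [reflexivity|].
  rewrite (fa_cmp _ h); apply cmp_eq; reflexivity.
Defined.

(* Objects of  [G^op, Cat], by generators and relations as for [gset].  The
   equalities of functors are componentwise, so that [Ob_int_obj] and
   [Ar_int_obj] below hold definitionally. *)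
Record gcat := GCat {
  lev : nat -> cat;
  lev_s : forall n, fctor (lev (S n)) (lev n);
  lev_t : forall n, fctor (lev (S n)) (lev n);
  lev_ss : forall n, feq (fctor_comp (lev_s n) (lev_s (S n)))
                         (fctor_comp (lev_s n) (lev_t (S n)));
  lev_tt : forall n, feq (fctor_comp (lev_t n) (lev_t (S n)))
                         (fctor_comp (lev_t n) (lev_s (S n))) }.

Arguments lev X n : rename.
Arguments lev_s X n : rename.
Arguments lev_t X n : rename.

Record gfun (X Y : gcat) := GFun {
  gf : forall n, fctor (lev X n) (lev Y n);
  gf_s : forall n, fctor_comp (lev_s Y n) (gf (S n)) = fctor_comp (gf n) (lev_s X n);
  gf_t : forall n, fctor_comp (lev_t Y n) (gf (S n)) = fctor_comp (gf n) (lev_t X n) }.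

Arguments gf {X Y} f n : rename.

(* The 2-cells of  [G^op, Cat]:  2-natural transformations between Cat-valued
   functors have modifications as their 2-cells. *)
Record gmod (X Y : gcat) := GMod {
  msrc : gfun X Y;
  mtgt : gfun X Y;
  mapp : forall n, nt (lev X n) (lev Y n);
  mapp_src : forall n, nsrc (mapp n) = gf msrc n;
  mapp_tgt : forall n, ntgt (mapp n) = gf mtgt n;
  mapp_s : forall n,
    hcomp (nt_id (lev_s Y n)) (mapp (S n)) = hcomp (mapp n) (nt_id (lev_s X n));
  mapp_t : forall n,
    hcomp (nt_id (lev_t Y n)) (mapp (S n)) = hcomp (mapp n) (nt_id (lev_t X n)) }.

Arguments mapp {X Y} a n : rename.

Lemma gfun_eq (X Y : gcat) (f g : gfun X Y) : (forall n, gf f n = gf g n) -> f = g.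
Proof.
destruct f as [f fs ft], g as [g gs' gt']; cbn; intros E.
apply functional_extensionality_dep in E; subst g.
f_equal; apply proof_irrelevance.
Qed.

Lemma gmod_eq (X Y : gcat) (a b : gmod X Y) :
  msrc a = msrc b -> mtgt a = mtgt b -> (forall n, mapp a n = mapp b n) -> a = b.
Proof.
destruct a as [f g a a1 a2 a3 a4], b as [f' g' b b1 b2 b3 b4]; cbn.
intros <- <- E; apply functional_extensionality_dep in E; subst b.
f_equal; apply proof_irrelevance.
Qed.

Definition gfun_id (X : gcat) : gfun X X.
Proof.
refine {| gf := fun n => fctor_id (lev X n) |};
  intros n; apply feq_eq; split; reflexivity.
Defined.

Definition gfun_comp (X Y Z : gcat) (g : gfun Y Z) (f : gfun X Y) : gfun X Z.
Proof.
refine {| gf := fun n => fctor_comp (gf g n) (gf f n) |}.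
- intros n; rewrite fctor_comp_assoc, gf_s, <- !fctor_comp_assoc, gf_s; reflexivity.
- intros n; rewrite fctor_comp_assoc, gf_t, <- !fctor_comp_assoc, gf_t; reflexivity.
Defined.

Definition gmod_id (X Y : gcat) (f : gfun X Y) : gmod X Y.
Proof.
refine {| msrc := f; mtgt := f; mapp := fun n => nt_id (gf f n) |}; try reflexivity.
- intros n; rewrite !hcomp_id, gf_s; reflexivity.
- intros n; rewrite !hcomp_id, gf_t; reflexivity.
Defined.

Lemma gmod_vcomp_ok (X Y : gcat) (b a : gmod X Y) (e : msrc b = mtgt a) n :
  nsrc (mapp b n) = ntgt (mapp a n).
Proof. rewrite mapp_src, mapp_tgt, e; reflexivity. Qed.

Lemma nt_id_vcomp (A B : cat) (F : fctor A B) :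
  nt_id F = @vcomp A B (nt_id F) (nt_id F) eq_refl.
Proof.
apply nt_eq; try reflexivity; intros x; cbn; rewrite cmp_idl'; reflexivity.
Qed.

Lemma whisker_vcomp (A A' B B' : cat) (S : fctor B B') (S' : fctor A A')
  (b a : nt A B) (b' a' : nt A' B') e e' :
  hcomp (nt_id S) b = hcomp b' (nt_id S') ->
  hcomp (nt_id S) a = hcomp a' (nt_id S') ->
  hcomp (nt_id S) (@vcomp A B b a e) = hcomp (@vcomp A' B' b' a' e') (nt_id S').
Proof.
intros Eb Ea.
assert (k : nsrc (hcomp (nt_id S) b) = ntgt (hcomp (nt_id S) a))
  by (cbn; rewrite e; reflexivity).
assert (k' : nsrc (hcomp b' (nt_id S')) = ntgt (hcomp a' (nt_id S')))
  by (cbn; rewrite e'; reflexivity).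
rewrite (nt_id_vcomp S), (nt_id_vcomp S').
rewrite (hcomp_vcomp _ _ k), (hcomp_vcomp _ _ k').
exact (@cmp_eq (fun_cat A B') _ _ _ _ k k' Eb Ea).
Qed.

Definition gmod_vcomp (X Y : gcat) (b a : gmod X Y) (e : msrc b = mtgt a) :
  gmod X Y.
Proof.
refine {| msrc := msrc a; mtgt := mtgt b;
          mapp := fun n => vcomp (gmod_vcomp_ok e n) |}.
- intros n; apply mapp_src.
- intros n; apply mapp_tgt.
- intros n; apply whisker_vcomp; apply mapp_s.
- intros n; apply whisker_vcomp; apply mapp_t.
Defined.

Definition gfun_cat (X Y : gcat) : cat.
Proof.
refine {| obj := gfun X Y; arr := gmod X Y; dom := @msrc X Y; cod := @mtgt X Y;
          idn := @gmod_id X Y; cmp := @gmod_vcomp X Y |}; try reflexivity.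
- intros f e; apply gmod_eq; try reflexivity.
  intros n; apply (@cmp_idl' (fun_cat _ _)).
- intros f e; apply gmod_eq; try reflexivity.
  intros n; apply (@cmp_idr' (fun_cat _ _)).
- intros h g f e1 e2 e3 e4; apply gmod_eq; try reflexivity.
  intros n; apply (@cmp_assoc (fun_cat _ _)).
Defined.

Lemma hcomp_assoc (A B C D : cat) (c : nt C D) (b : nt B C) (a : nt A B) :
  hcomp c (hcomp b a) = hcomp (hcomp c b) a.
Proof. exact (tassoc2 (t := CAT) c b a). Qed.

Definition gmod_hcomp (X Y Z : gcat) (b : gmod Y Z) (a : gmod X Y) : gmod X Z.
Proof.
refine {| msrc := gfun_comp (msrc b) (msrc a);
          mtgt := gfun_comp (mtgt b) (mtgt a);
          mapp := fun n => hcomp (mapp b n) (mapp a n) |}.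
- intros n; cbn; rewrite !mapp_src; reflexivity.
- intros n; cbn; rewrite !mapp_tgt; reflexivity.
- intros n; rewrite hcomp_assoc, mapp_s, <- !hcomp_assoc, mapp_s; reflexivity.
- intros n; rewrite hcomp_assoc, mapp_t, <- !hcomp_assoc, mapp_t; reflexivity.
Defined.

Definition gmod_hcomp_fctor (X Y Z : gcat) :
  fctor (prod_cat (gfun_cat Y Z) (gfun_cat X Y)) (gfun_cat X Z).
Proof.
refine (@Fctor (prod_cat (gfun_cat Y Z) (gfun_cat X Y)) (gfun_cat X Z)
  (fun F => gfun_comp (fst F) (snd F)) (fun a => gmod_hcomp (fst a) (snd a))
  _ _ _ _); try reflexivity.
- intros [g f]; apply gmod_eq; try reflexivity. intros n; apply hcomp_id.
- intros [b' a'] [b a] e e'; apply gmod_eq; try reflexivity.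
  intros n; apply hcomp_vcomp.
Defined.

Definition GCAT : twocat.
Proof.
refine {| tob := gcat; thom := gfun_cat; tid := gfun_id;
          tcmp := gmod_hcomp_fctor |}.
- intros X Y f; apply gfun_eq; intros n; apply fctor_comp_idl.
- intros X Y a; apply gmod_eq.
  + apply gfun_eq; intros n; apply fctor_comp_idl.
  + apply gfun_eq; intros n; apply fctor_comp_idl.
  + intros n; exact (tidl2 (t := CAT) (mapp a n)).
- intros X Y f; apply gfun_eq; intros n; apply fctor_comp_idr.
- intros X Y a; apply gmod_eq.
  + apply gfun_eq; intros n; apply fctor_comp_idr.
  + apply gfun_eq; intros n; apply fctor_comp_idr.
  + intros n; exact (tidr2 (t := CAT) (mapp a n)).
- intros X Y Z W h g f; apply gfun_eq; intros n; apply fctor_comp_assoc.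
- intros X Y Z W c b a; apply gmod_eq.
  + apply gfun_eq; intros n; apply fctor_comp_assoc.
  + apply gfun_eq; intros n; apply fctor_comp_assoc.
  + intros n; apply hcomp_assoc.
Defined.

(* [glob_] : postcomposition of  X : G^op -> Cat  with a 2-functor on [CAT]. *)
Definition glob_obj (C : functor2 CAT CAT) (X : gcat) : gcat.
Proof.
refine (@GCat (fun n => f2ob C (lev X n) : cat)
  (fun n => f2_1 C (lev_s X n : obj (thom CAT _ _)))
  (fun n => f2_1 C (lev_t X n : obj (thom CAT _ _))) _ _).
- intros n; apply eq_feq.
  etransitivity; [symmetry; apply (f2_c1 C)|].
  etransitivity; [|apply (f2_c1 C)].
  exact (f_equal (fo (f2hom C _ _)) (feq_eq (lev_ss X n))).
- intros n; apply eq_feq.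
  etransitivity; [symmetry; apply (f2_c1 C)|].
  etransitivity; [|apply (f2_c1 C)].
  exact (f_equal (fo (f2hom C _ _)) (feq_eq (lev_tt X n))).
Defined.

Definition glob_1 (C : functor2 CAT CAT) (X Y : gcat) (f : gfun X Y) :
  gfun (glob_obj C X) (glob_obj C Y).
Proof.
refine (@GFun (glob_obj C X) (glob_obj C Y)
  (fun n => f2_1 C (gf f n : obj (thom CAT _ _))) _ _).
- intros n.
  etransitivity; [symmetry; apply (f2_c1 C)|].
  etransitivity; [|apply (f2_c1 C)].
  exact (f_equal (fo (f2hom C _ _)) (gf_s f n)).
- intros n.
  etransitivity; [symmetry; apply (f2_c1 C)|].
  etransitivity; [|apply (f2_c1 C)].
  exact (f_equal (fo (f2hom C _ _)) (gf_t f n)).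
Defined.

Lemma glob_whisker (C : functor2 CAT CAT) (A A' B B' : cat)
  (S : fctor B B') (S' : fctor A A') (a : nt A B) (a' : nt A' B') :
  hcomp (nt_id S) a = hcomp a' (nt_id S') ->
  @hcomp (f2ob C A) (f2ob C B) (f2ob C B')
     (nt_id (f2_1 C (S : obj (thom CAT _ _)))) (f2_2 C (a : arr (thom CAT _ _)))
  = @hcomp (f2ob C A) (f2ob C A') (f2ob C B')
     (f2_2 C (a' : arr (thom CAT _ _))) (nt_id (f2_1 C (S' : obj (thom CAT _ _)))).
Proof.
intros E.
pose proof (fa_idn (f2hom C B B') S) as I; cbn in I.
pose proof (fa_idn (f2hom C A A') S') as I'; cbn in I'.
unfold f2_1; rewrite <- I, <- I'.
etransitivity; [symmetry; exact (f2_c2 C (nt_id S : arr (thom CAT _ _)) a)|].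
etransitivity; [|exact (f2_c2 C (a' : arr (thom CAT _ _)) (nt_id S'))].
exact (f_equal (fa (f2hom C _ _)) E).
Qed.

Definition glob_2 (C : functor2 CAT CAT) (X Y : gcat) (a : gmod X Y) :
  gmod (glob_obj C X) (glob_obj C Y).
Proof.
refine (@GMod (glob_obj C X) (glob_obj C Y) (glob_1 C (msrc a)) (glob_1 C (mtgt a))
  (fun n => f2_2 C (mapp a n : arr (thom CAT _ _))) _ _ _ _).
- intros n. etransitivity; [apply (fa_dom (f2hom C _ _))|].
  exact (f_equal (fo (f2hom C _ _)) (mapp_src a n)).
- intros n. etransitivity; [apply (fa_cod (f2hom C _ _))|].
  exact (f_equal (fo (f2hom C _ _)) (mapp_tgt a n)).
- intros n; apply glob_whisker, mapp_s.
- intros n; apply glob_whisker, mapp_t.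
Defined.

Definition glob_hom (C : functor2 CAT CAT) (X Y : gcat) :
  fctor (gfun_cat X Y) (gfun_cat (glob_obj C X) (glob_obj C Y)).
Proof.
refine (@Fctor (gfun_cat X Y) (gfun_cat (glob_obj C X) (glob_obj C Y))
  (@glob_1 C X Y) (@glob_2 C X Y) _ _ _ _); try reflexivity.
- intros f; apply gmod_eq; try reflexivity.
  intros n; exact (fa_idn (f2hom C _ _) (gf f n)).
- intros b a e e'; apply gmod_eq; try reflexivity.
  intros n; exact (@fa_cmp _ _ (f2hom C (lev X n) (lev Y n)) _ _ _ _).
Defined.

Definition glob_functor (C : functor2 CAT CAT) : functor2 GCAT GCAT.
Proof.
refine (@Functor2 GCAT GCAT (glob_obj C) (glob_hom C) _ _ _).
- intros X; apply gfun_eq; intros n; apply (f2_id C).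
- intros X Y Z g f; apply gfun_eq; intros n; apply (f2_c1 C).
- intros X Y Z b a; apply gmod_eq.
  + apply gfun_eq; intros n; apply (f2_c1 C).
  + apply gfun_eq; intros n; apply (f2_c1 C).
  + intros n; apply (f2_c2 C).
Defined.

Definition glob_unit (C : monad2 CAT) :
  nat2 (functor2_id GCAT) (glob_functor (m2fun C)).
Proof.
unshelve refine (@Nat2 GCAT GCAT (functor2_id GCAT) (glob_functor (m2fun C))
  (fun X => @GFun X (glob_obj (m2fun C) X)
              (fun n => n2app (m2unit C) (lev X n)) _ _) _ _).
- intros n; symmetry; exact (n2nat1 (m2unit C) (lev_s X n : obj (thom CAT _ _))).
- intros n; symmetry; exact (n2nat1 (m2unit C) (lev_t X n : obj (thom CAT _ _))).
- intros X Y f; apply gfun_eq; intros n.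
  exact (n2nat1 (m2unit C) (gf f n : obj (thom CAT _ _))).
- intros X Y a; apply gmod_eq.
  + apply gfun_eq; intros n.
    exact (n2nat1 (m2unit C) (gf (msrc a) n : obj (thom CAT _ _))).
  + apply gfun_eq; intros n.
    exact (n2nat1 (m2unit C) (gf (mtgt a) n : obj (thom CAT _ _))).
  + intros n; exact (n2nat2 (m2unit C) (mapp a n : arr (thom CAT _ _))).
Defined.

Definition glob_mult (C : monad2 CAT) :
  nat2 (functor2_comp (glob_functor (m2fun C)) (glob_functor (m2fun C)))
       (glob_functor (m2fun C)).
Proof.
unshelve refine (@Nat2 GCAT GCAT
  (functor2_comp (glob_functor (m2fun C)) (glob_functor (m2fun C)))
  (glob_functor (m2fun C))
  (fun X => @GFun (glob_obj (m2fun C) (glob_obj (m2fun C) X)) (glob_obj (m2fun C) X)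
              (fun n => n2app (m2mult C) (lev X n)) _ _) _ _).
- intros n; symmetry; exact (n2nat1 (m2mult C) (lev_s X n : obj (thom CAT _ _))).
- intros n; symmetry; exact (n2nat1 (m2mult C) (lev_t X n : obj (thom CAT _ _))).
- intros X Y f; apply gfun_eq; intros n.
  exact (n2nat1 (m2mult C) (gf f n : obj (thom CAT _ _))).
- intros X Y a; apply gmod_eq.
  + apply gfun_eq; intros n.
    exact (n2nat1 (m2mult C) (gf (msrc a) n : obj (thom CAT _ _))).
  + apply gfun_eq; intros n.
    exact (n2nat1 (m2mult C) (gf (mtgt a) n : obj (thom CAT _ _))).
  + intros n; exact (n2nat2 (m2mult C) (mapp a n : arr (thom CAT _ _))).
Defined.

Definition glob_monad (C : monad2 CAT) : monad2 GCAT.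
Proof.
refine (@Monad2 GCAT (glob_functor (m2fun C)) (glob_unit C) (glob_mult C) _ _ _);
  intros X; apply gfun_eq; intros n.
- apply (m2unit_l C).
- apply (m2unit_r C).
- apply (m2mult_assoc C).
Defined.

Definition fm (F : functor GSET GSET) (A B : gset) (f : ghom A B) n
  (x : cell (fob F A) n) : cell (fob F B) n :=
  gmap (fmap F (f : hom GSET A B)) x.

Arguments fm F {A B} f {n} x.

Lemma fm_comp (F : functor GSET GSET) (A B C : gset) (g : ghom B C)
  (f : ghom A B) n (x : cell (fob F A) n) :
  fm F g (fm F f x)
  = fm F (ghom_comp g f) x.
Proof.
exact (f_equal (fun h : ghom _ _ => gmap h x) (eq_sym (@fmap_comp _ _ F A B C g f))).
Qed.

Lemma fm_id (F : functor GSET GSET) (A : gset) n (x : cell (fob F A) n) :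
  fm F (ghom_id A) x = x.
Proof. exact (f_equal (fun h : ghom _ _ => gmap h x) (@fmap_id _ _ F A)). Qed.

Lemma fm_ext (F : functor GSET GSET) (A B : gset) (f g : ghom A B)
  (E : forall n (x : cell A n), gmap f x = gmap g x) n (x : cell (fob F A) n) :
  fm F f x = fm F g x.
Proof. rewrite (ghom_eq E); reflexivity. Qed.

Lemma gpb_s (A B Z : gset) (f : ghom A Z) (g : ghom B Z) n
  (z : {p : cell A (S n) * cell B (S n) | gmap f (fst p) = gmap g (snd p)}) :
  gmap f (gs (fst (proj1_sig z))) = gmap g (gs (snd (proj1_sig z))).
Proof. destruct z as [p e]; cbn. rewrite <- !gmap_s, e; reflexivity. Qed.

Lemma gpb_t (A B Z : gset) (f : ghom A Z) (g : ghom B Z) n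
  (z : {p : cell A (S n) * cell B (S n) | gmap f (fst p) = gmap g (snd p)}) :
  gmap f (gt (fst (proj1_sig z))) = gmap g (gt (snd (proj1_sig z))).
Proof. destruct z as [p e]; cbn. rewrite <- !gmap_t, e; reflexivity. Qed.

Definition gpb (A B Z : gset) (f : ghom A Z) (g : ghom B Z) : gset.
Proof.
refine (@GSet
  (fun n => {p : cell A n * cell B n | gmap f (fst p) = gmap g (snd p)})
  (fun n z => exist _ (gs (fst (proj1_sig z)), gs (snd (proj1_sig z))) (gpb_s z))
  (fun n z => exist _ (gt (fst (proj1_sig z)), gt (snd (proj1_sig z))) (gpb_t z))
  _ _).
- intros n z; apply subset_eq_compat; cbn; f_equal; apply gs_glob.
- intros n z; apply subset_eq_compat; cbn; f_equal; apply gt_glob.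
Defined.

Lemma gpb_ext (A B Z : gset) (f : ghom A Z) (g : ghom B Z) n
  (z z' : cell (gpb f g) n) :
  fst (proj1_sig z) = fst (proj1_sig z') -> snd (proj1_sig z) = snd (proj1_sig z') ->
  z = z'.
Proof.
destruct z as [[a b] e], z' as [[a' b'] e']; cbn; intros -> ->.
apply subset_eq_compat; reflexivity.
Qed.

Definition gpb1 (A B Z : gset) (f : ghom A Z) (g : ghom B Z) : ghom (gpb f g) A.
Proof.
refine (@GHom (gpb f g) A (fun n z => fst (proj1_sig z)) _ _); reflexivity.
Defined.

Definition gpb2 (A B Z : gset) (f : ghom A Z) (g : ghom B Z) : ghom (gpb f g) B.
Proof.
refine (@GHom (gpb f g) B (fun n z => snd (proj1_sig z)) _ _); reflexivity.
Defined.

Definition gpb_pair (A B Z W : gset) (f : ghom A Z) (g : ghom B Z)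
  (a : ghom W A) (b : ghom W B)
  (E : forall n (x : cell W n), gmap f (gmap a x) = gmap g (gmap b x)) :
  ghom W (gpb f g).
Proof.
refine (@GHom W (gpb f g) (fun n x => exist _ (gmap a x, gmap b x) (E n x)) _ _);
  intros n x; apply subset_eq_compat; cbn; rewrite ?gmap_s, ?gmap_t; reflexivity.
Defined.

Lemma gpb_is_pullback (A B Z : gset) (f : ghom A Z) (g : ghom B Z) :
  @is_pullback GSET A B Z (gpb f g) f g (gpb1 f g) (gpb2 f g).
Proof.
split.
- apply ghom_eq; intros n [p e]; exact e.
- intros W a b E.
  assert (E' : forall n (x : cell W n), gmap f (gmap a x) = gmap g (gmap b x))
    by (intros n x; exact (f_equal (fun h : ghom _ _ => gmap h x) E)).
  exists (gpb_pair E'); split; [split; apply ghom_eq; reflexivity|].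
  intros u [<- <-]; apply ghom_eq; intros n x; cbn.
  apply gpb_ext; reflexivity.
Qed.

Lemma is_pullback_cell (A B Z P : gset) (f : ghom A Z) (g : ghom B Z)
  (p : ghom P A) (q : ghom P B) :
  @is_pullback GSET A B Z P f g p q ->
  forall n (a : cell A n) (b : cell B n), gmap f a = gmap g b ->
    exists! z : cell P n, gmap p z = a /\ gmap q z = b.
Proof.
intros [E U] n a b e.
destruct (gpb_is_pullback f g) as [E0 _].
destruct (U (gpb f g) (gpb1 f g) (gpb2 f g) E0) as [u [[u1 u2] _]].
assert (E' : forall n (x : cell P n), gmap f (gmap p x) = gmap g (gmap q x))
  by (intros m x; exact (f_equal (fun h : ghom _ _ => gmap h x) E)).
set (v := gpb_pair E').
assert (uv : ghom_comp u v = ghom_id P).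
{ destruct (U P p q E) as [w [_ w_uniq]].
  transitivity w; [symmetry|]; apply w_uniq.
  - split.
    + transitivity (ghom_comp (gpb1 f g) v); [|apply ghom_eq; reflexivity].
      rewrite <- u1; apply ghom_eq; reflexivity.
    + transitivity (ghom_comp (gpb2 f g) v); [|apply ghom_eq; reflexivity].
      rewrite <- u2; apply ghom_eq; reflexivity.
  - split; apply ghom_eq; reflexivity. }
exists (gmap u (exist _ (a, b) e : cell (gpb f g) n)); split.
- split.
  + exact (f_equal (fun h : ghom _ _ => gmap h (exist _ (a, b) e : cell (gpb f g) n)) u1).
  + exact (f_equal (fun h : ghom _ _ => gmap h (exist _ (a, b) e : cell (gpb f g) n)) u2).
- intros z [<- <-].
  etransitivity; [|exact (f_equal (fun h : ghom _ _ => gmap h z) uv)].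
  cbn; f_equal; apply gpb_ext; reflexivity.
Qed.

(* The inverse of the comparison  F (A x_Z B) -> F A x_{F Z} F B. *)
Lemma fpair_ex (F : functor GSET GSET) (hF : preserves_pullbacks F)
  (A B Z : gset) (f : ghom A Z) (g : ghom B Z) n
  (a : cell (fob F A) n) (b : cell (fob F B) n)
  (e : fm F f a = fm F g b) :
  exists! z : cell (fob F (gpb f g)) n,
    fm F (gpb1 f g) z = a /\
    fm F (gpb2 f g) z = b.
Proof. exact (is_pullback_cell (hF _ _ _ _ _ _ _ _ (gpb_is_pullback f g)) e). Qed.

Definition fpair (F : functor GSET GSET) (hF : preserves_pullbacks F)
  (A B Z : gset) (f : ghom A Z) (g : ghom B Z) n
  (a : cell (fob F A) n) (b : cell (fob F B) n)
  (e : fm F f a = fm F g b) :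
  cell (fob F (gpb f g)) n :=
  proj1_sig (constructive_indefinite_description _ (fpair_ex hF e)).

Lemma fpair_unique (F : functor GSET GSET) (hF : preserves_pullbacks F)
  (A B Z : gset) (f : ghom A Z) (g : ghom B Z) n
  (a : cell (fob F A) n) (b : cell (fob F B) n)
  (e : fm F f a = fm F g b) z :
  fm F (gpb1 f g) z = a ->
  fm F (gpb2 f g) z = b ->
  fpair hF e = z.
Proof.
intros E1 E2; unfold fpair.
destruct (constructive_indefinite_description _ _) as [w [W U]]; cbn.
apply U; split; assumption.
Qed.

Lemma fpair_proj (F : functor GSET GSET) (hF : preserves_pullbacks F)
  (A B Z : gset) (f : ghom A Z) (g : ghom B Z) n
  (a : cell (fob F A) n) (b : cell (fob F B) n)
  (e : fm F f a = fm F g b) :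
  fm F (gpb1 f g) (fpair hF e) = a /\ fm F (gpb2 f g) (fpair hF e) = b.
Proof.
unfold fpair.
destruct (constructive_indefinite_description _ _) as [w [W U]]; exact W.
Qed.

(* [Ob X], [Ar X], [Dom X], [Cod X], [Idn X], [Cmp X] exhibit [X] as a category
   internal to [GSET], along  Cat([G^op, Set]) = [G^op, Cat]. *)
Definition Ob (X : gcat) : gset :=
  {| cell := fun n => obj (lev X n);
     gs := fun n x => fo (lev_s X n) x;
     gt := fun n x => fo (lev_t X n) x;
     gs_glob := fun n x => feq_fo (lev_ss X n) x;
     gt_glob := fun n x => feq_fo (lev_tt X n) x |}.

Definition Ar (X : gcat) : gset :=
  {| cell := fun n => arr (lev X n);
     gs := fun n x => fa (lev_s X n) x;
     gt := fun n x => fa (lev_t X n) x;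
     gs_glob := fun n x => feq_fa (lev_ss X n) x;
     gt_glob := fun n x => feq_fa (lev_tt X n) x |}.

Definition Dom (X : gcat) : ghom (Ar X) (Ob X) :=
  @GHom (Ar X) (Ob X) (fun n f => dom f)
    (fun n f => eq_sym (fa_dom (lev_s X n) f))
    (fun n f => eq_sym (fa_dom (lev_t X n) f)).

Definition Cod (X : gcat) : ghom (Ar X) (Ob X) :=
  @GHom (Ar X) (Ob X) (fun n f => cod f)
    (fun n f => eq_sym (fa_cod (lev_s X n) f))
    (fun n f => eq_sym (fa_cod (lev_t X n) f)).

Definition Idn (X : gcat) : ghom (Ob X) (Ar X) :=
  @GHom (Ob X) (Ar X) (fun n x => idn x)
    (fun n x => fa_idn (lev_s X n) x)
    (fun n x => fa_idn (lev_t X n) x).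

(* Pairs [(g, f)] with [dom g = cod f]. *)
Definition Comp (X : gcat) : gset := gpb (Dom X) (Cod X).
Definition Comp1 (X : gcat) : ghom (Comp X) (Ar X) := gpb1 (Dom X) (Cod X).
Definition Comp2 (X : gcat) : ghom (Comp X) (Ar X) := gpb2 (Dom X) (Cod X).

Definition Cmp (X : gcat) : ghom (Comp X) (Ar X).
Proof.
refine (@GHom (Comp X) (Ar X)
  (fun n z => cmp (fst (proj1_sig z)) (snd (proj1_sig z)) (proj2_sig z)) _ _).
- intros n [[g f] e]; apply fa_cmp.
- intros n [[g f] e]; apply fa_cmp.
Defined.

Definition Ob1 (X Y : gcat) (f : gfun X Y) : ghom (Ob X) (Ob Y) :=
  @GHom (Ob X) (Ob Y) (fun n x => fo (gf f n) x)
    (fun n x => feq_fo (eq_feq (gf_s f n)) x)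
    (fun n x => feq_fo (eq_feq (gf_t f n)) x).

Definition Ar1 (X Y : gcat) (f : gfun X Y) : ghom (Ar X) (Ar Y) :=
  @GHom (Ar X) (Ar Y) (fun n x => fa (gf f n) x)
    (fun n x => feq_fa (eq_feq (gf_s f n)) x)
    (fun n x => feq_fa (eq_feq (gf_t f n)) x).

Lemma whisker_napp (A A' B B' : cat) (S : fctor B B') (S' : fctor A A')
  (a : nt A B) (a' : nt A' B') :
  hcomp (nt_id S) a = hcomp a' (nt_id S') ->
  forall x, fa S (napp a x) = napp a' (fo S' x).
Proof.
intros E x.
pose proof (f_equal (fun b => napp b x) E) as Ex; cbn in Ex.
rewrite cmp_idl' in Ex; rewrite Ex.
assert (h : dom (napp a' (fo S' x)) = cod (idn (fo (nsrc a') (fo S' x)))) by bdry.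
etransitivity; [|exact (cmp_idr' h)].
apply cmp_eq; [reflexivity|exact (fa_idn (nsrc a') (fo S' x))].
Qed.

Lemma napp_whisker (A A' B B' : cat) (S : fctor B B') (S' : fctor A A')
  (a : nt A B) (a' : nt A' B') :
  fctor_comp S (nsrc a) = fctor_comp (nsrc a') S' ->
  fctor_comp S (ntgt a) = fctor_comp (ntgt a') S' ->
  (forall x, fa S (napp a x) = napp a' (fo S' x)) ->
  hcomp (nt_id S) a = hcomp a' (nt_id S').
Proof.
intros E1 E2 E; apply nt_eq; [exact E1|exact E2|intros x; cbn].
rewrite cmp_idl', E.
assert (h : dom (napp a' (fo S' x)) = cod (idn (fo (nsrc a') (fo S' x)))) by bdry.
symmetry; etransitivity; [|exact (cmp_idr' h)].
apply cmp_eq; [reflexivity|exact (fa_idn (nsrc a') (fo S' x))].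
Qed.

Definition Mod (X Y : gcat) (a : gmod X Y) : ghom (Ob X) (Ar Y) :=
  @GHom (Ob X) (Ar Y) (fun n x => napp (mapp a n) x)
    (fun n x => whisker_napp (mapp_s a n) x)
    (fun n x => whisker_napp (mapp_t a n) x).

(* Composition of the internal category  F X :  the image under [F] of that of
   [X], along the isomorphism  F (Comp X) = F (Ar X) x_{F (Ob X)} F (Ar X). *)
Definition icmp (F : functor GSET GSET) (hF : preserves_pullbacks F) (X : gcat) n
  (g f : cell (fob F (Ar X)) n) (e : fm F (Dom X) g = fm F (Cod X) f) :
  cell (fob F (Ar X)) n :=
  fm F (Cmp X) (fpair hF e).

Lemma icmp_fm (F : functor GSET GSET) (hF : preserves_pullbacks F) (X : gcat)
  (W : gset) (u v : ghom W (Ar X))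
  (E : forall n (x : cell W n), gmap (Dom X) (gmap u x) = gmap (Cod X) (gmap v x))
  n (x : cell (fob F W) n) g f e :
  g = fm F u x -> f = fm F v x ->
  @icmp F hF X n g f e = fm F (ghom_comp (Cmp X) (gpb_pair E)) x.
Proof.
intros -> ->; unfold icmp. rewrite <- fm_comp; f_equal.
apply fpair_unique; rewrite fm_comp; apply fm_ext; reflexivity.
Qed.

Lemma icmp_Comp (F : functor GSET GSET) (hF : preserves_pullbacks F) (X : gcat)
  n (g f : cell (fob F (Ar X)) n) (e : fm F (Dom X) g = fm F (Cod X) f) :
  exists z : cell (fob F (Comp X)) n,
    g = fm F (Comp1 X) z /\ f = fm F (Comp2 X) z /\ icmp hF e = fm F (Cmp X) z.
Proof.
exists (fpair hF e); destruct (fpair_proj hF e) as [E1 E2].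
split; [symmetry; exact E1|split; [symmetry; exact E2|reflexivity]].
Qed.

Definition icat (F : functor GSET GSET) (hF : preserves_pullbacks F) (X : gcat)
  (n : nat) : cat.
Proof.
refine (@Cat (cell (fob F (Ob X)) n) (cell (fob F (Ar X)) n)
  (fun f => fm F (Dom X) f) (fun f => fm F (Cod X) f) (fun x => fm F (Idn X) x)
  (fun g f e => icmp hF e) _ _ _ _ _ _ _).
- intros x. rewrite fm_comp. etransitivity; [|apply fm_id].
  apply fm_ext; intros m y; apply dom_idn.
- intros x. rewrite fm_comp. etransitivity; [|apply fm_id].
  apply fm_ext; intros m y; apply cod_idn.
- intros g f e; destruct (icmp_Comp hF e) as [z [Eg [Ef ->]]].
  rewrite ?Eg, ?Ef, !fm_comp; apply fm_ext; intros m [[g' f'] e']; apply dom_cmp.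
- intros g f e; destruct (icmp_Comp hF e) as [z [Eg [Ef ->]]].
  rewrite ?Eg, ?Ef, !fm_comp; apply fm_ext; intros m [[g' f'] e']; apply cod_cmp.
- intros f e.
  assert (E : forall m (y : cell (Ar X) m),
    gmap (Dom X) (gmap (ghom_comp (Idn X) (Cod X)) y)
    = gmap (Cod X) (gmap (ghom_id (Ar X)) y)) by (intros; apply dom_idn).
  rewrite (icmp_fm hF E (x := f) e); [|apply fm_comp|symmetry; apply fm_id].
  etransitivity; [|apply fm_id]; apply fm_ext; intros m y; apply cmp_idl.
- intros f e.
  assert (E : forall m (y : cell (Ar X) m),
    gmap (Dom X) (gmap (ghom_id (Ar X)) y)
    = gmap (Cod X) (gmap (ghom_comp (Idn X) (Dom X)) y))
    by (intros; symmetry; apply cod_idn).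
  rewrite (icmp_fm hF E (x := f) e); [|symmetry; apply fm_id|apply fm_comp].
  etransitivity; [|apply fm_id]; apply fm_ext; intros m y; apply cmp_idr.
- intros h g f e1 e2 e3 e4.
  destruct (icmp_Comp hF e3) as [z [Eh [Eg Ehg]]].
  destruct (icmp_Comp hF e1) as [w [Eg' [Ef Egf]]].
  assert (Ezw : fm F (Comp2 X) z = fm F (Comp1 X) w) by congruence.
  set (t := fpair hF Ezw).
  destruct (fpair_proj hF Ezw) as [tz tw]; fold t in tz, tw.
  set (T := gpb (Comp2 X) (Comp1 X)) in *.
  set (q1 := gpb1 (Comp2 X) (Comp1 X) : ghom T (Comp X)) in *.
  set (q2 := gpb2 (Comp2 X) (Comp1 X) : ghom T (Comp X)) in *.
  assert (E : forall m (y : cell T m),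
    gmap (Dom X) (gmap (ghom_comp (Comp1 X) q1) y)
    = gmap (Cod X) (gmap (ghom_comp (Cmp X) q2) y)).
  { intros m [[[[a b] ab] [[b' c] bc]] bb]; cbn in *; subst b'.
    rewrite cod_cmp; exact ab. }
  assert (E' : forall m (y : cell T m),
    gmap (Dom X) (gmap (ghom_comp (Cmp X) q1) y)
    = gmap (Cod X) (gmap (ghom_comp (Comp2 X) q2) y)).
  { intros m [[[[a b] ab] [[b' c] bc]] bb]; cbn in *; subst b'.
    rewrite dom_cmp; exact bc. }
  rewrite (icmp_fm hF E (x := t) e2), (icmp_fm hF E' (x := t) e4).
  + apply fm_ext; intros m [[[[a b] ab] [[b' c] bc]] bb].
    cbn in bb; destruct bb; apply cmp_assoc.
  + rewrite <- fm_comp, tz; exact Ehg.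
  + rewrite <- fm_comp, tw; exact Ef.
  + rewrite <- fm_comp, tz; exact Eh.
  + rewrite <- fm_comp, tw; exact Egf.
Defined.

Definition icat_s (F : functor GSET GSET) (hF : preserves_pullbacks F) (X : gcat) n :
  fctor (icat hF X (S n)) (icat hF X n).
Proof.
refine (@Fctor (icat hF X (S n)) (icat hF X n)
  (fun x => gs (X := fob F (Ob X)) x) (fun f => gs (X := fob F (Ar X)) f) _ _ _ _).
- intros f; symmetry; apply gmap_s.
- intros f; symmetry; apply gmap_s.
- intros x; apply gmap_s.
- intros g f e e'; cbn. unfold icmp at 1, fm. rewrite gmap_s.
  unfold icmp, fm; f_equal. symmetry; apply fpair_unique; unfold fm;
  rewrite <- gmap_s; f_equal; apply (fpair_proj hF e).
Defined.

Definition icat_t (F : functor GSET GSET) (hF : preserves_pullbacks F) (X : gcat) n :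
  fctor (icat hF X (S n)) (icat hF X n).
Proof.
refine (@Fctor (icat hF X (S n)) (icat hF X n)
  (fun x => gt (X := fob F (Ob X)) x) (fun f => gt (X := fob F (Ar X)) f) _ _ _ _).
- intros f; symmetry; apply gmap_t.
- intros f; symmetry; apply gmap_t.
- intros x; apply gmap_t.
- intros g f e e'; cbn. unfold icmp at 1, fm. rewrite gmap_t.
  unfold icmp, fm; f_equal. symmetry; apply fpair_unique; unfold fm;
  rewrite <- gmap_t; f_equal; apply (fpair_proj hF e).
Defined.

(* The action of  Cat(F)  on objects, read in  [G^op, Cat]:  the internal category
   with object of objects [fob F (Ob X)], object of arrows [fob F (Ar X)], and
   structure maps the images under [F] of those of [X].  On 1-cells and 2-cells
   ([int_1], [int_2]) one likewise applies [F] to the underlying maps of globular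
   sets, and the components of the unit and multiplication of [Cat_monad] at [X]
   are those of [M] at [Ob X] and [Ar X]. *)
Definition int_obj (F : functor GSET GSET) (hF : preserves_pullbacks F) (X : gcat) :
  gcat :=
  {| lev := icat hF X; lev_s := icat_s hF X; lev_t := icat_t hF X;
     lev_ss := fun n => conj (gs_glob (g := fob F (Ob X)) (n := n))
                             (gs_glob (g := fob F (Ar X)) (n := n));
     lev_tt := fun n => conj (gt_glob (g := fob F (Ob X)) (n := n))
                             (gt_glob (g := fob F (Ar X)) (n := n)) |}.

Lemma Ob_int_obj (F : functor GSET GSET) (hF : preserves_pullbacks F) (X : gcat) :
  Ob (int_obj hF X) = fob F (Ob X).
Proof. reflexivity. Qed.

Lemma Ar_int_obj (F : functor GSET GSET) (hF : preserves_pullbacks F) (X : gcat) :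
  Ar (int_obj hF X) = fob F (Ar X).
Proof. reflexivity. Qed.

Lemma Ob1_comp (X Y Z : gcat) (g : gfun Y Z) (f : gfun X Y) :
  Ob1 (gfun_comp g f) = ghom_comp (Ob1 g) (Ob1 f).
Proof. apply ghom_eq; reflexivity. Qed.

Lemma Ar1_comp (X Y Z : gcat) (g : gfun Y Z) (f : gfun X Y) :
  Ar1 (gfun_comp g f) = ghom_comp (Ar1 g) (Ar1 f).
Proof. apply ghom_eq; reflexivity. Qed.

Definition int_1_lev (F : functor GSET GSET) (hF : preserves_pullbacks F)
  (X Y : gcat) (f : gfun X Y) n : fctor (icat hF X n) (icat hF Y n).
Proof.
refine (@Fctor (icat hF X n) (icat hF Y n) (fun x => fm F (Ob1 f) x)
  (fun a => fm F (Ar1 f) a) _ _ _ _).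
- intros a; cbn; rewrite !fm_comp; apply fm_ext; intros m y; apply fa_dom.
- intros a; cbn; rewrite !fm_comp; apply fm_ext; intros m y; apply fa_cod.
- intros x; cbn; rewrite !fm_comp; apply fm_ext; intros m y; apply fa_idn.
- intros g h e e'; cbn in *.
  destruct (icmp_Comp hF e) as [z [Eg [Eh ->]]].
  assert (E : forall m (y : cell (Comp X) m),
    gmap (Dom Y) (gmap (ghom_comp (Ar1 f) (Comp1 X)) y)
    = gmap (Cod Y) (gmap (ghom_comp (Ar1 f) (Comp2 X)) y))
    by (intros m [[a b] ab]; cbn in *; rewrite fa_dom, fa_cod, ab; reflexivity).
  rewrite (icmp_fm hF E (x := z) e');
    [|rewrite Eg; apply fm_comp|rewrite Eh; apply fm_comp].
  rewrite fm_comp; apply fm_ext; intros m [[a b] ab]; apply fa_cmp.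
Defined.

Definition int_1 (F : functor GSET GSET) (hF : preserves_pullbacks F)
  (X Y : gcat) (f : gfun X Y) : gfun (int_obj hF X) (int_obj hF Y).
Proof.
refine (@GFun (int_obj hF X) (int_obj hF Y) (int_1_lev hF f) _ _).
- intros n; apply feq_eq; split; intros x; apply gmap_s.
- intros n; apply feq_eq; split; intros x; apply gmap_t.
Defined.

Definition int_2_lev (F : functor GSET GSET) (hF : preserves_pullbacks F)
  (X Y : gcat) (a : gmod X Y) n : nt (icat hF X n) (icat hF Y n).
Proof.
refine (@Nt (icat hF X n) (icat hF Y n) (int_1_lev hF (msrc a) n)
  (int_1_lev hF (mtgt a) n) (fun x => fm F (Mod a) x) _ _ _).
- intros x; cbn; rewrite !fm_comp; apply fm_ext; intros m y; cbn.
  rewrite <- mapp_src; apply napp_dom.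
- intros x; cbn; rewrite !fm_comp; apply fm_ext; intros m y; cbn.
  rewrite <- mapp_tgt; apply napp_cod.
- intros f e e'; cbn in *.
  assert (E : forall m (y : cell (Ar X) m),
    gmap (Dom Y) (gmap (ghom_comp (Mod a) (Cod X)) y)
    = gmap (Cod Y) (gmap (Ar1 (msrc a)) y))
    by (intros; cbn; rewrite napp_dom, fa_cod, mapp_src; reflexivity).
  assert (E' : forall m (y : cell (Ar X) m),
    gmap (Dom Y) (gmap (Ar1 (mtgt a)) y)
    = gmap (Cod Y) (gmap (ghom_comp (Mod a) (Dom X)) y))
    by (intros; cbn; rewrite napp_cod, fa_dom, mapp_tgt; reflexivity).
  rewrite (icmp_fm hF E (x := f) e), (icmp_fm hF E' (x := f) e');
    try reflexivity; try apply fm_comp.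
  apply fm_ext; intros m y; cbn.
  assert (h : dom (napp (mapp a m) (cod y)) = cod (fa (nsrc (mapp a m)) y)) by bdry.
  assert (k : dom (fa (ntgt (mapp a m)) y) = cod (napp (mapp a m) (dom y))) by bdry.
  etransitivity; [|etransitivity; [exact (napp_nat h k)|]]; apply cmp_eq;
    try reflexivity; [rewrite mapp_src|rewrite mapp_tgt]; reflexivity.
Defined.

Definition int_2 (F : functor GSET GSET) (hF : preserves_pullbacks F)
  (X Y : gcat) (a : gmod X Y) : gmod (int_obj hF X) (int_obj hF Y).
Proof.
refine (@GMod (int_obj hF X) (int_obj hF Y) (int_1 hF (msrc a)) (int_1 hF (mtgt a))
  (int_2_lev hF a) _ _ _ _); try reflexivity.
- intros n; apply napp_whisker;
    [exact (gf_s (int_1 hF (msrc a)) n)|exact (gf_s (int_1 hF (mtgt a)) n)|].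
  intros x; apply gmap_s.
- intros n; apply napp_whisker;
    [exact (gf_t (int_1 hF (msrc a)) n)|exact (gf_t (int_1 hF (mtgt a)) n)|].
  intros x; apply gmap_t.
Defined.

Definition int_hom (F : functor GSET GSET) (hF : preserves_pullbacks F)
  (X Y : gcat) : fctor (gfun_cat X Y) (gfun_cat (int_obj hF X) (int_obj hF Y)).
Proof.
refine (@Fctor (gfun_cat X Y) (gfun_cat (int_obj hF X) (int_obj hF Y))
  (@int_1 F hF X Y) (@int_2 F hF X Y) _ _ _ _); try reflexivity.
- intros f; apply gmod_eq; try reflexivity.
  intros n; apply nt_eq; try reflexivity.
  intros x; cbn; rewrite fm_comp; apply fm_ext; reflexivity.
- intros b a e e'; apply gmod_eq; try reflexivity.
  intros n; apply nt_eq; try reflexivity.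
  intros x; cbn.
  assert (E : forall m (y : cell (Ob X) m),
    gmap (Dom Y) (gmap (Mod b) y) = gmap (Cod Y) (gmap (Mod a) y)).
  { intros m y; cbn. rewrite napp_dom, napp_cod, mapp_src, mapp_tgt.
    exact (f_equal (fun f => fo (gf f m) y) e). }
  symmetry; etransitivity; [apply (icmp_fm hF E (x := x)); reflexivity|].
  apply fm_ext; intros m y; apply cmp_eq; reflexivity.
Defined.

Lemma int_1_id (F : functor GSET GSET) (hF : preserves_pullbacks F) (X : gcat) :
  int_1 hF (gfun_id X) = gfun_id (int_obj hF X).
Proof.
apply gfun_eq; intros n; apply feq_eq; split; intros x;
(etransitivity; [|apply fm_id]); apply fm_ext; reflexivity.
Qed.

Lemma int_1_comp (F : functor GSET GSET) (hF : preserves_pullbacks F)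
  (X Y Z : gcat) (g : gfun Y Z) (f : gfun X Y) :
  int_1 hF (gfun_comp g f) = gfun_comp (int_1 hF g) (int_1 hF f).
Proof.
apply gfun_eq; intros n; apply feq_eq; split; intros x; cbn;
rewrite fm_comp; apply fm_ext; reflexivity.
Qed.

Definition int_functor (F : functor GSET GSET) (hF : preserves_pullbacks F) :
  functor2 GCAT GCAT.
Proof.
refine (@Functor2 GCAT GCAT (int_obj hF) (int_hom hF) _ _ _).
- apply int_1_id.
- intros X Y Z g f; apply int_1_comp.
- intros X Y Z b a; apply gmod_eq; [apply int_1_comp|apply int_1_comp|].
  intros n; apply nt_eq.
  + exact (f_equal (fun h => gf h n) (int_1_comp hF (msrc b) (msrc a))).
  + exact (f_equal (fun h => gf h n) (int_1_comp hF (mtgt b) (mtgt a))).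
  + intros x; cbn.
    assert (E : forall m (y : cell (Ob X) m),
      gmap (Dom Z) (gmap (ghom_comp (Mod b) (Ob1 (mtgt a))) y)
      = gmap (Cod Z) (gmap (ghom_comp (Ar1 (msrc b)) (Mod a)) y)).
    { intros m y; cbn. rewrite napp_dom, fa_cod, napp_cod, mapp_src, mapp_tgt.
      reflexivity. }
    symmetry; etransitivity;
      [apply (icmp_fm hF E (x := x)); apply fm_comp|].
    apply fm_ext; intros m y; apply cmp_eq; cbn;
      [rewrite mapp_tgt|rewrite mapp_src]; reflexivity.
Defined.

Lemma nt_app_fm (F G : functor GSET GSET) (phi : nattrans F G) (A B : gset)
  (f : ghom A B) n (x : cell (fob F A) n) :
  gmap (nt_app phi B) (fm F f x) = fm G f (gmap (nt_app phi A) x).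
Proof.
exact (f_equal (fun h : ghom _ _ => gmap h x) (@nt_nat _ _ _ _ phi A B f)).
Qed.

Definition int_unit_lev (M : monad GSET) (hM : preserves_pullbacks (mfun M))
  (X : gcat) n : fctor (lev X n) (icat hM X n).
Proof.
refine (@Fctor (lev X n) (icat hM X n)
  (fun x => gmap (nt_app (munit M) (Ob X)) (x : cell (Ob X) n))
  (fun f => gmap (nt_app (munit M) (Ar X)) (f : cell (Ar X) n)) _ _ _ _).
- intros f; symmetry; exact (nt_app_fm (munit M) (Dom X) (f : cell (Ar X) n)).
- intros f; symmetry; exact (nt_app_fm (munit M) (Cod X) (f : cell (Ar X) n)).
- intros x; exact (nt_app_fm (munit M) (Idn X) (x : cell (Ob X) n)).
- intros g f e e'.
  set (z := exist _ (g, f) e : cell (Comp X) n).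
  etransitivity; [exact (nt_app_fm (munit M) (Cmp X) z)|].
  cbn; unfold icmp; f_equal; symmetry; apply fpair_unique.
  + symmetry; exact (nt_app_fm (munit M) (Comp1 X) z).
  + symmetry; exact (nt_app_fm (munit M) (Comp2 X) z).
Defined.

Definition int_unit (M : monad GSET) (hM : preserves_pullbacks (mfun M)) :
  nat2 (functor2_id GCAT) (int_functor hM).
Proof.
unshelve refine (@Nat2 GCAT GCAT (functor2_id GCAT) (int_functor hM)
  (fun X => @GFun X (int_obj hM X) (int_unit_lev hM X) _ _) _ _).
- intros n; apply feq_eq; split; intros x.
  + exact (gmap_s (nt_app (munit M) (Ob X)) x).
  + exact (gmap_s (nt_app (munit M) (Ar X)) x).
- intros n; apply feq_eq; split; intros x.
  + exact (gmap_t (nt_app (munit M) (Ob X)) x).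
  + exact (gmap_t (nt_app (munit M) (Ar X)) x).
- intros X Y f; apply gfun_eq; intros n; apply feq_eq; split; intros x.
  + exact (nt_app_fm (munit M) (Ob1 f) (x : cell (Ob X) n)).
  + exact (nt_app_fm (munit M) (Ar1 f) (x : cell (Ar X) n)).
- assert (N : forall (X Y : gcat) (f : gfun X Y) n,
    fctor_comp (int_unit_lev hM Y n) (gf f n)
    = fctor_comp (int_1_lev hM f n) (int_unit_lev hM X n)).
  { intros X Y f n; apply feq_eq; split; intros x.
    + exact (nt_app_fm (munit M) (Ob1 f) (x : cell (Ob X) n)).
    + exact (nt_app_fm (munit M) (Ar1 f) (x : cell (Ar X) n)). }
  intros X Y a; apply gmod_eq.
  + apply gfun_eq; intros n; apply N.
  + apply gfun_eq; intros n; apply N.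
  + intros n; apply (@napp_whisker _ _ _ _ (int_unit_lev hM Y n)
                       (int_unit_lev hM X n) (mapp a n) (int_2_lev hM a n)).
    * rewrite mapp_src; apply N.
    * rewrite mapp_tgt; apply N.
    * intros x; exact (nt_app_fm (munit M) (Mod a) (x : cell (Ob X) n)).
Defined.

(* The comparison  Comp (F X) -> F (Comp X). *)
Definition Comp_int (F : functor GSET GSET) (hF : preserves_pullbacks F)
  (X : gcat) : ghom (Comp (int_obj hF X)) (fob F (Comp X)).
Proof.
refine (@GHom (Comp (int_obj hF X)) (fob F (Comp X))
  (fun n z => fpair hF (proj2_sig z)) _ _).
- intros n [[g f] e]; symmetry; apply fpair_unique; unfold fm;
  rewrite <- gmap_s; cbn; f_equal; apply (fpair_proj hF e).
- intros n [[g f] e]; symmetry; apply fpair_unique; unfold fm;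
  rewrite <- gmap_t; cbn; f_equal; apply (fpair_proj hF e).
Defined.

Lemma fmap_mmult (M : monad GSET) (A B : gset) (f : ghom A B)
  (f' : ghom (fob (mfun M) A) (fob (mfun M) B)) n
  (x : cell (fob (mfun M) (fob (mfun M) A)) n) :
  (forall m (y : cell (fob (mfun M) A) m), gmap f' y = fm (mfun M) f y) ->
  gmap (nt_app (mmult M) B) (fm (mfun M) f' x)
  = fm (mfun M) f (gmap (nt_app (mmult M) A) x).
Proof.
intros E. etransitivity; [|exact (nt_app_fm (mmult M) f x)].
apply (f_equal (@gmap _ _ (nt_app (mmult M) B) n)).
exact (@fm_ext (mfun M) _ _ f' (fmap (mfun M) (f : hom GSET A B)) E n x).
Qed.

Lemma fm_Comp_int (F : functor GSET GSET) (hF : preserves_pullbacks F) (X : gcat)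
  (h : ghom (Comp (int_obj hF X)) (Ar (int_obj hF X))) (k : ghom (Comp X) (Ar X))
  n (z : cell (fob F (Comp (int_obj hF X))) n) :
  (forall m (y : cell (Comp (int_obj hF X)) m),
     gmap h y = fm F k (gmap (Comp_int hF X) y)) ->
  fm F h z = fm (functor_comp F F) k (fm F (Comp_int hF X) z).
Proof.
intros E; symmetry.
etransitivity; [exact (@fm_comp F _ _ _
  (fmap F (k : hom GSET (Comp X) (Ar X))) (Comp_int hF X) n z)|].
exact (@fm_ext F _ _
  (ghom_comp (fmap F (k : hom GSET (Comp X) (Ar X))) (Comp_int hF X)) h
  (fun m y => eq_sym (E m y)) n z).
Qed.

Definition int_mult_lev (M : monad GSET) (hM : preserves_pullbacks (mfun M))
  (X : gcat) n : fctor (icat hM (int_obj hM X) n) (icat hM X n).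
Proof.
refine (@Fctor (icat hM (int_obj hM X) n) (icat hM X n)
  (fun x => gmap (nt_app (mmult M) (Ob X)) x)
  (fun f => gmap (nt_app (mmult M) (Ar X)) f) _ _ _ _).
- intros f; symmetry.
  exact (@fmap_mmult M _ _ (Dom X) (Dom (int_obj hM X)) n f (fun _ _ => eq_refl)).
- intros f; symmetry.
  exact (@fmap_mmult M _ _ (Cod X) (Cod (int_obj hM X)) n f (fun _ _ => eq_refl)).
- intros x.
  exact (@fmap_mmult M _ _ (Idn X) (Idn (int_obj hM X)) n x (fun _ _ => eq_refl)).
- intros g f e e'.
  destruct (icmp_Comp hM e) as [z [Eg [Ef Egf]]].
  set (w := fm (mfun M) (Comp_int hM X) z).
  assert (P : icmp hM e = fm (functor_comp (mfun M) (mfun M)) (Cmp X) w).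
  { etransitivity; [exact Egf|]. apply fm_Comp_int. reflexivity. }
  assert (P1 : g = fm (functor_comp (mfun M) (mfun M)) (Comp1 X) w).
  { etransitivity; [exact Eg|]. apply fm_Comp_int.
    intros m [[a b] ab]; exact (eq_sym (proj1 (fpair_proj hM ab))). }
  assert (P2 : f = fm (functor_comp (mfun M) (mfun M)) (Comp2 X) w).
  { etransitivity; [exact Ef|]. apply fm_Comp_int.
    intros m [[a b] ab]; exact (eq_sym (proj2 (fpair_proj hM ab))). }
  etransitivity; [exact (f_equal (@gmap _ _ (nt_app (mmult M) (Ar X)) n) P)|].
  etransitivity; [exact (nt_app_fm (mmult M) (Cmp X) w)|].
  apply (f_equal (@gmap _ _ (fmap (mfun M) (Cmp X : hom GSET (Comp X) (Ar X))) n)).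
  symmetry; apply fpair_unique; symmetry.
  + etransitivity; [exact (f_equal (@gmap _ _ (nt_app (mmult M) (Ar X)) n) P1)|].
    exact (nt_app_fm (mmult M) (Comp1 X) w).
  + etransitivity; [exact (f_equal (@gmap _ _ (nt_app (mmult M) (Ar X)) n) P2)|].
    exact (nt_app_fm (mmult M) (Comp2 X) w).
Defined.

Definition int_mult (M : monad GSET) (hM : preserves_pullbacks (mfun M)) :
  nat2 (functor2_comp (int_functor hM) (int_functor hM)) (int_functor hM).
Proof.
assert (N : forall (X Y : gcat) (f : gfun X Y) n,
  fctor_comp (int_mult_lev hM Y n) (int_1_lev hM (int_1 hM f) n)
  = fctor_comp (int_1_lev hM f n) (int_mult_lev hM X n)).
{ intros X Y f n; apply feq_eq; split; intros x.
  + exact (@fmap_mmult M _ _ (Ob1 f) (Ob1 (int_1 hM f)) n x (fun _ _ => eq_refl)).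
  + exact (@fmap_mmult M _ _ (Ar1 f) (Ar1 (int_1 hM f)) n x (fun _ _ => eq_refl)). }
unshelve refine (@Nat2 GCAT GCAT
  (functor2_comp (int_functor hM) (int_functor hM)) (int_functor hM)
  (fun X => @GFun (int_obj hM (int_obj hM X)) (int_obj hM X) (int_mult_lev hM X) _ _)
  _ _).
- intros n; apply feq_eq; split; intros x.
  + exact (gmap_s (nt_app (mmult M) (Ob X)) x).
  + exact (gmap_s (nt_app (mmult M) (Ar X)) x).
- intros n; apply feq_eq; split; intros x.
  + exact (gmap_t (nt_app (mmult M) (Ob X)) x).
  + exact (gmap_t (nt_app (mmult M) (Ar X)) x).
- intros X Y f; apply gfun_eq; intros n; apply N.
- intros X Y a; apply gmod_eq.
  + apply gfun_eq; intros n; apply N.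
  + apply gfun_eq; intros n; apply N.
  + intros n; apply (@napp_whisker _ _ _ _ (int_mult_lev hM Y n)
      (int_mult_lev hM X n) (int_2_lev hM (int_2 hM a) n) (int_2_lev hM a n)).
    * apply N.
    * apply N.
    * intros x.
      exact (@fmap_mmult M _ _ (Mod a) (Mod (int_2 hM a)) n x (fun _ _ => eq_refl)).
Defined.

Definition Cat_monad (M : monad GSET) (hM : preserves_pullbacks (mfun M)) :
  monad2 GCAT.
Proof.
refine (@Monad2 GCAT (int_functor hM) (int_unit hM) (int_mult hM) _ _ _);
  intros X; apply gfun_eq; intros n; apply feq_eq; split; intros x.
- exact (f_equal (fun h : ghom _ _ => gmap h x) (munit_l M (Ob X))).
- exact (f_equal (fun h : ghom _ _ => gmap h x) (munit_l M (Ar X))).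
- etransitivity;
    [|exact (f_equal (fun h : ghom _ _ => gmap h x) (munit_r M (Ob X)))].
  cbn; f_equal; apply fm_ext; reflexivity.
- etransitivity;
    [|exact (f_equal (fun h : ghom _ _ => gmap h x) (munit_r M (Ar X)))].
  cbn; f_equal; apply fm_ext; reflexivity.
- etransitivity;
    [exact (f_equal (fun h : ghom _ _ => gmap h x) (mmult_assoc M (Ob X)))|].
  cbn; f_equal; apply fm_ext; reflexivity.
- etransitivity;
    [exact (f_equal (fun h : ghom _ _ => gmap h x) (mmult_assoc M (Ar X)))|].
  cbn; f_equal; apply fm_ext; reflexivity.
Defined.

(* Main.v *)
(* The free strict omega-category monad is realised by iterated free categories
   (paths whose edges are cells of the free omega-category on the shifted globular
   set).  Its fibres over the terminal globular set are represented by the pasting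
   diagrams [ar t] of trees, and so are those of [R0], by cartesianness of [phi0].
   Pasting diagrams are iterated pushouts of globes, so that for a tree [A] the
   category  [A, X]  is an iterated pullback of the categories [X_n] and the
   comparison  kappa : C [A, X] -> [A, C X]  is invertible.  An element [a] of  R0 A
   yields  ev_a : [A, X] -> R X,  and the distributive law is determined by
   lambda ev_a kappa = C (ev_a).  All axioms are checked after precomposition with
   the jointly surjective functors  ev_a kappa.  For the multiplication of [R] this
   requires every element of  R0 R0 Z  to come from one of  R0 R0 A,  [A] a pasting
   diagram;  that is deduced from the cartesianness of the multiplication of the free
   omega-category monad, proved through discrete Conduche functors. *)
From Stdlib Require Import FunctionalExtensionality ProofIrrelevance ClassicalEpsilon.
From Stdlib Require Import List Arith Lia.
Require Import Defs.
Import ListNotations.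

Set Implicit Arguments.
Unset Strict Implicit.

(** * Strict omega-categories with total composition *)

(** A cell of [R C X] is an operation together with a map [A -> C X] from its arity, and lambda must
    turn this map into an element of [C [A, X]]. For an arbitrary [A] there is no way back along
    kappa: [[A, X]] is a limit of the [X_n], and [C] is only known to preserve pullbacks, not
    products or the terminal category. Pasting diagrams are connected and are built by gluing at
    vertices, without disjoint unions, and this is what makes pullbacks sufficient. The remaining
    obstacle is a cell of [R R C X], which involves two layers of operations. It has to be pulled
    back along a map [A -> C X] from its total pasting diagram, and that this is possible is what
    cartesianness of the multiplication says. It rests on a remark about paths: a map of globular
    sets never changes the lengths of the nested lists, so that a decomposition of the image of a
    cell comes from a decomposition of the cell. *)

Definition sid (X : gset) (i : forall n, cell X n -> cell X (S n)) n d
  (x : cell X n) : cell X n := iid i n d (isrc d x).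
Definition tid (X : gset) (i : forall n, cell X n -> cell X (S n)) n d
  (x : cell X n) : cell X n := iid i n d (itgt d x).

(* Composition is total, with junk values on non-composable pairs; [y] and [x] are
   composable in codimension [d] when the iterated identities on their boundaries
   agree.  Unlike [isrc d y = itgt d x], this condition lives in [cell og n], so
   that it makes sense for [oshift] below without transport. *)
Record ocat := OCat {
  og :> gset;
  oid : forall n, cell og n -> cell og (S n);
  oc : forall n (d : nat), cell og n -> cell og n -> cell og n;
  oid_s : forall n (x : cell og n), gs (oid x) = x;
  oid_t : forall n (x : cell og n), gt (oid x) = x;
  oc_s1 : forall n (y x : cell og (S n)), sid oid 1 y = tid oid 1 x ->
    gs (oc 1 y x) = gs x;
  oc_t1 : forall n (y x : cell og (S n)), sid oid 1 y = tid oid 1 x ->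
    gt (oc 1 y x) = gt y;
  oc_s : forall n d (y x : cell og (S n)), 0 < d <= n ->
    sid oid (S d) y = tid oid (S d) x ->
    gs (oc (S d) y x) = oc d (gs y) (gs x);
  oc_t : forall n d (y x : cell og (S n)), 0 < d <= n ->
    sid oid (S d) y = tid oid (S d) x ->
    gt (oc (S d) y x) = oc d (gt y) (gt x);
  oc_assoc : forall n d (z y x : cell og n), 0 < d <= n ->
    sid oid d z = tid oid d y -> sid oid d y = tid oid d x ->
    sid oid d z = tid oid d (oc d y x) -> sid oid d (oc d z y) = tid oid d x ->
    oc d z (oc d y x) = oc d (oc d z y) x;
  oc_idl : forall n d (x : cell og n), 0 < d <= n ->
    sid oid d (tid oid d x) = tid oid d x -> oc d (tid oid d x) x = x;
  oc_idr : forall n d (x : cell og n), 0 < d <= n ->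
    sid oid d x = tid oid d (sid oid d x) -> oc d x (sid oid d x) = x;
  oc_id : forall n d (y x : cell og n), 0 < d <= n ->
    sid oid d y = tid oid d x ->
    oid (oc d y x) = oc (S d) (oid y) (oid x);
  oc_ich : forall n d d' (y' y x' x : cell og n), 0 < d -> d < d' -> d' <= n ->
    sid oid d y' = tid oid d y -> sid oid d x' = tid oid d x ->
    sid oid d' (oc d y' y) = tid oid d' (oc d x' x) ->
    sid oid d' y' = tid oid d' x' -> sid oid d' y = tid oid d' x ->
    sid oid d (oc d' y' x') = tid oid d (oc d' y x) ->
    oc d' (oc d y' y) (oc d x' x) = oc d (oc d' y' x') (oc d' y x) }.

Arguments oid {o n} x : rename.
Arguments oc {o n} d y x : rename.

Notation "'osid' A" := (@sid (og A) (@oid A) _) (at level 10, A at level 9).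
Notation "'otid' A" := (@tid (og A) (@oid A) _) (at level 10, A at level 9).

Section Boundaries.
Variables (X : gset) (i : forall n, cell X n -> cell X (S n)).
Hypothesis (i_s : forall n (x : cell X n), gs (i x) = x)
  (i_t : forall n (x : cell X n), gt (i x) = x).

Lemma iid_inj n d (x y : cell X (n - d)) : iid i n d x = iid i n d y -> x = y.
Proof.
revert d x y; induction n as [|n IH]; intros [|d] x y; try (intros E; exact E).
cbn; intros E. apply IH. rewrite <- (i_s (iid i n d x)), E; apply i_s.
Qed.

(** The source map retracts [i], hence iterated identities are injective, and comparing them is as
    strict as comparing the boundaries themselves. *)
Lemma sid_tid_iff n d (y x : cell X n) :
  isrc d y = itgt d x <-> sid i d y = tid i d x.
Proof.
split; [intros E; unfold sid, tid; rewrite E; reflexivity|apply iid_inj].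
Qed.

Lemma isrc_iid n d (x : cell X (n - d)) : isrc d (iid i n d x) = x.
Proof.
revert d x; induction n as [|n IH]; intros [|d] x; try reflexivity.
cbn. rewrite i_s; apply IH.
Qed.

Lemma itgt_iid n d (x : cell X (n - d)) : itgt d (iid i n d x) = x.
Proof.
revert d x; induction n as [|n IH]; intros [|d] x; try reflexivity.
cbn. rewrite i_t; apply IH.
Qed.

Lemma sid_tid n d (x : cell X n) : sid i d (tid i d x) = tid i d x.
Proof. unfold sid, tid; rewrite isrc_iid; reflexivity. Qed.

Lemma tid_sid n d (x : cell X n) : tid i d (sid i d x) = sid i d x.
Proof. unfold sid, tid; rewrite itgt_iid; reflexivity. Qed.

Lemma isrc_gs_gt n d (x : cell X (S (S n))) : 0 < d -> isrc d (gs x) = isrc d (gt x).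
Proof. destruct d; [lia|]; intros _; cbn; rewrite gs_glob; reflexivity. Qed.

Lemma itgt_gs_gt n d (x : cell X (S (S n))) : 0 < d -> itgt d (gs x) = itgt d (gt x).
Proof. destruct d; [lia|]; intros _; cbn; rewrite gt_glob; reflexivity. Qed.

(** The hypothesis only gives [isrc d (gs y) = itgt d (gt x)]. Since [d > 0], globularity lets
    [gt x] be replaced by [gs x] below it. *)
Lemma sid_tid_gs n d (y x : cell X (S n)) : 0 < d <= n ->
  sid i (S d) y = tid i (S d) x -> sid i d (gs y) = tid i d (gs x).
Proof.
intros h E; apply sid_tid_iff in E; apply sid_tid_iff.
destruct n; [lia|]. rewrite itgt_gs_gt by lia; exact E.
Qed.

Lemma sid_tid_gt n d (y x : cell X (S n)) : 0 < d <= n ->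
  sid i (S d) y = tid i (S d) x -> sid i d (gt y) = tid i d (gt x).
Proof.
intros h E; apply sid_tid_iff in E; apply sid_tid_iff.
destruct n; [lia|]. rewrite <- isrc_gs_gt by lia; exact E.
Qed.

End Boundaries.

Arguments iid_inj {X i} i_s {n d x y}.
Arguments sid_tid_iff {X i} i_s {n} d y x.
Arguments sid_tid_gs {X i} i_s {n d y x}.
Arguments sid_tid_gt {X i} i_s {n d y x}.

Section OfOmega.
Variable A : omega_cat.

Definition tot n d (y x : cell (wset A) n) : cell (wset A) n :=
  match excluded_middle_informative (0 < d <= n) with
  | left h => match excluded_middle_informative (isrc d y = itgt d x) with
              | left e => wcomp A n d h y x e
              | right _ => y
              end
  | right _ => y
  end.

Lemma totE n d h (y x : cell (wset A) n) e : tot d y x = wcomp A n d h y x e.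
Proof.
unfold tot. destruct excluded_middle_informative as [h'|]; [|contradiction].
destruct excluded_middle_informative as [e'|]; [|contradiction].
f_equal; apply proof_irrelevance.
Qed.

Lemma wcmpb n d (y x : cell (wset A) n) :
  sid (wid A) d y = tid (wid A) d x -> isrc d y = itgt d x.
Proof. apply sid_tid_iff, wid_s. Qed.

Definition ocat_of : ocat.
Proof.
refine (@OCat (wset A) (wid A) tot (wid_s A) (wid_t A) _ _ _ _ _ _ _ _ _).
- intros n y x E; apply wcmpb in E.
  assert (h : 0 < 1 <= S n) by lia. rewrite (totE h E); apply wcomp_s1.
- intros n y x E; apply wcmpb in E.
  assert (h : 0 < 1 <= S n) by lia. rewrite (totE h E); apply wcomp_t1.
- intros n d y x h' E; apply wcmpb in E.
  assert (h : 0 < S d <= S n) by lia. rewrite (totE h E).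
  assert (E' : isrc d (gs y) = itgt d (gs x)).
  { destruct n; [lia|]. rewrite itgt_gs_gt by lia; exact E. }
  rewrite (totE h' E'); apply wcomp_s.
- intros n d y x h' E; apply wcmpb in E.
  assert (h : 0 < S d <= S n) by lia. rewrite (totE h E).
  assert (E' : isrc d (gt y) = itgt d (gt x)).
  { destruct n; [lia|]. rewrite <- isrc_gs_gt by lia; exact E. }
  rewrite (totE h' E'); apply wcomp_t.
- intros n d z y x h e1 e2; apply wcmpb in e1, e2.
  rewrite (totE h e1), (totE h e2); intros e3 e4; apply wcmpb in e3, e4.
  rewrite (totE h e3), (totE h e4); apply wcomp_assoc.
- intros n d x h e; apply wcmpb in e. rewrite (totE h e); apply wcomp_idl.
- intros n d x h e; apply wcmpb in e. rewrite (totE h e); apply wcomp_idr.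
- intros n d y x h e.
  assert (h' : 0 < S d <= S n) by lia.
  assert (e' : isrc (S d) (wid A n y) = itgt (S d) (wid A n x)).
  { cbn. rewrite wid_s, wid_t. apply wcmpb, e. }
  apply wcmpb in e.
  rewrite (totE h e), (totE h' e'). apply wcomp_id.
- intros n d d' y' y x' x h1 h2 h3 e1 e2.
  assert (h : 0 < d <= n) by lia. assert (h' : 0 < d' <= n) by lia.
  apply wcmpb in e1, e2. rewrite (totE h e1), (totE h e2).
  intros e3 e4 e5; apply wcmpb in e3, e4, e5.
  rewrite (totE h' e3), (totE h' e4), (totE h' e5).
  intros e6; apply wcmpb in e6. rewrite (totE h e6).
  apply winterchange; assumption.
Defined.

End OfOmega.

Section ToOmega.
Variable A : ocat.

Let cmpb n d (y x : cell A n) : isrc d y = itgt d x -> osid A d y = otid A d x.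
Proof. apply sid_tid_iff, oid_s. Qed.

Definition omega_of : omega_cat.
Proof.
refine (@OmegaCat A (@oid A) (fun n d _ y x _ => oc d y x) (@oid_s A) (@oid_t A)
  _ _ _ _ _ _ _ _ _).
- intros n _ y x e; apply oc_s1, cmpb, e.
- intros n _ y x e; apply oc_t1, cmpb, e.
- intros n d _ h y x e _; apply oc_s; [exact h|apply cmpb, e].
- intros n d _ h y x e _; apply oc_t; [exact h|apply cmpb, e].
- intros n d h z y x e1 e2 e3 e4; apply oc_assoc; try apply cmpb; assumption.
- intros n d h x e; apply oc_idl; [assumption|apply cmpb; assumption].
- intros n d h x e; apply oc_idr; [assumption|apply cmpb; assumption].
- intros n d h _ y x e _; apply oc_id; [assumption|apply cmpb; assumption].
- intros n d d' h h' l y' y x' x e1 e2 e3 e4 e5 e6.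
  apply oc_ich; try apply cmpb; try assumption; lia.
Defined.

End ToOmega.

Definition omap (A B : ocat) (f : ghom A B) : Prop :=
  (forall n (x : cell A n), gmap f (oid x) = oid (gmap f x)) /\
  (forall n d (y x : cell A n), 0 < d <= n -> osid A d y = otid A d x ->
     gmap f (oc d y x) = oc d (gmap f y) (gmap f x)).

Lemma gmap_iid (A B : ocat) (f : ghom A B) :
  (forall n (x : cell A n), gmap f (oid x) = oid (gmap f x)) ->
  forall n d (x : cell A (n - d)),
    gmap f (iid (@oid A) n d x) = iid (@oid B) n d (gmap f x).
Proof.
intros E n; induction n as [|n IH]; intros [|d] x; try reflexivity.
cbn. rewrite E, IH; reflexivity.
Qed.

Lemma gmap_sid (A B : ocat) (f : ghom A B) :
  (forall n (x : cell A n), gmap f (oid x) = oid (gmap f x)) ->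
  forall n d (x : cell A n), gmap f (osid A d x) = osid B d (gmap f x).
Proof. intros E n d x; unfold sid; rewrite gmap_iid, gmap_isrc; auto. Qed.

Lemma gmap_tid (A B : ocat) (f : ghom A B) :
  (forall n (x : cell A n), gmap f (oid x) = oid (gmap f x)) ->
  forall n d (x : cell A n), gmap f (otid A d x) = otid B d (gmap f x).
Proof. intros E n d x; unfold tid; rewrite gmap_iid, gmap_itgt; auto. Qed.

Lemma omap_cmpb (A B : ocat) (f : ghom A B) : omap f ->
  forall n d (y x : cell A n), osid A d y = otid A d x ->
  osid B d (gmap f y) = otid B d (gmap f x).
Proof.
intros [E _] n d y x e. rewrite <- gmap_sid, <- gmap_tid by exact E.
f_equal; exact e.
Qed.

Lemma omap_comp (A B C : ocat) (g : ghom B C) (f : ghom A B) :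
  omap g -> omap f -> omap (ghom_comp g f : ghom A C).
Proof.
intros [g1 g2] F; split.
- intros n x; cbn; rewrite (proj1 F); apply g1.
- intros n d y x h e; cbn; rewrite (proj2 F) by assumption.
  apply g2; [exact h|apply omap_cmpb; assumption].
Qed.

Definition omega_fun_of (A B : omega_cat) (f : ghom (wset A) (wset B))
  (F : @omap (ocat_of A) (ocat_of B) f) : omega_fun A B.
Proof.
refine (@OmegaFun A B f (proj1 F) _).
intros n d h y x e e'.
etransitivity; [|etransitivity; [apply (proj2 F n d y x h)|]].
- cbn; f_equal; symmetry; apply totE.
- apply (sid_tid_iff (wid_s A)), e.
- apply totE.
Defined.

Lemma omap_of (A B : omega_cat) (f : omega_fun A B) :
  @omap (ocat_of A) (ocat_of B) (wmap f).
Proof.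
split; [apply (wmap_id f)|].
intros n d y x h e; cbn in *. apply wcmpb in e.
assert (e' : isrc d (gmap (wmap f) y) = itgt d (gmap (wmap f) x))
  by (rewrite gmap_isrc, gmap_itgt, e; reflexivity).
rewrite (totE h e), (totE h e'); apply wmap_comp.
Qed.

(** The round trip through [omega_cat] replaces the junk values of [oc], so it does not return [A]
    itself; the identity of cells is nevertheless an [omap] both ways. *)
Lemma omap_to (A : ocat) : @omap A (ocat_of (omega_of A)) (ghom_id A).
Proof.
split; [reflexivity|].
intros n d y x h e; cbn. apply (sid_tid_iff (@oid_s A)) in e.
symmetry; exact (@totE (omega_of A) n d h y x e).
Qed.

Lemma omap_from (A : ocat) : @omap (ocat_of (omega_of A)) A (ghom_id A).
Proof.
split; [reflexivity|].
intros n d y x h e; cbn. apply (sid_tid_iff (@oid_s A)) in e.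
exact (@totE (omega_of A) n d h y x e).
Qed.

Definition shift (X : gset) : gset :=
  {| cell := fun n => cell X (S n); gs := fun n x => gs x; gt := fun n x => gt x;
     gs_glob := fun n x => gs_glob x; gt_glob := fun n x => gt_glob x |}.

Definition fshift (X Y : gset) (f : ghom X Y) : ghom (shift X) (shift Y) :=
  @GHom (shift X) (shift Y) (fun n x => gmap f x)
    (fun n x => gmap_s f x) (fun n x => gmap_t f x).

Lemma sid_shift (X : gset) (i : forall n, cell X n -> cell X (S n)) n d
  (x : cell X (S n)) : d <= n ->
  @sid (shift X) (fun n => i (S n)) n d x = sid i d x.
Proof.
revert d x; induction n as [|n IH]; intros [|d] x h; try reflexivity; try lia.
cbn. apply (f_equal (i (S n))). exact (IH d (gs x) (le_S_n _ _ h)).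
Qed.

Lemma tid_shift (X : gset) (i : forall n, cell X n -> cell X (S n)) n d
  (x : cell X (S n)) : d <= n ->
  @tid (shift X) (fun n => i (S n)) n d x = tid i d x.
Proof.
revert d x; induction n as [|n IH]; intros [|d] x h; try reflexivity; try lia.
cbn. apply (f_equal (i (S n))). exact (IH d (gt x) (le_S_n _ _ h)).
Qed.

(* The coproduct of all hom-omega-categories. *)
Definition oshift (A : ocat) : ocat.
Proof.
refine (@OCat (shift A) (fun n x => @oid A (S n) x) (fun n d y x => @oc A (S n) d y x)
  (fun n => @oid_s A (S n)) (fun n => @oid_t A (S n)) _ _ _ _ _ _ _ _ _).
- intros n y x; rewrite sid_shift, tid_shift by lia; apply oc_s1.
- intros n y x; rewrite sid_shift, tid_shift by lia; apply oc_t1.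
- intros n d y x h; rewrite sid_shift, tid_shift by lia; apply oc_s; lia.
- intros n d y x h; rewrite sid_shift, tid_shift by lia; apply oc_t; lia.
- intros n d z y x h; rewrite !sid_shift, !tid_shift by lia; apply oc_assoc; lia.
- intros n d x h; rewrite !sid_shift, !tid_shift by lia; apply oc_idl; lia.
- intros n d x h; rewrite !sid_shift, !tid_shift by lia; apply oc_idr; lia.
- intros n d y x h; rewrite !sid_shift, !tid_shift by lia; apply oc_id; lia.
- intros n d d' y' y x' x h h1 h2; rewrite !sid_shift, !tid_shift by lia.
  apply oc_ich; lia.
Defined.

Lemma osid_shift (A : ocat) n d (x : cell A (S n)) : d <= n ->
  @sid (oshift A) (@oid (oshift A)) n d x = osid A d x.
Proof. apply (@sid_shift A (@oid A)). Qed.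

Lemma otid_shift (A : ocat) n d (x : cell A (S n)) : d <= n ->
  @tid (oshift A) (@oid (oshift A)) n d x = otid A d x.
Proof. apply (@tid_shift A (@oid A)). Qed.

Lemma omap_shift (A B : ocat) (f : ghom A B) :
  omap f -> @omap (oshift A) (oshift B) (fshift f).
Proof.
intros [f1 f2]; split.
- intros n x; apply f1.
- intros n d y x h; rewrite osid_shift, otid_shift by lia; apply f2; lia.
Qed.

Fixpoint s0 (X : gset) n : cell X n -> cell X 0 :=
  match n with 0 => fun x => x | S n => fun x => s0 (gs x) end.
Fixpoint t0 (X : gset) n : cell X n -> cell X 0 :=
  match n with 0 => fun x => x | S n => fun x => t0 (gt x) end.
Fixpoint id0 (A : ocat) n (x : cell A 0) : cell A n :=
  match n with 0 => x | S n => oid (id0 n x) end.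

Lemma s0_shift (X : gset) n (x : cell X (S n)) :
  s0 x = gs (s0 (X := shift X) x : cell X 1).
Proof. revert x; induction n as [|n IH]; intros x; [reflexivity|apply IH]. Qed.

Lemma t0_shift (X : gset) n (x : cell X (S n)) :
  t0 x = gt (t0 (X := shift X) x : cell X 1).
Proof. revert x; induction n as [|n IH]; intros x; [reflexivity|apply IH]. Qed.

Lemma s0_gt (X : gset) n (x : cell X (S (S n))) : s0 (gt x) = s0 (gs x).
Proof. cbn; rewrite gs_glob; reflexivity. Qed.

Lemma t0_gs (X : gset) n (x : cell X (S (S n))) : t0 (gs x) = t0 (gt x).
Proof. cbn; rewrite gt_glob; reflexivity. Qed.

Lemma gmap_s0 (X Y : gset) (f : ghom X Y) n (x : cell X n) :
  s0 (gmap f x) = gmap f (s0 x).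
Proof. induction n as [|n IH]; [reflexivity|]; cbn; rewrite gmap_s; apply IH. Qed.

Lemma sid_top (A : ocat) n (x : cell A n) : osid A n x = id0 n (s0 x).
Proof.
induction n as [|n IH]; [reflexivity|]. exact (f_equal oid (IH (gs x))).
Qed.

Lemma tid_top (A : ocat) n (x : cell A n) : otid A n x = id0 n (t0 x).
Proof.
induction n as [|n IH]; [reflexivity|]. exact (f_equal oid (IH (gt x))).
Qed.

Lemma s0_id0 (A : ocat) n (x : cell A 0) : s0 (id0 n x) = x.
Proof. induction n as [|n IH]; [reflexivity|]; cbn; rewrite oid_s; exact IH. Qed.

Lemma t0_id0 (A : ocat) n (x : cell A 0) : t0 (id0 n x) = x.
Proof. induction n as [|n IH]; [reflexivity|]; cbn; rewrite oid_t; exact IH. Qed.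

Lemma cmpb_top (A : ocat) n (y x : cell A n) :
  s0 y = t0 x -> osid A n y = otid A n x.
Proof. rewrite sid_top, tid_top; intros ->; reflexivity. Qed.

Lemma s0_oc (A : ocat) n d (y x : cell A n) : 0 < d <= n ->
  osid A d y = otid A d x -> s0 (oc d y x) = s0 x.
Proof.
revert d y x; induction n as [|n IH]; intros d y x h E; [lia|].
destruct d as [|[|d]]; [lia| |]; cbn [s0].
- rewrite oc_s1; auto.
- rewrite oc_s by (lia || exact E). apply IH; [lia|apply (sid_tid_gs (@oid_s A));
    [lia|exact E]].
Qed.

Lemma t0_oc (A : ocat) n d (y x : cell A n) : 0 < d <= n ->
  osid A d y = otid A d x -> t0 (oc d y x) = t0 y.
Proof.
revert d y x; induction n as [|n IH]; intros d y x h E; [lia|].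
destruct d as [|[|d]]; [lia| |]; cbn [t0].
- rewrite oc_t1; auto.
- rewrite oc_t by (lia || exact E). apply IH; [lia|apply (sid_tid_gt (@oid_s A));
    [lia|exact E]].
Qed.

Lemma sid_id0 (A : ocat) n d (x : cell A 0) : osid A d (id0 n x) = id0 n x.
Proof.
revert d; induction n as [|n IH]; intros [|d]; try reflexivity.
change (oid (osid A d (gs (id0 (S n) x))) = oid (id0 n x)).
cbn [id0]; rewrite oid_s, IH; reflexivity.
Qed.

Lemma tid_id0 (A : ocat) n d (x : cell A 0) : otid A d (id0 n x) = id0 n x.
Proof.
revert d; induction n as [|n IH]; intros [|d]; try reflexivity.
change (oid (otid A d (gt (id0 (S n) x))) = oid (id0 n x)).
cbn [id0]; rewrite oid_t, IH; reflexivity.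
Qed.

Lemma oc_id0 (A : ocat) n d (x : cell A 0) : 0 < d <= n ->
  oc d (id0 n x) (id0 n x) = id0 n x.
Proof.
intros h. pose proof (oc_idl (x := id0 n x) h) as E.
rewrite !tid_id0, sid_id0 in E; auto.
Qed.

Lemma oc_idr_top (A : ocat) n (x : cell A (S n)) :
  oc (S n) x (id0 (S n) (s0 x)) = x.
Proof.
rewrite <- sid_top; apply oc_idr; [lia|].
symmetry; apply tid_sid, oid_t.
Qed.

Lemma oc_idl_top (A : ocat) n (x : cell A (S n)) :
  oc (S n) (id0 (S n) (t0 x)) x = x.
Proof.
rewrite <- tid_top; apply oc_idl; [lia|]. apply sid_tid, oid_s.
Qed.

(** * The free strict omega-category *)

Section Chains.
Variables (O E : Type) (s t : E -> O).

Fixpoint chain (x : O) (l : list E) : Prop :=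
  match l with [] => True | e :: l => s e = x /\ chain (t e) l end.
Fixpoint fin (x : O) (l : list E) : O :=
  match l with [] => x | e :: l => fin (t e) l end.

Lemma chain_app x l l' : chain x (l ++ l') <-> chain x l /\ chain (fin x l) l'.
Proof. revert x; induction l as [|e l IH]; intros x; cbn; [|rewrite IH]; tauto. Qed.

Lemma fin_app x l l' : fin x (l ++ l') = fin (fin x l) l'.
Proof. revert x; induction l as [|e l IH]; intros x; cbn; auto. Qed.

(** Truncation does no harm: the edge lists of paths that are composable below the top codimension
    have equal lengths. *)
Fixpoint zip (f : E -> E -> E) (l l' : list E) : list E :=
  match l, l' with
  | e :: l, e' :: l' => f e e' :: zip f l l'
  | _, _ => []
  end.
End Chains.

Lemma fin_map (O E O' E' : Type) (t : E -> O) (t' : E' -> O') (f : O -> O')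
  (g : E -> E') :
  forall l x, (forall e, In e l -> t' (g e) = f (t e)) ->
  fin t' (f x) (map g l) = f (fin t x l).
Proof.
induction l as [|e l IH]; intros x H; cbn; [reflexivity|].
rewrite H by (left; reflexivity). apply IH; intros; apply H; right; assumption.
Qed.

Lemma chain_map (O E O' E' : Type) (s t : E -> O) (s' t' : E' -> O') (f : O -> O')
  (g : E -> E') :
  forall l x, (forall e, In e l -> s' (g e) = f (s e) /\ t' (g e) = f (t e)) ->
  chain s t x l -> chain s' t' (f x) (map g l).
Proof.
induction l as [|e l IH]; intros x H; cbn; [tauto|]. intros [<- C].
destruct (H e) as [H1 H2]; [left; reflexivity|]. split; [exact H1|].
rewrite H2; apply IH; [|exact C]. intros; apply H; right; assumption.
Qed.

(* [raw n X] and [valid] describe the [n]-cells of the free omega-category on [X] as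
   an iterated free category: an [(n+1)]-cell is a path [(x, [e1; ...; ek])] from
   [x], the edges [ei] being [n]-cells of the free omega-category on [shift X]. *)
Fixpoint raw (n : nat) (X : gset) : Type :=
  match n with 0 => cell X 0 | S n => (cell X 0 * list (raw n (shift X)))%type end.

Definition rst n X : raw n X -> cell X 0 :=
  match n return raw n X -> cell X 0 with 0 => fun r => r | S n => fst end.
Arguments rst {n X} r.

Definition esrc n X (e : raw n (shift X)) : cell X 0 := gs (rst e : cell X 1).
Definition etgt n X (e : raw n (shift X)) : cell X 0 := gt (rst e : cell X 1).
Arguments esrc {n X} e.
Arguments etgt {n X} e.

Definition ren n X : raw n X -> cell X 0 :=
  match n return raw n X -> cell X 0 with
  | 0 => fun r => r
  | S n => fun r => fin etgt (fst r) (snd r)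
  end.
Arguments ren {n X} r.

Fixpoint valid (n : nat) (X : gset) : raw n X -> Prop :=
  match n return raw n X -> Prop with
  | 0 => fun _ => True
  | S n => fun r => chain esrc etgt (fst r) (snd r) /\ Forall (@valid n (shift X))
    (snd r)
  end.
Arguments valid {n X} r.

Fixpoint rmap n X Y (f : ghom X Y) : raw n X -> raw n Y :=
  match n return raw n X -> raw n Y with
  | 0 => fun r => gmap f r
  | S n => fun r => (gmap f (fst r), map (@rmap n _ _ (fshift f)) (snd r))
  end.
Arguments rmap {n X Y} f r.

Fixpoint rs n X : raw (S n) X -> raw n X :=
  match n return raw (S n) X -> raw n X with
  | 0 => fun r => fst r
  | S n => fun r => (fst r, map (@rs n (shift X)) (snd r))
  end.
Arguments rs {n X} r.

Fixpoint rt n X : raw (S n) X -> raw n X :=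
  match n return raw (S n) X -> raw n X with
  | 0 => fun r => ren r
  | S n => fun r => (fst r, map (@rt n (shift X)) (snd r))
  end.
Arguments rt {n X} r.

Fixpoint rid n X : raw n X -> raw (S n) X :=
  match n return raw n X -> raw (S n) X with
  | 0 => fun r => (r, [])
  | S n => fun r => (fst r, map (@rid n (shift X)) (snd r))
  end.
Arguments rid {n X} r.

(** In codimension [n] the common boundary is a vertex and paths are concatenated; in lower
    codimension the paths share their vertices and are composed edge by edge. The recursion keeps
    [d], because shifting lowers the dimensions of a cell and of its boundary together. *)
Fixpoint rcomp n d X : raw n X -> raw n X -> raw n X :=
  match n return raw n X -> raw n X -> raw n X with
  | 0 => fun y x => y
  | S n' => fun y x =>
      if S n' <=? d then (fst x, snd x ++ snd y)
      else (fst x, zip (@rcomp n' d (shift X)) (snd y) (snd x))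
  end.
Arguments rcomp {n} d {X} y x.

Fixpoint rsid n d X : raw n X -> raw n X :=
  match n return raw n X -> raw n X with
  | 0 => fun r => r
  | S n' => fun r => if S n' <=? d then (fst r, [])
                     else (fst r, map (@rsid n' d (shift X)) (snd r))
  end.
Arguments rsid {n} d {X} r.

Fixpoint rtid n d X : raw n X -> raw n X :=
  match n return raw n X -> raw n X with
  | 0 => fun r => r
  | S n' => fun r => if S n' <=? d then (ren r, [])
                     else (fst r, map (@rtid n' d (shift X)) (snd r))
  end.
Arguments rtid {n} d {X} r.

Lemma valid_cons n X x (e : raw n (shift X)) l :
  valid (n := S n) (X := X) (x, e :: l) <->
  esrc e = x /\ valid e /\ valid (n := S n) (X := X) (etgt e, l).
Proof.
cbn; split.
- intros [[H1 H2] H3]; inversion H3; tauto.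
- intros [H1 [H2 [H3 H4]]]; repeat split; auto.
Qed.

(** The vertices of the path [e] are 1-cells of [X], and consecutive ones bound 2-cells, hence all
    are parallel: the ends of an edge may be read off at its first or at its last vertex. *)
Lemma ren_parallel n X (e : raw n (shift X)) : valid e ->
  gs (ren e : cell X 1) = esrc e /\ gt (ren e : cell X 1) = etgt e.
Proof.
destruct n as [|n]; [split; reflexivity|].
destruct e as [x l]; intros [C _]; cbn in x, l, C.
unfold esrc, etgt; cbn [ren rst fst snd].
revert x C; induction l as [|e l IH]; intros x C; [split; reflexivity|].
destruct C as [<- C]; cbn [fin]. destruct (IH _ C) as [-> ->].
unfold esrc, etgt; cbn. split; [symmetry; apply gs_glob|apply gt_glob].
Qed.

Lemma rst_rs n X (r : raw (S n) X) : rst (rs r) = rst r.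
Proof. destruct n; reflexivity. Qed.

Lemma rst_rt n X (e : raw (S n) (shift X)) : valid e ->
  esrc (rt e) = esrc e /\ etgt (rt e) = etgt e.
Proof.
intros v; destruct n; [|split; reflexivity].
destruct (ren_parallel v); split; assumption.
Qed.

Lemma rst_rid n X (r : raw n X) : rst (rid r) = rst r.
Proof. destruct n; reflexivity. Qed.

Lemma rst_rcomp n d X (y x : raw n X) : 0 < n -> rst (rcomp d y x) = rst x.
Proof. destruct n; [lia|]; cbn -[Nat.leb]; destruct (S n <=? d); reflexivity. Qed.

Lemma rst_rsid n d X (r : raw n X) : rst (rsid d r) = rst r.
Proof. destruct n as [|n]; [reflexivity|]; cbn -[Nat.leb];
destruct (S n <=? d); reflexivity. Qed.

Lemma etgt_rtid n d X (e : raw n (shift X)) : valid e -> etgt (rtid d e) = etgt e.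
Proof.
intros v; destruct n as [|n]; [reflexivity|].
cbn -[Nat.leb]; unfold etgt at 1; destruct (S n <=? d); [|reflexivity].
apply (ren_parallel v).
Qed.

Lemma esrc_rtid n d X (e : raw n (shift X)) : valid e -> esrc (rtid d e) = esrc e.
Proof.
intros v; destruct n as [|n]; [reflexivity|].
cbn -[Nat.leb]; unfold esrc at 1; destruct (S n <=? d); [|reflexivity].
apply (ren_parallel v).
Qed.

Lemma rst_rmap n X Y (f : ghom X Y) (r : raw n X) : rst (rmap f r) = gmap f (rst r).
Proof. destruct n; reflexivity. Qed.

Lemma esrc_rmap n X Y (f : ghom X Y) (r : raw n (shift X)) :
  esrc (rmap (fshift f) r) = gmap f (esrc r).
Proof. unfold esrc; rewrite rst_rmap; apply gmap_s. Qed.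

Lemma etgt_rmap n X Y (f : ghom X Y) (r : raw n (shift X)) :
  etgt (rmap (fshift f) r) = gmap f (etgt r).
Proof. unfold etgt; rewrite rst_rmap; apply gmap_t. Qed.

Lemma ren_rmap n X Y (f : ghom X Y) (r : raw n X) : ren (rmap f r) = gmap f (ren r).
Proof.
destruct n as [|n]; [reflexivity|].
cbn; apply fin_map; intros; apply etgt_rmap.
Qed.

Lemma valid_rmap n X Y (f : ghom X Y) (r : raw n X) : valid r -> valid (rmap f r).
Proof.
revert X Y f r; induction n as [|n IH]; intros X Y f r; [exact id|].
intros [C V]; split; cbn.
- apply (chain_map (s := esrc) (t := etgt)); [|exact C].
  split; [apply esrc_rmap|apply etgt_rmap].
- apply Forall_map; revert V; apply Forall_impl; intros e; apply IH.
Qed.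

Lemma valid_map n m X (g : raw n (shift X) -> raw m (shift X)) x l :
  (forall e, In e l -> valid e ->
     esrc (g e) = esrc e /\ etgt (g e) = etgt e /\ valid (g e)) ->
  valid (n := S n) (X := X) (x, l) -> valid (n := S m) (X := X) (x, map g l).
Proof.
revert x; induction l as [|e l IH]; intros x H; [intros; split; constructor|].
cbn [map]; rewrite !valid_cons; intros [E [v V]].
destruct (H e) as [H1 [H2 H3]]; [left; reflexivity|exact v|].
rewrite H1, H2; repeat split; [exact E|exact H3| |];
apply IH; auto; intros; apply H; auto; right; assumption.
Qed.

Lemma valid_rs n X (r : raw (S n) X) : valid r -> valid (rs r).
Proof.
revert X r; induction n as [|n IH]; intros X [x l] v; [exact I|].
apply valid_map; [|exact v]. intros e _ ve.
unfold esrc, etgt; rewrite rst_rs; auto.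
Qed.

Lemma valid_rt n X (r : raw (S n) X) : valid r -> valid (rt r).
Proof.
revert X r; induction n as [|n IH]; intros X [x l] v; [exact I|].
apply valid_map; [|exact v]. intros e _ ve.
destruct (rst_rt ve); auto.
Qed.

Lemma valid_rid n X (r : raw n X) : valid r -> valid (rid r).
Proof.
revert X r; induction n as [|n IH].
- intros X r _; split; constructor.
- intros X [x l] v. apply valid_map; [|exact v]. intros e _ ve.
  unfold esrc, etgt; rewrite rst_rid; auto.
Qed.

(** Below the top codimension, composability forces two paths to have equally many edges, pairwise
    composable; this is the induction that goes with it. *)
Lemma zip_ind n d X (P : list (raw n (shift X)) -> list (raw n (shift X)) -> Prop) :
  P [] [] ->
  (forall e e' l l', rsid d e = rtid d e' -> valid e -> valid e' ->
     map (rsid d) l = map (rtid d) l' ->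
     Forall valid l -> Forall valid l' -> P l l' -> P (e :: l) (e' :: l')) ->
  forall l l', map (rsid d) l = map (rtid d) l' ->
    Forall valid l -> Forall valid l' -> P l l'.
Proof.
intros H0 HS l; induction l as [|e l IH]; intros [|e' l'] E V V';
  try discriminate E; [exact H0|].
injection E as E1 E2. inversion V; inversion V'; subst.
apply HS; auto.
Qed.

Lemma rcomp_top n d X (y x : raw (S n) X) : n < d ->
  rcomp d y x = (fst x, snd x ++ snd y).
Proof. intros h; cbn -[Nat.leb]. rewrite (proj2 (Nat.leb_le _ _) h); reflexivity. Qed.

Lemma rcomp_low n d X (y x : raw (S n) X) : d <= n ->
  rcomp d y x = (fst x, zip (rcomp d) (snd y) (snd x)).
Proof.
intros h; cbn -[Nat.leb].
rewrite (proj2 (Nat.leb_gt _ _)) by lia; reflexivity.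
Qed.

Lemma rsid_top n d X (r : raw (S n) X) : n < d -> rsid d r = (fst r, []).
Proof. intros h; cbn -[Nat.leb]. rewrite (proj2 (Nat.leb_le _ _) h); reflexivity. Qed.

Lemma rsid_low n d X (r : raw (S n) X) : d <= n ->
  rsid d r = (fst r, map (rsid d) (snd r)).
Proof.
intros h; cbn -[Nat.leb].
rewrite (proj2 (Nat.leb_gt _ _)) by lia; reflexivity.
Qed.

Lemma rtid_top n d X (r : raw (S n) X) : n < d -> rtid d r = (ren r, []).
Proof. intros h; cbn -[Nat.leb]. rewrite (proj2 (Nat.leb_le _ _) h); reflexivity. Qed.

Lemma rtid_low n d X (r : raw (S n) X) : d <= n ->
  rtid d r = (fst r, map (rtid d) (snd r)).
Proof.
intros h; cbn -[Nat.leb].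
rewrite (proj2 (Nat.leb_gt _ _)) by lia; reflexivity.
Qed.

Ltac top_low n d h :=
  destruct (le_lt_dec d n) as [h|h];
  [rewrite ?rcomp_low, ?rsid_low, ?rtid_low by lia
  |rewrite ?rcomp_top, ?rsid_top, ?rtid_top by lia]; cbn [fst snd].

Lemma valid_rcomp n d X (y x : raw n X) : 0 < d <= n -> valid y -> valid x ->
  rsid d y = rtid d x -> valid (rcomp d y x).
Proof.
revert X y x; induction n as [|n IH]; [intros; lia|]; intros X [y ly] [x lx] h.
intros [Cy Vy] [Cx Vx]; cbn [fst snd] in *; top_low n d h'.
- intros [-> E]%pair_equal_spec; revert x Cy Cx; pattern ly, lx;
    revert ly lx E Vy Vx; apply zip_ind.
  + split; constructor.
  + intros e e' l l' E v v' _ _ _ HI x [<- Cy] [E' Cx]; cbn [zip].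
    assert (Et : etgt e = etgt e').
    { rewrite <- (etgt_rtid d v'), <- E; unfold etgt; rewrite rst_rsid; reflexivity. }
    rewrite Et in Cy. destruct (HI _ Cy Cx) as [C V].
    unfold esrc, etgt in *; cbn [valid chain fst snd] in *.
    unfold esrc, etgt in *; rewrite rst_rcomp by lia.
    split; [split; assumption|constructor; [|exact V]].
    apply IH; auto; lia.
- intros [= ->]; split; cbn [fst snd]; [rewrite chain_app|rewrite Forall_app]; auto.
Qed.

Lemma ren_map_rt n X x (l : list (raw (S n) (shift X))) : Forall valid l ->
  fin etgt x (map rt l) = fin etgt x l.
Proof.
intros V; refine (@fin_map _ _ _ _ etgt etgt (fun x => x) rt l x _).
intros e i. rewrite Forall_forall in V. apply rst_rt, V, i.
Qed.

Lemma rs_rs n X (r : raw (S (S n)) X) : rs (rs r) = rs (rt r).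
Proof.
revert X r; induction n as [|n IH]; intros X [x l]; [reflexivity|].
cbn; rewrite !map_map; f_equal; apply map_ext; intros; apply IH.
Qed.

Lemma rt_rt n X (r : raw (S (S n)) X) : valid r -> rt (rt r) = rt (rs r).
Proof.
revert X r; induction n as [|n IH]; intros X [x l] [C V].
- cbn in *. etransitivity; [exact (@ren_map_rt 0 X x l V)|]. symmetry.
  exact (@fin_map (cell X 0) (raw 1 (shift X)) _ (raw 0 (shift X))
    etgt etgt (fun x => x)
           rs l x (fun _ _ => eq_refl)).
- cbn in *; rewrite !map_map; f_equal; apply map_ext_in; intros e i; apply IH.
  rewrite Forall_forall in V; apply V, i.
Qed.

Lemma rs_rid n X (r : raw n X) : rs (rid r) = r.
Proof.
revert X r; induction n as [|n IH]; [reflexivity|]; intros X [x l].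
cbn; rewrite map_map; f_equal; etransitivity; [|apply map_id].
apply map_ext; intros; apply IH.
Qed.

Lemma rt_rid n X (r : raw n X) : rt (rid r) = r.
Proof.
revert X r; induction n as [|n IH]; [reflexivity|]; intros X [x l].
cbn; rewrite map_map; f_equal; etransitivity; [|apply map_id].
apply map_ext; intros; apply IH.
Qed.

(** [rsid] recurses through [shift], from dimension 0 upwards, whereas [sid] takes sources from the
    top. This equation reconciles the two recursions. *)
Lemma rsidE n d X (r : raw (S n) X) : rsid (S d) r = rid (rsid d (rs r)).
Proof.
revert X r; induction n as [|n IH]; intros X [x l]; [reflexivity|].
cbn [rs fst snd]. top_low n d h; cbn [rid fst snd map]; [|reflexivity].
f_equal; rewrite !map_map; apply map_ext; intros e; apply IH.
Qed.

Lemma rtidE n d X (r : raw (S n) X) : valid r -> rtid (S d) r = rid (rtid d (rt r)).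
Proof.
revert X r; induction n as [|n IH]; intros X [x l]; [reflexivity|].
intros [C V]. cbn [rt fst snd] in *. top_low n d h; cbn [rid fst snd map].
- f_equal; rewrite !map_map; apply map_ext_in; intros e i; apply IH.
  rewrite Forall_forall in V; apply V, i.
- f_equal; symmetry; apply ren_map_rt, V.
Qed.

Lemma rsid0 n X (r : raw n X) : rsid 0 r = r.
Proof.
revert X r; induction n as [|n IH]; [reflexivity|]; intros X [x l].
cbn; f_equal; etransitivity; [|apply map_id]; apply map_ext; intros; apply IH.
Qed.

Lemma rtid0 n X (r : raw n X) : rtid 0 r = r.
Proof.
revert X r; induction n as [|n IH]; [reflexivity|]; intros X [x l].
cbn; f_equal; etransitivity; [|apply map_id]; apply map_ext; intros; apply IH.
Qed.

Definition tcell X n := {r : raw n X | valid r}.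

Lemma tcell_eq X n (a b : tcell X n) : proj1_sig a = proj1_sig b -> a = b.
Proof.
destruct a as [a p], b as [b q]; cbn; intros <-; f_equal; apply proof_irrelevance.
Qed.

Definition TG (X : gset) : gset.
Proof.
refine (@GSet (tcell X)
  (fun n r => exist _ (rs (proj1_sig r)) (valid_rs (proj2_sig r)))
  (fun n r => exist _ (rt (proj1_sig r)) (valid_rt (proj2_sig r))) _ _);
  intros n [r v]; apply tcell_eq; cbn.
- apply rs_rs.
- apply rt_rt, v.
Defined.

Definition tident X n (r : tcell X n) : tcell X (S n) :=
  exist _ (rid (proj1_sig r)) (valid_rid (proj2_sig r)).

Lemma tident_s X n (x : cell (TG X) n) : gs (X := TG X) (tident x) = x.
Proof. apply tcell_eq, rs_rid. Qed.

Lemma tident_t X n (x : cell (TG X) n) : gt (X := TG X) (tident x) = x.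
Proof. apply tcell_eq, rt_rid. Qed.

(** The test is on validity of the raw composite, not on composability; by [valid_rcomp] the default
    [y] is not met on composable pairs with [0 < d <= n]. *)
Definition tcomp X n d (y x : tcell X n) : tcell X n :=
  match excluded_middle_informative (valid (rcomp d (proj1_sig y) (proj1_sig x))) with
  | left v => exist _ _ v
  | right _ => y
  end.

Lemma proj_sid X n d (r : tcell X n) :
  proj1_sig (@sid (TG X) (@tident X) n d r) = rsid d (proj1_sig r).
Proof.
revert d r; induction n as [|n IH]; intros [|d] r; try reflexivity.
- symmetry; apply rsid0.
- rewrite rsidE. apply (f_equal rid), (IH d (gs (X := TG X) r)).
Qed.

Lemma proj_tid X n d (r : tcell X n) :
  proj1_sig (@tid (TG X) (@tident X) n d r) = rtid d (proj1_sig r).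
Proof.
revert d r; induction n as [|n IH]; intros [|d] r; try reflexivity.
- symmetry; apply rtid0.
- rewrite rtidE by exact (proj2_sig r).
  apply (f_equal rid), (IH d (gt (X := TG X) r)).
Qed.

Lemma tcmpb X n d (y x : tcell X n) :
  @sid (TG X) (@tident X) n d y = @tid (TG X) (@tident X) n d x <->
  rsid d (proj1_sig y) = rtid d (proj1_sig x).
Proof.
rewrite <- proj_sid, <- proj_tid; split; [intros ->; reflexivity|apply tcell_eq].
Qed.

Lemma proj_tcomp X n d (y x : tcell X n) : 0 < d <= n ->
  rsid d (proj1_sig y) = rtid d (proj1_sig x) ->
  proj1_sig (tcomp d y x) = rcomp d (proj1_sig y) (proj1_sig x).
Proof.
intros h E; unfold tcomp; destruct excluded_middle_informative as [v|v]; [reflexivity|].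
destruct v; apply valid_rcomp; auto; apply proj2_sig.
Qed.

Lemma rs_rcomp1 n X (y x : raw (S n) X) : valid y -> valid x ->
  rsid 1 y = rtid 1 x -> rs (rcomp 1 y x) = rs x.
Proof.
revert X y x; induction n as [|n IH]; intros X [y ly] [x lx].
{ reflexivity. }
intros [_ Vy] [_ Vx]; cbn [fst snd] in *; top_low (S n) 1 h'; [|lia];
  intros [-> E]%pair_equal_spec.
cbn [fst snd rs]; f_equal.
  pattern ly, lx; revert ly lx E Vy Vx; apply zip_ind; [reflexivity|].
  intros e e' l l' E v v' _ _ _ HI. cbn [zip map]; f_equal; [apply IH; auto;
    lia|exact HI].
Qed.

Lemma rt_rcomp1 n X (y x : raw (S n) X) : valid y -> valid x ->
  rsid 1 y = rtid 1 x -> rt (rcomp 1 y x) = rt y.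
Proof.
revert X y x; induction n as [|n IH]; intros X [y ly] [x lx].
{ intros _ _ [= E]; cbn; rewrite fin_app, E; reflexivity. }
intros [_ Vy] [_ Vx]; cbn [fst snd] in *; top_low (S n) 1 h'; [|lia];
  intros [-> E]%pair_equal_spec.
cbn [fst snd rt]; f_equal.
  pattern ly, lx; revert ly lx E Vy Vx; apply zip_ind; [reflexivity|].
  intros e e' l l' E v v' _ _ _ HI. cbn [zip map]; f_equal; [apply IH; auto;
    lia|exact HI].
Qed.

Lemma rs_rcomp n d X (y x : raw (S n) X) : 0 < d <= n -> valid y -> valid x ->
  rsid (S d) y = rtid (S d) x -> rs (rcomp (S d) y x) = rcomp d (rs y) (rs x).
Proof.
revert X y x; induction n as [|n IH]; [intros; lia|]; intros X [y ly] [x lx] h.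
intros [_ Vy] [_ Vx]; cbn [fst snd rs rt rid] in *; top_low n d h';
  (intros [-> E]%pair_equal_spec || intros _);
cbn [fst snd rs rt rid]; f_equal; [|apply map_app].
  pattern ly, lx; revert ly lx E Vy Vx; apply zip_ind; [reflexivity|].
  intros e e' l l' E v v' _ _ _ HI. cbn [zip map]; f_equal; [apply IH; auto;
    lia|exact HI].
Qed.

Lemma rt_rcomp n d X (y x : raw (S n) X) : 0 < d <= n -> valid y -> valid x ->
  rsid (S d) y = rtid (S d) x -> rt (rcomp (S d) y x) = rcomp d (rt y) (rt x).
Proof.
revert X y x; induction n as [|n IH]; [intros; lia|]; intros X [y ly] [x lx] h.
intros [_ Vy] [_ Vx]; cbn [fst snd rs rt rid] in *; top_low n d h';
  (intros [-> E]%pair_equal_spec || intros _);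
cbn [fst snd rs rt rid]; f_equal; [|apply map_app].
  pattern ly, lx; revert ly lx E Vy Vx; apply zip_ind; [reflexivity|].
  intros e e' l l' E v v' _ _ _ HI. cbn [zip map]; f_equal; [apply IH; auto;
    lia|exact HI].
Qed.

Lemma rid_rcomp n d X (y x : raw n X) : 0 < d <= n -> valid y -> valid x ->
  rsid d y = rtid d x -> rid (rcomp d y x) = rcomp (S d) (rid y) (rid x).
Proof.
revert X y x; induction n as [|n IH]; [intros; lia|]; intros X [y ly] [x lx] h.
intros [_ Vy] [_ Vx]; cbn [fst snd rs rt rid] in *; top_low n d h';
  (intros [-> E]%pair_equal_spec || intros _);
cbn [fst snd rs rt rid]; f_equal; [|apply map_app].
  pattern ly, lx; revert ly lx E Vy Vx; apply zip_ind; [reflexivity|].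
  intros e e' l l' E v v' _ _ _ HI. cbn [zip map]; f_equal; [apply IH; auto;
    lia|exact HI].
Qed.

Lemma rcomp_assoc n d X (z y x : raw n X) :
  rcomp d z (rcomp d y x) = rcomp d (rcomp d z y) x.
Proof.
revert X z y x; induction n as [|n IH]; [reflexivity|]; intros X [z lz] [y ly] [x lx].
top_low n d h; f_equal; [|symmetry; apply app_assoc].
revert ly lx; induction lz as [|e lz IHl]; intros [|e' ly] [|e'' lx]; try reflexivity.
cbn [zip]; f_equal; [apply IH|apply IHl].
Qed.

Lemma rcomp_idl n d X (x : raw n X) : rcomp d (rtid d x) x = x.
Proof.
revert X x; induction n as [|n IH]; [reflexivity|]; intros X [x lx].
top_low n d h; f_equal; [|apply app_nil_r].
induction lx as [|e lx IHl]; [reflexivity|]; cbn [map zip]; f_equal; auto.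
Qed.

Lemma rcomp_idr n d X (x : raw n X) : rcomp d x (rsid d x) = x.
Proof.
revert X x; induction n as [|n IH]; [reflexivity|]; intros X [x lx].
top_low n d h; [f_equal|reflexivity].
induction lx as [|e lx IHl]; [reflexivity|]; cbn [map zip]; f_equal; auto.
Qed.

Lemma zip_app (E : Type) (f : E -> E -> E) (a b c d : list E) :
  length a = length b -> zip f a b ++ zip f c d = zip f (a ++ c) (b ++ d).
Proof.
revert b; induction a as [|e a IH]; intros [|e' b] [=]; [reflexivity|].
cbn; f_equal; auto.
Qed.

(** When [d'] is the top codimension, this says that zipping commutes with concatenation, which
    holds because the composable paths [x'] and [x] have equal lengths. *)
Lemma rcomp_ich n d d' X (y' y x' x : raw n X) : d < d' -> d' <= n ->
  rsid d x' = rtid d x ->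
  rcomp d' (rcomp d y' y) (rcomp d x' x) = rcomp d (rcomp d' y' x') (rcomp d' y x).
Proof.
revert X y' y x' x; induction n as [|n IH]; [lia|].
intros X [y' ly'] [y ly] [x' lx'] [x lx] h1 h2.
assert (h : d <= n) by lia; rewrite rsid_low, rtid_low by exact h.
cbn [fst snd]; intros [-> E]%pair_equal_spec.
rewrite !(fun y x => @rcomp_low n d X y x h).
destruct (le_lt_dec d' n) as [h'|h'];
[rewrite !(fun y x => @rcomp_low n d' X y x h')
|rewrite !(fun y x => @rcomp_top n d' X y x h')]; cbn [fst snd]; f_equal.
- revert ly' ly lx E; induction lx' as [|e lx' IHl];
  intros [|a ly'] [|b ly] [|c lx] E; try reflexivity; try discriminate E.
  cbn [zip map] in *; injection E as E1 E2; f_equal; auto.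
- apply zip_app. apply (f_equal (@length _)) in E; rewrite !length_map in E; exact E.
Qed.

Definition TO (X : gset) : ocat.
Proof.
refine (@OCat (TG X) (@tident X) (@tcomp X) (@tident_s X) (@tident_t X)
  _ _ _ _ _ _ _ _ _).
- intros n y x E%tcmpb; apply tcell_eq.
  change (rs (proj1_sig (tcomp 1 y x)) = rs (proj1_sig x)).
  rewrite proj_tcomp by (lia || exact E). apply rs_rcomp1; auto; apply proj2_sig.
- intros n y x E%tcmpb; apply tcell_eq.
  change (rt (proj1_sig (tcomp 1 y x)) = rt (proj1_sig y)).
  rewrite proj_tcomp by (lia || exact E). apply rt_rcomp1; auto; apply proj2_sig.
- intros n d y x h E; pose proof (@sid_tid_gs (TG X) (@tident X) (@tident_s X)
    _ _ _ _ h E) as E'.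
  apply tcmpb in E, E'. apply tcell_eq.
  change (rs (proj1_sig (tcomp (S d) y x))
    = proj1_sig (tcomp d (gs (X := TG X) y : tcell X n) (gs (X := TG X)
      x : tcell X n))).
  rewrite !proj_tcomp by (lia || assumption).
  apply rs_rcomp; auto; apply proj2_sig.
- intros n d y x h E; pose proof (@sid_tid_gt (TG X) (@tident X) (@tident_s X)
    _ _ _ _ h E) as E'.
  apply tcmpb in E, E'. apply tcell_eq.
  change (rt (proj1_sig (tcomp (S d) y x))
    = proj1_sig (tcomp d (gt (X := TG X) y : tcell X n) (gt (X := TG X)
      x : tcell X n))).
  rewrite !proj_tcomp by (lia || assumption).
  apply rt_rcomp; auto; apply proj2_sig.
- intros n d z y x h E1 E2 E3 E4. apply tcmpb in E1, E2, E3, E4.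
  apply tcell_eq. rewrite !proj_tcomp by assumption. apply rcomp_assoc.
- intros n d x h E%tcmpb. apply tcell_eq.
  rewrite proj_tcomp, proj_tid by assumption. apply rcomp_idl.
- intros n d x h E%tcmpb. apply tcell_eq.
  rewrite proj_tcomp, proj_sid by assumption. apply rcomp_idr.
- intros n d y x h E.
  assert (E' : @sid (TG X) (@tident X) (S n) (S d) (tident y)
               = @tid (TG X) (@tident X) (S n) (S d) (tident x)).
  { apply tcmpb in E; apply tcmpb; cbn [tident proj1_sig].
    rewrite rsidE, rtidE, rs_rid, rt_rid, E by (apply valid_rid, proj2_sig).
    reflexivity. }
  apply tcmpb in E, E'. apply tcell_eq.
  rewrite proj_tcomp by (lia || exact E'). cbn [tident proj1_sig].
  rewrite proj_tcomp by assumption.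
  apply rid_rcomp; auto; apply proj2_sig.
- intros n d d' y' y x' x h1 h2 h3 E1 E2 E3 E4 E5 E6.
  apply tcmpb in E1, E2, E3, E4, E5, E6. apply tcell_eq.
  rewrite !proj_tcomp by (lia || assumption). apply rcomp_ich; auto.
Defined.

Lemma rs_rmap n X Y (f : ghom X Y) (r : raw (S n) X) : rs (rmap f r) = rmap f (rs r).
Proof.
revert X Y f r; induction n as [|n IH]; [reflexivity|]; intros X Y f [x l].
cbn [rs rmap fst snd]; rewrite !map_map; f_equal; apply map_ext; intros e.
exact (IH _ _ (fshift f) e).
Qed.

Lemma rt_rmap n X Y (f : ghom X Y) (r : raw (S n) X) : rt (rmap f r) = rmap f (rt r).
Proof.
revert X Y f r; induction n as [|n IH]; [intros; exact (ren_rmap f r)|].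
intros X Y f [x l].
cbn [rt rmap fst snd]; rewrite !map_map; f_equal; apply map_ext; intros e.
exact (IH _ _ (fshift f) e).
Qed.

Definition Tmap (X Y : gset) (f : ghom X Y) : ghom (TG X) (TG Y).
Proof.
refine (@GHom (TG X) (TG Y)
  (fun n r => exist _ (rmap f (proj1_sig r)) (valid_rmap f (proj2_sig r))) _ _).
- intros n r; apply tcell_eq, rs_rmap.
- intros n r; apply tcell_eq, rt_rmap.
Defined.

Lemma rid_rmap X Y (f : ghom X Y) n (r : raw n X) : rmap f (rid r) = rid (rmap f r).
Proof.
revert X Y f r; induction n as [|n IH]; [reflexivity|]; intros X Y f [x l].
cbn [rid rmap fst snd]; rewrite !map_map; f_equal; apply map_ext; intros e.
exact (IH _ _ (fshift f) e).
Qed.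

Lemma rcomp_rmap X Y (f : ghom X Y) n d (y x : raw n X) :
  rmap f (rcomp d y x) = rcomp d (rmap f y) (rmap f x).
Proof.
revert X Y f y x; induction n as [|n IH]; [reflexivity|]; intros X Y f [y ly] [x lx].
top_low n d h; cbn; f_equal; [|apply map_app].
revert lx; induction ly as [|e ly IHl]; intros [|e' lx]; try reflexivity.
cbn; f_equal; auto.
Qed.

Lemma omap_Tmap (X Y : gset) (f : ghom X Y) : @omap (TO X) (TO Y) (Tmap f).
Proof.
assert (I : forall n (x : tcell X n), gmap (Tmap f) (tident x)
  = tident (gmap (Tmap f) x))
  by (intros; apply tcell_eq, rid_rmap).
split; [exact I|].
intros n d y x h E.
assert (E' := E). apply (f_equal (@gmap _ _ (Tmap f) n)) in E'.
rewrite (@gmap_sid (TO X) (TO Y) (Tmap f) I), (@gmap_tid (TO X) (TO Y) (Tmap f) I)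
  in E'.
apply tcmpb in E, E'. apply tcell_eq. cbn.
rewrite !proj_tcomp by assumption. apply rcomp_rmap.
Qed.

Lemma rmap_ext X Y (f g : ghom X Y) n (r : raw n X) :
  (forall n (x : cell X n), gmap f x = gmap g x) -> rmap f r = rmap g r.
Proof. intros E; rewrite (ghom_eq E); reflexivity. Qed.

Lemma rmap_id X n (r : raw n X) : rmap (ghom_id X) r = r.
Proof.
revert X r; induction n as [|n IH]; [reflexivity|]; intros X [x l].
cbn; f_equal; etransitivity; [|apply map_id]; apply map_ext; intros e.
rewrite <- (IH _ e) at 2. apply rmap_ext; reflexivity.
Qed.

Lemma rmap_comp X Y Z (g : ghom Y Z) (f : ghom X Y) n (r : raw n X) :
  rmap g (rmap f r) = rmap (ghom_comp g f) r.
Proof.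
revert X Y Z g f r; induction n as [|n IH]; [reflexivity|]; intros X Y Z g f [x l].
cbn; f_equal; rewrite map_map; apply map_ext; intros e.
rewrite IH. apply rmap_ext; reflexivity.
Qed.

(** * Evaluation of paths and the universal property of the free omega-category *)

Fixpoint pfold (O E C : Type) (t : E -> O) (u : O -> C) (m : C -> C -> C)
  (h : E -> C) (x : O) (l : list E) : C :=
  match l with [] => u x | e :: l => m (pfold t u m h (t e) l) (h e) end.

(* The extension of [f] to the free omega-category: edges of a path are evaluated
   in [oshift A], then composed along dimension 0. *)
Fixpoint ext (n : nat) (X : gset) (A : ocat) (f : ghom X A) : raw n X -> cell A n :=
  match n return raw n X -> cell A n with
  | 0 => fun r => gmap f r
  | S n => fun r =>
      pfold etgt (fun x => id0 (S n) (gmap f x)) (oc (S n))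
        (@ext n (shift X) (oshift A) (fshift f)) (fst r) (snd r)
  end.
Arguments ext {n X A} f r.

Lemma ext_nil n X (A : ocat) (f : ghom X A) x :
  ext f ((x, []) : raw (S n) X) = id0 (S n) (gmap f x).
Proof. reflexivity. Qed.

Lemma ext_cons n X (A : ocat) (f : ghom X A) x e l :
  ext f ((x, e :: l) : raw (S n) X)
  = oc (S n) (ext f ((etgt e, l) : raw (S n) X))
      (@ext n (shift X) (oshift A) (fshift f) e).
Proof. reflexivity. Qed.

Lemma ext_s0_t0 n X (A : ocat) (f : ghom X A) (r : raw n X) : valid r ->
  s0 (ext f r) = gmap f (rst r) /\ t0 (ext f r) = gmap f (ren r).
Proof.
revert X A f r; induction n as [|n IH]; [split; reflexivity|].
intros X A f [x l]; revert x; induction l as [|e l IHl]; intros x.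
- rewrite ext_nil, s0_id0, t0_id0; split; reflexivity.
- rewrite valid_cons; intros [E [v V]]. rewrite ext_cons.
  destruct (IHl _ V) as [Es Et].
  destruct (IH (shift X) (oshift A) (fshift f) e v) as [Fs Ft].
  set (z := @ext n (shift X) (oshift A) (fshift f) e) in *.
  assert (Zs : s0 (z : cell A (S n)) = gmap f x).
  { rewrite s0_shift. etransitivity; [exact (f_equal gs Fs)|].
    rewrite <- E; apply gmap_s. }
  assert (Zt : t0 (z : cell A (S n)) = gmap f (etgt e)).
  { rewrite t0_shift. etransitivity; [exact (f_equal gt Ft)|].
    rewrite <- (proj2 (ren_parallel v)); apply gmap_t. }
  assert (K : osid A (S n) (ext f ((etgt e, l) : raw (S n) X))
              = otid A (S n) (z : cell A (S n)))
    by (apply cmpb_top; rewrite Zt; exact Es).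
  rewrite s0_oc, t0_oc by (lia || exact K). split; assumption.
Qed.

(** The laws of [oc] hold on composable pairs only, so every unfolding of an evaluated path needs
    this fact. Both sides are identities on the image of the vertex [etgt e]. *)
Lemma ext_cons_cmpb n X (A : ocat) (f : ghom X A) x (e : raw n (shift X)) l :
  valid (n := S n) (X := X) (x, e :: l) ->
  osid A (S n) (ext f ((etgt e, l) : raw (S n) X))
  = otid A (S n) (@ext n (shift X) (oshift A) (fshift f) e : cell A (S n)).
Proof.
rewrite valid_cons; intros [E [v V]]. apply cmpb_top.
rewrite (proj1 (ext_s0_t0 f V)), t0_shift; symmetry.
etransitivity; [exact (f_equal gt (proj2 (@ext_s0_t0 _ _ (oshift A) (fshift f) _ v)))|].
etransitivity; [apply gmap_t|].
exact (f_equal (gmap f) (proj2 (ren_parallel v))).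
Qed.

Lemma ext_rs n X (A : ocat) (f : ghom X A) (r : raw (S n) X) : valid r ->
  gs (ext f r) = ext f (rs r).
Proof.
revert X A f r; induction n as [|n IH]; intros X A f r v.
{ exact (proj1 (ext_s0_t0 f v)). }
destruct r as [x l]; revert x v; induction l as [|e l IHl]; intros x v.
{ cbn [rs fst snd map]; rewrite !ext_nil; cbn [id0]; apply oid_s. }
pose proof (ext_cons_cmpb f v) as K.
apply valid_cons in v as [E [v V]].
rewrite ext_cons, oc_s by (lia || exact K).
cbn [rs fst snd map]. rewrite ext_cons; f_equal; [|apply (IH _ (oshift A)), v].
unfold etgt at 2; rewrite rst_rs; apply IHl, V.
Qed.

Lemma ext_rt n X (A : ocat) (f : ghom X A) (r : raw (S n) X) : valid r ->
  gt (ext f r) = ext f (rt r).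
Proof.
revert X A f r; induction n as [|n IH]; intros X A f r v.
{ exact (proj2 (ext_s0_t0 f v)). }
destruct r as [x l]; revert x v; induction l as [|e l IHl]; intros x v.
{ cbn [rt fst snd map]; rewrite !ext_nil; cbn [id0]; apply oid_t. }
pose proof (ext_cons_cmpb f v) as K.
apply valid_cons in v as [E [v V]].
rewrite ext_cons, oc_t by (lia || exact K).
cbn [rt fst snd map]. rewrite ext_cons; f_equal; [|apply (IH _ (oshift A)), v].
rewrite (proj2 (rst_rt v)); apply IHl, V.
Qed.

Lemma ext_rid n X (A : ocat) (f : ghom X A) (r : raw n X) : valid r ->
  ext f (rid r) = oid (ext f r).
Proof.
revert X A f r; induction n as [|n IH]; intros X A f r v; [reflexivity|].
destruct r as [x l]; revert x v; induction l as [|e l IHl]; intros x v; [reflexivity|].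
pose proof (ext_cons_cmpb f v) as K.
apply valid_cons in v as [E [v V]].
rewrite ext_cons, oc_id by (lia || exact K).
cbn [rid fst snd map]. rewrite ext_cons; f_equal; [|apply (IH _ (oshift A)), v].
unfold etgt at 1; rewrite rst_rid; apply IHl, V.
Qed.

Definition extG X (A : ocat) (f : ghom X A) : ghom (TO X) A.
Proof.
refine (@GHom (TO X) A (fun n r => ext f (proj1_sig r)) _ _); intros n [r v].
- apply ext_rs, v.
- apply ext_rt, v.
Defined.

Lemma extG_oid X (A : ocat) (f : ghom X A) n (r : cell (TO X) n) :
  gmap (extG f) (oid r) = oid (gmap (extG f) r).
Proof. destruct r as [r v]; apply ext_rid, v. Qed.

Lemma ext_cmpb X (A : ocat) (f : ghom X A) n d (y x : raw n X) :
  valid y -> valid x -> rsid d y = rtid d x ->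
  osid A d (ext f y) = otid A d (ext f x).
Proof.
intros v v' E.
pose proof (@gmap_sid (TO X) A (extG f) (extG_oid f) n d (exist _ y v)) as Es.
pose proof (@gmap_tid (TO X) A (extG f) (extG_oid f) n d (exist _ x v')) as Et.
cbn [extG gmap proj1_sig] in Es, Et. rewrite <- Es, <- Et.
apply (f_equal (fun r : tcell X n => ext f (proj1_sig r))), tcell_eq.
etransitivity; [exact (proj_sid d (exist _ y v : tcell X n))|].
etransitivity; [exact E|]. symmetry; exact (proj_tid d (exist _ x v' : tcell X n)).
Qed.

Lemma ext_app n X (A : ocat) (f : ghom X A) x lx ly :
  valid (n := S n) (X := X) (x, lx ++ ly) ->
  ext f ((x, lx ++ ly) : raw (S n) X)
  = oc (S n) (ext f ((fin etgt x lx, ly) : raw (S n) X))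
      (ext f ((x, lx) : raw (S n) X)).
Proof.
revert x; induction lx as [|e lx IH]; intros x v; cbn [app fin].
- symmetry; etransitivity; [|apply oc_idr_top].
  rewrite ext_nil; do 2 f_equal; symmetry; exact (proj1 (ext_s0_t0 f v)).
- assert (v1 : valid ((x, e :: lx) : raw (S n) X)).
  { destruct v as [C V]; cbn [fst snd] in *.
    change (e :: lx ++ ly) with ((e :: lx) ++ ly) in C, V.
    rewrite chain_app in C; rewrite Forall_app in V; split; tauto. }
  pose proof (ext_cons_cmpb f v) as K; pose proof (ext_cons_cmpb f v1) as K1.
  apply valid_cons in v as [E [v V]]; apply valid_cons in v1 as [_ [_ V1]].
  assert (V2 : valid ((fin etgt (etgt e) lx, ly) : raw (S n) X)).
  { destruct V as [C V]; cbn [fst snd] in *.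
    rewrite chain_app in C; rewrite Forall_app in V; split; tauto. }
  assert (K2 : osid A (S n) (ext f ((fin etgt (etgt e) lx, ly) : raw (S n) X))
               = otid A (S n) (ext f ((etgt e, lx) : raw (S n) X))).
  { apply cmpb_top.
    etransitivity; [exact (proj1 (ext_s0_t0 f V2))|].
    symmetry; exact (proj2 (ext_s0_t0 f V1)). }
  rewrite !ext_cons, IH by exact V. rewrite IH in K by exact V.
  symmetry; apply oc_assoc; try assumption; [lia|].
  apply cmpb_top; rewrite t0_oc by (lia || exact K1).
  etransitivity; [exact (proj1 (ext_s0_t0 f V2))|].
    symmetry; exact (proj2 (ext_s0_t0 f V1)).
Qed.

(** For the top codimension this is associativity, in the form [ext_app]. Otherwise both paths lose
    their first edge, and the interchange law between codimensions [d] and [S n] exchanges composing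
    edges with composing along the path. *)
Lemma ext_rcomp n d X (A : ocat) (f : ghom X A) (y x : raw n X) : 0 < d <= n ->
  valid y -> valid x -> rsid d y = rtid d x ->
  ext f (rcomp d y x) = oc d (ext f y) (ext f x).
Proof.
revert X A f y x; induction n as [|n IH]; [lia|]; intros X A f [y ly] [x lx] h vy vx E.
pose proof (valid_rcomp h vy vx E) as vc; revert E vc.
destruct (le_lt_dec d n) as [h'|h'].
2: { assert (d = S n) by lia; subst d.
  rewrite rsid_top, rtid_top, rcomp_top by lia; cbn [fst snd].
  intros [-> _]%pair_equal_spec v. apply ext_app, v. }
rewrite rsid_low, rtid_low, rcomp_low by exact h'; cbn [fst snd].
intros [-> E]%pair_equal_spec.
pose proof vy as [_ Vy]; pose proof vx as [_ Vx]; cbn [fst snd] in Vy, Vx.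
revert x vy vx; pattern ly, lx; revert ly lx E Vy Vx; apply zip_ind.
- intros x _ _ _; cbn [zip]; rewrite ext_nil. symmetry; apply oc_id0; lia.
- intros e e' l l' E v v' El _ _ HI x vy vx; cbn [zip]; intros vc.
  assert (Et : etgt e = etgt e').
  { rewrite <- (etgt_rtid d v'), <- E; unfold etgt; rewrite rst_rsid; reflexivity. }
  assert (Ec : etgt (rcomp d e e') = etgt e')
    by (unfold etgt; rewrite rst_rcomp by lia; reflexivity).
  pose proof (ext_cons_cmpb f vy) as Ky; pose proof (ext_cons_cmpb f vx) as Kx.
  pose proof (ext_cons_cmpb f vc) as Kc.
  assert (Q : osid A d (ext f ((x, e :: l) : raw (S n) X))
              = otid A d (ext f ((x, e' :: l') : raw (S n) X))).
  { apply ext_cmpb; [exact vy|exact vx|].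
    rewrite rsid_low, rtid_low by exact h'; cbn [fst snd map]; congruence. }
  rewrite !ext_cons in *.
  apply valid_cons in vy as [_ [_ vy]]; apply valid_cons in vx as [_ [_ vx]].
  apply valid_cons in vc as [_ [_ vc]].
  rewrite Ec, Et in *.
  assert (Q' : osid A d (ext f ((etgt e', l) : raw (S n) X))
               = otid A d (ext f ((etgt e', l') : raw (S n) X))).
  { apply ext_cmpb; [exact vy|exact vx|].
    rewrite rsid_low, rtid_low by exact h'; cbn [fst snd map]; congruence. }
  assert (Qe : osid A d (@ext n (shift X) (oshift A) (fshift f) e : cell A (S n))
               = otid A d (@ext n (shift X) (oshift A) (fshift f) e' : cell A (S n))).
  { rewrite <- osid_shift, <- otid_shift by exact h'.
    apply (@ext_cmpb (shift X) (oshift A)); assumption. }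
  rewrite (HI _ vy vx vc) in *.
  assert (hd : 0 < d <= n) by lia.
  rewrite (IH _ (oshift A) (fshift f) e e' hd v v' E) in *.
  etransitivity; [exact (f_equal (fun z => oc (S n) z _) (HI _ vy vx vc))|].
  assert (h1 : d < S n) by lia.
  exact (@oc_ich A (S n) d (S n) _ _ _ _ (proj1 h) h1 (le_n _) Q' Qe Kc Ky Kx Q).
Qed.

Lemma omap_extG X (A : ocat) (f : ghom X A) : omap (extG f).
Proof.
split; [apply extG_oid|].
intros n d y x h E. pose proof E as E'; apply tcmpb in E'.
etransitivity; [apply (f_equal (ext f)), (proj_tcomp h E')|].
apply ext_rcomp; auto; apply proj2_sig.
Qed.

Lemma ext_rmap n X Y (A : ocat) (g : ghom Y A) (f : ghom X Y) (r : raw n X) :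
  ext g (rmap f r) = ext (ghom_comp g f : ghom X A) r.
Proof.
revert X Y A g f r; induction n as [|n IH]; [reflexivity|]; intros X Y A g f [x l].
revert x; induction l as [|e l IHl]; intros x; [reflexivity|].
cbn [rmap fst snd map]. rewrite !ext_cons, etgt_rmap. f_equal; [apply IHl|].
etransitivity; [exact (IH _ _ (oshift A) (fshift g) (fshift f) e)|].
f_equal; apply ghom_eq; reflexivity.
Qed.

Lemma ext_omap n X (A B : ocat) (h : ghom A B) (f : ghom X A) (r : raw n X) :
  omap h -> valid r -> ext (ghom_comp h f : ghom X B) r = gmap h (ext f r).
Proof.
intros H; revert X A B h f r H; induction n as [|n IH]; [reflexivity|].
intros X A B h f [x l] H; revert x; induction l as [|e l IHl]; intros x v.
- rewrite !ext_nil; cbn [ghom_comp gmap]. generalize (S n); intros m.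
  induction m as [|m IHm]; [reflexivity|].
  cbn [id0]; rewrite (proj1 H), IHm; reflexivity.
- pose proof (ext_cons_cmpb f v) as K.
  apply valid_cons in v as [_ [ve v]].
  rewrite !ext_cons, (proj2 H) by (lia || exact K). rewrite IHl by exact v. f_equal.
  etransitivity; [|exact (IH _ (oshift A) (oshift B) (fshift h) (fshift f)
    e (omap_shift H) ve)].
  f_equal; apply ghom_eq; reflexivity.
Qed.

Fixpoint reta n X : cell X n -> raw n X :=
  match n return cell X n -> raw n X with
  | 0 => fun x => x
  | S n => fun x => (s0 x, [@reta n (shift X) x])
  end.
Arguments reta {n X} x.

Lemma rst_reta n X (x : cell X n) : rst (reta x) = s0 x.
Proof. destruct n; reflexivity. Qed.

Lemma valid_reta n X (x : cell X n) : valid (reta x).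
Proof.
revert X x; induction n as [|n IH]; intros X x; [exact I|].
cbn [reta]; rewrite valid_cons. unfold esrc; rewrite rst_reta.
split; [symmetry; apply s0_shift|]. split; [apply IH|split; constructor].
Qed.

Lemma rs_reta n X (x : cell X (S n)) : rs (reta x) = reta (gs x).
Proof.
revert X x; induction n as [|n IH]; intros X x; [reflexivity|].
change ((s0 (gs x), [rs (reta (X := shift X) x)])
  = (s0 (gs x), [reta (X := shift X) (gs x)])).
do 2 f_equal; exact (IH (shift X) x).
Qed.

Lemma rt_reta n X (x : cell X (S n)) : rt (reta x) = reta (gt x).
Proof.
revert X x; induction n as [|n IH]; intros X x; [reflexivity|].
change ((s0 (gs x), [rt (reta (X := shift X) x)])
  = (s0 (gt x), [reta (X := shift X) (gt x)])).
rewrite s0_gt; do 2 f_equal; exact (IH (shift X) x).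
Qed.

Lemma reta_rmap n X Y (f : ghom X Y) (x : cell X n) :
  reta (gmap f x) = rmap f (reta x).
Proof.
revert X Y f x; induction n as [|n IH]; intros X Y f x; [reflexivity|].
cbn [reta rmap fst snd map]. rewrite gmap_s0; do 2 f_equal.
exact (IH _ _ (fshift f) x).
Qed.

Definition Teta X : ghom X (TG X).
Proof.
refine (@GHom X (TG X) (fun n x => exist _ (reta x) (valid_reta x)) _ _);
  intros n x; apply tcell_eq; [apply rs_reta|apply rt_reta].
Defined.

Lemma gt_s0_shift (X : gset) n (x : cell X (S n)) :
  gt (s0 (X := shift X) x : cell X 1) = t0 x.
Proof.
revert x; induction n as [|n IH]; intros x; [reflexivity|].
etransitivity; [exact (IH (gs x))|apply t0_gs].
Qed.

Lemma ext_reta n X (A : ocat) (f : ghom X A) (x : cell X n) :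
  ext f (reta x) = gmap f x.
Proof.
revert X A f x; induction n as [|n IH]; intros X A f x; [reflexivity|].
cbn [reta]. rewrite ext_cons, ext_nil.
etransitivity; [apply f_equal; exact (IH _ (oshift A) (fshift f) x)|].
cbn [fshift gmap].
assert (E : gmap f (etgt (reta (X := shift X) x)) = t0 (gmap f x)).
{ unfold etgt; rewrite rst_reta, <- gmap_t.
  etransitivity; [|apply gt_s0_shift]. f_equal; symmetry; apply (gmap_s0 (fshift f)). }
rewrite E; apply oc_idl_top.
Qed.

Lemma valid_sing n X (e : raw n (shift X)) :
  valid e -> valid ((esrc e, [e]) : raw (S n) X).
Proof. intros v; apply valid_cons; split; [|split]; auto; split; constructor. Qed.

(** In the inductive step of [ext_Teta] an edge is evaluated in [oshift (TO X)], whereas the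
    induction hypothesis lives in [TO (shift X)]; this omega-functor connects the two. *)
Definition sing X : ghom (TO (shift X)) (oshift (TO X)).
Proof.
refine (@GHom (TO (shift X)) (oshift (TO X))
  (fun n r => exist valid ((esrc (proj1_sig r), [proj1_sig r]) : raw (S n) X)
     (valid_sing (proj2_sig r))) _ _);
intros n r; apply tcell_eq; cbn.
- unfold esrc; rewrite rst_rs; reflexivity.
- f_equal; symmetry; exact (proj1 (rst_rt (proj2_sig r))).
Defined.

Lemma omap_sing X : omap (sing X).
Proof.
split.
- intros n r; apply tcell_eq; cbn. unfold esrc; rewrite rst_rid; reflexivity.
- intros n d y x h E; pose proof E as E'; apply tcmpb in E'.
  assert (K : rsid d (proj1_sig (gmap (sing X) y : tcell X (S n)))
              = rtid d (proj1_sig (gmap (sing X) x : tcell X (S n)))).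
  { rewrite rsid_low, rtid_low by lia. cbn. rewrite E'; f_equal.
    rewrite <- (esrc_rtid d (proj2_sig x)), <- E'.
    unfold esrc; rewrite rst_rsid; reflexivity. }
  apply tcell_eq.
  etransitivity; [|symmetry; exact (proj_tcomp (n := S n) (conj (proj1 h)
    (le_S _ _ (proj2 h))) K)].
  etransitivity; [|symmetry; exact (@rcomp_low n d X _ _ (proj2 h))]. cbn.
  rewrite (proj_tcomp h E'). unfold esrc; rewrite rst_rcomp by lia. reflexivity.
Qed.

(** The cells of [TO X] are generated by those of [X], which yields the triangle identity at a free
    omega-category. The value of an edge is found by transporting the induction hypothesis along
    [sing]. *)
Lemma ext_Teta n X (r : raw n X) (v : valid r) :
  ext (A := TO X) (Teta X) r = exist _ r v.
Proof.
revert X r v; induction n as [|n IH]; intros X r v; [apply tcell_eq; reflexivity|].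
destruct r as [x l]; revert x v; induction l as [|e l IHl]; intros x v.
- rewrite ext_nil. apply tcell_eq.
  enough (H : forall m, proj1_sig (id0 (A := TO X) (S m) (gmap (Teta X) x)
    : tcell X (S m)) = (x, [])) by apply H.
  clear; induction m as [|m IHm]; [reflexivity|].
  cbn [id0] in *. change (rid (proj1_sig (id0 (A := TO X) (S m) (gmap (Teta X) x)
    : tcell X (S m))) = (x, [])).
  cbn [id0]; rewrite IHm; reflexivity.
- pose proof (ext_cons_cmpb (A := TO X) (Teta X) v) as K.
  pose proof v as v'; apply valid_cons in v' as [E [ve vl]].
  rewrite (IHl _ vl) in K.
  assert (F : @ext n (shift X) (oshift (TO X)) (fshift (Teta X)) e
              = gmap (sing X) (exist _ e ve : tcell (shift X) n)).
  { etransitivity; [|apply f_equal; exact (IH _ e ve)].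
    etransitivity; [|exact (@ext_omap n (shift X) (TO (shift X)) (oshift (TO X))
      (sing X) (Teta (shift X)) e (omap_sing X) ve)].
    f_equal. apply ghom_eq; intros m y; apply tcell_eq; cbn.
    unfold esrc; rewrite rst_reta. f_equal; apply s0_shift. }
  pose proof (eq_trans K (f_equal (otid (TO X) (S n)) F)) as K'; apply tcmpb in K'.
  etransitivity; [exact (f_equal2 (@oc (TO X) (S n) (S n)) (IHl _ vl) F)|].
  apply tcell_eq; etransitivity; [apply proj_tcomp; [lia|exact K']|].
  etransitivity; [apply rcomp_top; lia|]. cbn; rewrite E; reflexivity.
Qed.

Definition TF (X : gset) : omega_cat := omega_of (TO X).

Definition free_omega : functor GSET OMEGA_CAT.
Proof.
refine (@Functor GSET OMEGA_CAT TF
  (fun X Y f => @omega_fun_of (TF X) (TF Y) (Tmap f)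
     (omap_comp (omap_to (TO Y)) (omap_comp (omap_Tmap f) (omap_from (TO X)))))
  _ _).
- intros X; apply omega_fun_eq, ghom_eq; intros n r; apply tcell_eq, rmap_id.
- intros X Y Z g f; apply omega_fun_eq, ghom_eq; intros n r; apply tcell_eq.
  symmetry; apply rmap_comp.
Defined.

Definition free_unit : nattrans (functor_id GSET)
  (functor_comp omega_forget free_omega).
Proof.
refine (@Nattrans GSET GSET (functor_id GSET) (functor_comp omega_forget free_omega)
  Teta _).
intros X Y f; apply ghom_eq; intros n x; apply tcell_eq, reta_rmap.
Defined.

Definition omega_eval (A : omega_cat) : ghom (TG (wset A)) (wset A) :=
  extG (A := ocat_of A) (ghom_id (wset A)).

Definition free_counit :
  nattrans (functor_comp free_omega omega_forget) (functor_id OMEGA_CAT).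
Proof.
refine (@Nattrans OMEGA_CAT OMEGA_CAT (functor_comp free_omega omega_forget)
  (functor_id OMEGA_CAT)
  (fun A => @omega_fun_of (TF (wset A)) A (omega_eval A)
     (omap_comp (omap_extG (A := ocat_of A) (ghom_id (wset A)))
        (omap_from (TO (wset A))))) _).
intros A B f; apply omega_fun_eq, ghom_eq; intros n [r v].
change (ext (A := ocat_of B) (ghom_id (wset B)) (rmap (wmap f) r)
  = gmap (wmap f) (ext (A := ocat_of A) (ghom_id (wset A)) r)).
rewrite ext_rmap.
etransitivity; [|exact (@ext_omap n (wset A) (ocat_of A) (ocat_of B) (wmap f)
  (ghom_id (wset A)) r (omap_of f) v)].
f_equal; apply ghom_eq; reflexivity.
Defined.

Definition free_adjoint : left_adjoint omega_forget.
Proof.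
refine (@LeftAdjoint OMEGA_CAT GSET omega_forget free_omega free_unit free_counit _ _).
- intros X; apply omega_fun_eq, ghom_eq; intros n [r v].
  change (ext (A := ocat_of (TF X)) (ghom_id (TG X)) (rmap (Teta X) r) = exist _ r v).
  rewrite ext_rmap, <- (ext_Teta v).
  etransitivity; [|exact (@ext_omap n X (TO X) (ocat_of (TF X)) (ghom_id (TG X))
    (Teta X) r (omap_to (TO X)) v)].
  f_equal; apply ghom_eq; reflexivity.
- intros A; apply ghom_eq; intros n x.
  exact (ext_reta (A := ocat_of A) (ghom_id (wset A)) x).
Defined.

(** * Uniqueness of left adjoints *)

Section AdjointUnique.
Local Open Scope cat_scope.
Variables (D E : category) (U : functor D E).

Definition adjoint_comparison (L L' : left_adjoint U) : nattrans (ladj L) (ladj L').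
Proof.
refine (@Nattrans E D (ladj L) (ladj L') (fun X =>
  nt_app (adj_counit L) (fob (ladj L') X) ∘ fmap (ladj L) (nt_app (adj_unit L') X)) _).
intros X Y f.
etransitivity; [symmetry; apply ccomp_assoc|].
etransitivity; [apply f_equal; symmetry; apply (fmap_comp (ladj L))|].
etransitivity; [apply f_equal, f_equal; exact (nt_nat (adj_unit L') f)|].
etransitivity; [apply f_equal; apply (fmap_comp (ladj L))|].
etransitivity; [apply ccomp_assoc|]. etransitivity; [|symmetry; apply ccomp_assoc].
apply (f_equal (fun h => h ∘ _)).
exact (nt_nat (adj_counit L) (fmap (ladj L') f)).
Defined.

(** Naturality of the counit of [L] and of the unit of [L'] brings the two comparisons together; the
    triangle identities of [L'] and then of [L] cancel them. *)
Lemma adjoint_comparisonK (L L' : left_adjoint U) X :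
  nt_app (adjoint_comparison L' L) X ∘ nt_app (adjoint_comparison L L') X
  = cid (fob (ladj L) X).
Proof.
set (k := nt_app (adjoint_comparison L' L) X).
etransitivity; [apply ccomp_assoc|].
etransitivity;
  [apply (f_equal (fun h => h ∘ _)); symmetry; exact (nt_nat (adj_counit L) k)|].
etransitivity; [symmetry; apply ccomp_assoc|].
etransitivity; [apply f_equal; symmetry; apply (fmap_comp (ladj L))|].
etransitivity; [|exact (adj_triangle_l L X)]. apply f_equal, f_equal.
etransitivity; [apply (f_equal (fun h => h ∘ _)); apply (fmap_comp U)|].
etransitivity; [symmetry; apply ccomp_assoc|].
etransitivity;
  [apply f_equal; symmetry; exact (nt_nat (adj_unit L') (nt_app (adj_unit L) X))|].
etransitivity; [apply ccomp_assoc|].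
etransitivity;
  [apply (f_equal (fun h => h ∘ _)); exact (adj_triangle_r L' (fob (ladj L) X))|].
apply ccomp_idl.
Qed.

End AdjointUnique.

(** * Discrete Conduche functors *)

(** Decompositions lift uniquely. A lifted identity is determined by its source, so it needs no
    separate uniqueness clause. The notion passes to [oshift], as induction on paths requires. *)
Record conduche (E B : ocat) (g : ghom E B) : Prop := {
  cdc_omap : omap g;
  cdc_id : forall n (z : cell E (S n)) (y : cell B n),
    gmap g z = oid y -> z = oid (gs z);
  cdc_ex : forall n d (z : cell E n) (y x : cell B n), 0 < d <= n ->
    osid B d y = otid B d x -> gmap g z = oc d y x ->
    exists y' x', gmap g y' = y /\ gmap g x' = x /\
      osid E d y' = otid E d x' /\ z = oc d y' x';
  cdc_uniq : forall n d (y x y' x' : cell E n), 0 < d <= n ->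
    osid E d y = otid E d x -> osid E d y' = otid E d x' ->
    gmap g y = gmap g y' -> gmap g x = gmap g x' -> oc d y x = oc d y' x' ->
    y = y' /\ x = x' }.

Lemma conduche_shift (E B : ocat) (g : ghom E B) :
  conduche g -> @conduche (oshift E) (oshift B) (fshift g).
Proof.
intros [H1 H2 H3 H4]; split.
- apply omap_shift, H1.
- intros n z y; exact (H2 (S n) z y).
- intros n d z y x h; rewrite osid_shift, otid_shift by lia; intros K K'.
  assert (h' : 0 < d <= S n) by lia.
  destruct (H3 (S n) d z y x h' K K') as [y' [x' H]]; exists y', x'.
  rewrite osid_shift, otid_shift by lia; exact H.
- intros n d y x y' x' h; rewrite !osid_shift, !otid_shift by lia.
  apply H4; lia.
Qed.

Lemma id0_lift (E B : ocat) (g : ghom E B) : conduche g ->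
  forall m (z : cell E m) x, gmap g z = id0 m x -> z = id0 m (s0 z).
Proof.
intros C m; induction m as [|m IH]; intros z x e; [reflexivity|].
pose proof (cdc_id C e) as F; rewrite F; cbn [id0 s0]; rewrite oid_s; f_equal.
apply (IH _ x). rewrite <- gmap_s, e; apply oid_s.
Qed.

Lemma cmpb_top_inv (A : ocat) n (y x : cell A n) :
  osid A n y = otid A n x -> s0 y = t0 x.
Proof.
rewrite sid_top, tid_top; intros E. rewrite <- (s0_id0 n (s0 y)), E; apply s0_id0.
Qed.

(* The multiplication of the free omega-category monad, restricted along a discrete
   Conduche functor, is cartesian. *)
Lemma eval_lift n (E B : ocat) (g : ghom E B) : conduche g ->
  forall (w : raw n B) (z : cell E n), valid w ->
  gmap g z = ext (ghom_id B) w ->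
  exists w' : raw n E, valid w' /\ rmap g w' = w /\ ext (ghom_id E) w' = z.
Proof.
revert E B g; induction n as [|n IH]; intros E B g C.
{ intros w z _ e; exists z; repeat split; exact e. }
intros [x l]; revert x; induction l as [|e l IHl]; intros x z v.
- intros Ez; pose proof (id0_lift C Ez) as F.
  exists (s0 z, []); split; [split; constructor|]; split; [|exact (eq_sym F)].
  apply (f_equal (fun a => (a, []))).
  etransitivity; [symmetry; exact (gmap_s0 g z)|].
  etransitivity; [exact (f_equal (@s0 B (S n)) Ez)|apply (s0_id0 (A := B) (S n))].
- pose proof (ext_cons_cmpb (ghom_id B) v) as K.
  apply valid_cons in v as [Ex [v V]]. rewrite ext_cons; intros Ez.
  assert (h : 0 < S n <= S n) by lia.
  destruct (cdc_ex C h K Ez) as [y' [x' [Ey' [Ex' [K' ->]]]]].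
  destruct (IHl _ _ V Ey') as [[x1 l1] [V1 [M1 F1]]].
  destruct (IH _ _ _ (conduche_shift C) e x' v Ex') as [e' [v' [M' F']]].
  apply cmpb_top_inv in K'.
  (* Composability of the lifted factors says that the lifted tail starts where the lifted edge
     ends. *)
  assert (Q : x1 = etgt e').
  { rewrite <- F1 in K'. pose proof (proj1 (ext_s0_t0 (ghom_id E) V1)) as S1.
    etransitivity; [symmetry; exact S1|]. etransitivity; [exact K'|].
    rewrite t0_shift, <- F'.
    etransitivity; [exact (f_equal gt (proj2 (@ext_s0_t0 _ _ (oshift E) (ghom_id _)
      _ v')))|].
    apply (ren_parallel v'). }
  subst x1. cbn [rmap fst snd] in M1; apply pair_equal_spec in M1 as [_ M1].
  exists (esrc e', e' :: l1); split; [apply valid_cons; auto|].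
  split; [|rewrite ext_cons; exact (f_equal2 (oc (S n)) F1 F')].
  cbn [rmap fst snd map]. rewrite <- esrc_rmap, <- Ex, <- M1; repeat f_equal; exact M'.
Qed.

(** The start vertex is the 0-source of the value. By naturality of evaluation, the values of the
    two first edges have equal images under [g], and so do those of the two tails; [cdc_uniq] then
    splits the equality of the composites. *)
Lemma eval_lift_unique n (E B : ocat) (g : ghom E B) : conduche g ->
  forall w w' : raw n E, valid w -> valid w' -> rmap g w = rmap g w' ->
  ext (ghom_id E) w = ext (ghom_id E) w' -> w = w'.
Proof.
revert E B g; induction n as [|n IH]; intros E B g C.
{ intros w w' _ _ _ e; exact e. }
intros [x l] [x' l'] v v' M F.
assert (Ex : x = x').
{ etransitivity; [symmetry; exact (proj1 (ext_s0_t0 (ghom_id E) v))|].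
  rewrite F; exact (proj1 (ext_s0_t0 (ghom_id E) v')). }
subst x'; f_equal. cbn [rmap fst snd] in M; apply pair_equal_spec in M as [_ M].
revert x l' v v' M F; induction l as [|e l IHl]; intros x [|e' l'] v v' M F;
  try discriminate M; [reflexivity|].
pose proof (ext_cons_cmpb (ghom_id E) v) as K.
pose proof (ext_cons_cmpb (ghom_id E) v') as K'.
apply valid_cons in v as [_ [v V]]; apply valid_cons in v' as [_ [v' V']].
injection M as M1 M2. rewrite !ext_cons in F.
assert (h : 0 < S n <= S n) by lia.
assert (G : forall (y : raw (S n) E), valid y ->
  gmap g (ext (ghom_id E) y) = ext (ghom_id B) (rmap g y)).
{ intros y vy; rewrite ext_rmap, <- (ext_omap _ (cdc_omap C) vy).
  f_equal; apply ghom_eq; reflexivity. }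
assert (G' : forall (y : raw n (shift E)), valid y ->
  gmap g (@ext n (shift E) (oshift E) (ghom_id _) y : cell E (S n))
  = @ext n (shift B) (oshift B) (ghom_id _) (rmap (fshift g) y)).
{ intros y vy; rewrite ext_rmap.
  etransitivity; [symmetry; apply (@ext_omap n _ (oshift E) (oshift B) (fshift g)
    (ghom_id _) y (omap_shift (cdc_omap C)) vy)|].
  f_equal; apply ghom_eq; reflexivity. }
assert (Et : gmap g (etgt e) = gmap g (etgt e')) by (rewrite <- !etgt_rmap, M1;
  reflexivity).
destruct (cdc_uniq C h K K') as [F1 F2]; [| |exact F|].
- rewrite !G by assumption. cbn [rmap fst snd]. rewrite Et, M2; reflexivity.
- etransitivity; [apply G', v|]. rewrite M1; symmetry; apply G', v'.
- assert (Ee : e = e') by (apply (IH _ _ _ (conduche_shift C)); assumption).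
  subst e'; f_equal. apply (IHl _ _ V V' M2 F1).
Qed.

(** An identity is recognised by the nesting of lists alone: its innermost lists are empty. [rmap]
    keeps all lengths, hence reflects identities. *)
Lemma rmap_rid_inv n X Y (f : ghom X Y) (r : raw (S n) X) s :
  rmap f r = rid s -> r = rid (rs r).
Proof.
revert X Y f r s; induction n as [|n IH]; intros X Y f [x l] s.
- cbn; intros [= _ E]. destruct l; [reflexivity|discriminate E].
- destruct s as [y m]. cbn [rmap rid rs fst snd]; intros [_ E]%pair_equal_spec.
  f_equal. rewrite map_map. revert m E.
  induction l as [|e l IHl]; intros [|e' m] E; try discriminate E; [reflexivity|].
  cbn [map] in *; injection E as E1 E2.
  f_equal; [exact (IH _ _ (fshift f) e e' E1)|exact (IHl _ E2)].
Qed.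

Ltac splits := repeat match goal with |- _ /\ _ => split end.

(** [rmap] changes no length, so a cut of the image of [z] is a cut of [z] at the same place; below
    the top codimension the cuts are made edge by edge. *)
Lemma rcomp_rmap_lift n d X Y (f : ghom X Y) (z : raw n X) (y x : raw n Y) :
  0 < d <= n -> valid z -> valid y -> valid x -> rsid d y = rtid d x ->
  rmap f z = rcomp d y x ->
  exists y' x', valid y' /\ valid x' /\ rsid d y' = rtid d x' /\
    rmap f y' = y /\ rmap f x' = x /\ z = rcomp d y' x'.
Proof.
revert X Y f z y x; induction n as [|n IH]; [lia|].
intros X Y f [z lz] [y ly] [x lx] h vz vy vx.
destruct (le_lt_dec d n) as [h'|h'].
- rewrite rsid_low, rtid_low, rcomp_low by exact h'; cbn [rmap fst snd].
  intros [-> E]%pair_equal_spec [<- Ez]%pair_equal_spec.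
  pose proof vy as [_ Vy]; pose proof vx as [_ Vx]; cbn [fst snd] in Vy, Vx.
  enough (H : exists ly' lx', valid ((z, ly') : raw (S n) X) /\
    valid ((z, lx') : raw (S n) X) /\ map (rsid d) ly' = map (rtid d) lx' /\
    map (rmap (fshift f)) ly' = ly /\ map (rmap (fshift f)) lx' = lx /\
    lz = zip (rcomp d) ly' lx').
  { destruct H as [ly' [lx' [H1 [H2 [H3 [H4 [H5 H6]]]]]]].
    exists (z, ly'), (z, lx'). rewrite rsid_low, rtid_low, rcomp_low by exact h'.
    cbn [rmap fst snd]; splits; try assumption; congruence. }
  clear vy vx; revert z lz vz Ez; pattern ly, lx; revert ly lx E Vy Vx; apply zip_ind.
  + intros z [|e lz] _ E; [|discriminate E].
    exists [], []; repeat split; constructor.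
  + intros e e' l l' E v v' _ _ _ HI z [|ez lz]; [discriminate|].
    rewrite valid_cons; intros [<- [v1 V1]]. cbn [zip map]; intros [= E1 E2].
    assert (hd : 0 < d <= n) by lia.
    destruct (IH _ _ (fshift f) ez e e' hd v1 v v' E E1)
      as [ey [ex [H1 [H2 [H3 [H4 [H5 H6]]]]]]].
    destruct (HI _ _ V1 E2) as [ly' [lx' [G1 [G2 [G3 [G4 [G5 G6]]]]]]].
    assert (Sx : rst ez = rst ex) by (rewrite H6; apply rst_rcomp; lia).
    assert (Sy : esrc ey = esrc ez).
    { transitivity (esrc ex); [|unfold esrc; rewrite Sx; reflexivity].
      rewrite <- (esrc_rtid d H2), <- H3; unfold esrc; rewrite rst_rsid; reflexivity. }
    assert (Ty : etgt ey = etgt ez).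
    { transitivity (etgt ex); [|unfold etgt; rewrite Sx; reflexivity].
      rewrite <- (etgt_rtid d H2), <- H3; unfold etgt; rewrite rst_rsid; reflexivity. }
    assert (Sx' : esrc ex = esrc ez) by (unfold esrc; rewrite Sx; reflexivity).
    assert (Tx : etgt ex = etgt ez) by (unfold etgt; rewrite Sx; reflexivity).
    exists (ey :: ly'), (ex :: lx'); rewrite !valid_cons, Ty, Tx; cbn [map zip].
    splits; try assumption; congruence.
- rewrite rsid_top, rtid_top, rcomp_top by exact h'; cbn [rmap fst snd].
  intros [-> _]%pair_equal_spec [<- Ez]%pair_equal_spec.
  apply map_eq_app in Ez as [l1 [l2 [-> [<- <-]]]].
  destruct vz as [C V]; cbn [fst snd] in *.
  apply chain_app in C; apply Forall_app in V.
  (* The later factor starts at the vertex that [l1] reaches. *)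
  exists (fin etgt z l1, l2), (z, l1).
  rewrite rsid_top, rtid_top, rcomp_top by exact h'; cbn [rmap fst snd].
  splits; try reflexivity; try (split; tauto).
  f_equal; symmetry; exact (@fin_map _ _ _ _ etgt etgt (@gmap _ _ f 0)
    (rmap (fshift f)) l1 z (fun e _ => etgt_rmap f e)).
Qed.

Lemma app_inj (E : Type) (a b c d : list E) :
  length a = length b -> a ++ c = b ++ d -> a = b /\ c = d.
Proof.
revert b; induction a as [|x a IH]; intros [|y b] [=] F; [split; auto|].
cbn in F; injection F as -> F. destruct (IH b) as [-> ->]; auto.
Qed.

(** Paths with equal images have equal lengths, and a concatenation splits in one way once the
    length of its first part is known; below the top codimension the argument is repeated on
    edges. *)
Lemma rcomp_rmap_unique n d X Y (f : ghom X Y) (y x y' x' : raw n X) :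
  0 < d <= n -> rsid d y = rtid d x -> rsid d y' = rtid d x' ->
  rmap f y = rmap f y' -> rmap f x = rmap f x' ->
  rcomp d y x = rcomp d y' x' -> y = y' /\ x = x'.
Proof.
revert X Y f y x y' x'; induction n as [|n IH]; [lia|].
intros X Y f [y ly] [x lx] [y' ly'] [x' lx'] h.
destruct (le_lt_dec d n) as [h'|h'].
- rewrite !(fun r => @rsid_low n d X r h'), !(fun r => @rtid_low n d X r h'),
    !(fun r s => @rcomp_low n d X r s h'); cbn [rmap fst snd].
  intros [-> E]%pair_equal_spec [-> E']%pair_equal_spec.
  intros [_ Fy]%pair_equal_spec [_ Fx]%pair_equal_spec [-> F]%pair_equal_spec.
  enough (H : ly = ly' /\ lx = lx') by (destruct H as [-> ->]; split; reflexivity).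
  revert lx ly' lx' E E' Fy Fx F; induction ly as [|ey ly IHl];
  intros [|ex lx] [|ey' ly'] [|ex' lx'] E E' Fy Fx F;
  try discriminate E; try discriminate E'; try discriminate F; try discriminate Fy;
  [split; reflexivity|].
  cbn [map zip] in *. injection E as E1 E2; injection E' as E1' E2'.
  injection Fy as Fy1 Fy2; injection Fx as Fx1 Fx2; injection F as F1 F2.
  assert (hd : 0 < d <= n) by lia.
  destruct (IH _ _ (fshift f) ey ex ey' ex' hd) as [-> ->]; try assumption.
  destruct (IHl lx ly' lx') as [-> ->]; auto.
- rewrite !(fun r => @rsid_top n d X r h'), !(fun r => @rtid_top n d X r h'),
    !(fun r s => @rcomp_top n d X r s h'); cbn [rmap fst snd].
  intros [-> _]%pair_equal_spec [-> _]%pair_equal_spec.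
  intros [_ Fy]%pair_equal_spec [_ Fx]%pair_equal_spec [-> F]%pair_equal_spec.
  apply (f_equal (@length _)) in Fx; rewrite !length_map in Fx.
  apply (app_inj Fx) in F. destruct F as [-> ->]; split; reflexivity.
Qed.

Lemma conduche_Tmap X Y (f : ghom X Y) : @conduche (TO X) (TO Y) (Tmap f).
Proof.
split.
- apply omap_Tmap.
- intros n z y e. apply tcell_eq.
  exact (rmap_rid_inv (f_equal (@proj1_sig _ _) e)).
- intros n d [z vz] [y vy] [x vx] h E F. apply tcmpb in E.
  apply (f_equal (@proj1_sig _ _)) in F.
  pose proof (eq_trans F (proj_tcomp h E)) as F'. cbn [proj1_sig] in *.
  destruct (rcomp_rmap_lift h vz vy vx E F')
    as [y' [x' [v1 [v2 [H1 [H2 [H3 H4]]]]]]].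
  exists (exist _ y' v1), (exist _ x' v2). split; [apply tcell_eq, H2|].
  split; [apply tcell_eq, H3|]. split; [apply tcmpb, H1|].
  apply tcell_eq. etransitivity; [exact H4|].
  symmetry; exact (@proj_tcomp X n d (exist _ y' v1) (exist _ x' v2) h H1).
- intros n d y x y' x' h E E' Fy Fx F. apply tcmpb in E, E'.
  apply (f_equal (@proj1_sig _ _)) in Fy, Fx, F.
  pose proof (eq_trans (eq_sym (proj_tcomp h E)) (eq_trans F (proj_tcomp h E'))) as F'.
  destruct (rcomp_rmap_unique h E E' Fy Fx F').
  split; apply tcell_eq; assumption.
Qed.

(** * Pasting diagrams and familial functors *)

Definition gterminal : gset :=
  @GSet (fun _ => unit) (fun _ _ => tt) (fun _ _ => tt) (fun _ _ => eq_refl)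
    (fun _ _ => eq_refl).
Definition bang (X : gset) : ghom X gterminal :=
  @GHom X gterminal (fun _ _ => tt) (fun _ _ => eq_refl) (fun _ _ => eq_refl).

(* The suspension of [A], glued at its target to the vertex [b] of [B]. *)
Section Join.
Variables (A B : gset) (b : cell B 0).

(** [None] is the source vertex of the suspension. Its target vertex is [Some b] itself, so that the
    gluing needs no quotient. *)
Definition jcell n : Type :=
  match n with 0 => option (cell B 0) | S m => (cell A m + cell B (S m))%type end.

Definition jgs n : jcell (S n) -> jcell n :=
  match n return jcell (S n) -> jcell n with
  | 0 => fun c => match c with inl _ => None | inr d => Some (gs d) end
  | S m => fun c => match c with inl d => inl (gs d) | inr d => inr (gs d) end
  end.

Definition jgt n : jcell (S n) -> jcell n :=
  match n return jcell (S n) -> jcell n with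
  | 0 => fun c => match c with inl _ => Some b | inr d => Some (gt d) end
  | S m => fun c => match c with inl d => inl (gt d) | inr d => inr (gt d) end
  end.

Definition join : gset.
Proof.
refine (@GSet jcell jgs jgt _ _).
- intros [|n] [c|c]; cbn; rewrite ?gs_glob; reflexivity.
- intros [|n] [c|c]; cbn; rewrite ?gt_glob; reflexivity.
Defined.

Definition join1 : ghom A (shift join) :=
  @GHom A (shift join) (fun n c => inl c) (fun _ _ => eq_refl) (fun _ _ => eq_refl).

Definition join2 : ghom B join.
Proof.
refine (@GHom B join (fun n => match n return cell B n -> jcell n with
    0 => fun c => Some c | S m => fun c => inr c end) _ _);
  intros [|n] c; reflexivity.
Defined.

Definition copair Z (x : cell Z 0) (f : ghom A (shift Z)) (g : ghom B Z)
  (Hs : forall c : cell A 0, gs (gmap f c : cell Z 1) = x)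
  (Ht : forall c : cell A 0, gt (gmap f c : cell Z 1) = gmap g b) : ghom join Z.
Proof.
refine (@GHom join Z (fun n => match n return jcell n -> cell Z n with
    | 0 => fun c => match c with None => x | Some d => gmap g d end
    | S m => fun c => match c with inl d => gmap f d | inr d => gmap g d end
    end) _ _);
  intros [|n] [c|c]; cbn; auto; try apply gmap_s; try apply gmap_t.
- apply (gmap_s f).
- apply (gmap_t f).
Defined.

Lemma join_ext Z (f g : ghom join Z) :
  gmap f (None : cell join 0) = gmap g (None : cell join 0) ->
  ghom_comp (fshift f) join1 = ghom_comp (fshift g) join1 ->
  ghom_comp f join2 = ghom_comp g join2 -> f = g.
Proof.
intros E0 E1 E2; apply ghom_eq; intros [|n] [c|]; cbn.
- exact (f_equal (fun h : ghom B Z => gmap h c) E2).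
- exact E0.
- exact (f_equal (fun h : ghom A (shift Z) => gmap h c) E1).
- exact (f_equal (fun h : ghom B Z => gmap h (c : cell B (S n))) E2).
Qed.

End Join.

(* Batanin trees: [Node t u] is the tree [u] with the subtree [t] grafted on the
   root, as its leftmost branch. *)
Inductive tree := Leaf | Node (t u : tree).

Definition gpoint : gset :=
  @GSet (fun n => match n with 0 => unit | S _ => Empty_set end)
    (fun n x => match x with end) (fun n x => match x with end)
    (fun n x => match x with end) (fun n x => match x with end).

Definition gpoint_map Z (x : cell Z 0) : ghom gpoint Z.
Proof.
refine (@GHom gpoint Z (fun n => match n return cell gpoint n -> cell Z n with
  0 => fun _ => x | S _ => fun e => match e with end end) _ _); intros n [].
Defined.

(* The pasting diagram of a tree, with its initial vertex. *)
Fixpoint arity (t : tree) : {A : gset & cell A 0} :=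
  match t with
  | Leaf => existT _ gpoint tt
  | Node t u => existT _ (join (projT1 (arity t)) (projT2 (arity u))) None
  end.
Definition ar t : gset := projT1 (arity t).
Definition root t : cell (ar t) 0 := projT2 (arity t).

(** Vertices go to 1-cells of [Z] and edges to 2-cells, whose ends are parallel; as a pasting
    diagram is connected, all its vertices go to parallel 1-cells. The conditions of [copair]
    thereby reduce to conditions at the root. *)
Lemma ar_connected t Z (f : ghom (ar t) (shift Z)) (c : cell (ar t) 0) :
  gs (gmap f c : cell Z 1) = gs (gmap f (root t) : cell Z 1) /\
  gt (gmap f c : cell Z 1) = gt (gmap f (root t) : cell Z 1).
Proof.
revert Z f c; induction t as [|t _ u IH]; intros Z f c.
{ destruct c; split; reflexivity. }
destruct c as [c|]; [|split; reflexivity].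
destruct (IH _ (ghom_comp f (join2 (projT1 (arity t)) (root u))) c) as [E1 E2].
(* The edge that leads from the root of the whole diagram to the root of [ar u]. *)
set (e := gmap f (inl (root t) : cell (ar (Node t u)) 1) : cell (shift Z) 1).
assert (Es : gs e = gmap f (root (Node t u))) by exact (gmap_s f (inl (root t))).
assert (Et : gt e = gmap f (Some (root u) : cell (ar (Node t u)) 0))
  by exact (gmap_t f (inl (root t))).
cbn in E1, E2 |- *. split.
- etransitivity; [exact E1|]. exact (eq_trans (f_equal gs (eq_sym Et))
    (eq_trans (eq_sym (gs_glob e)) (f_equal gs Es))).
- etransitivity; [exact E2|]. exact (eq_trans (f_equal gt (eq_sym Et))
    (eq_trans (gt_glob e) (f_equal gt Es))).
Qed.

(** The universal path in the pasting diagram: the first edge runs through the suspended copy of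
    [ar t], the others through [ar u]. A tree higher than [n] would be truncated; [gen_ex] and
    [gen_unique] take the shape of some [r : raw n X], whose height is at most [n]. *)
Fixpoint gen (t : tree) (n : nat) : raw n (ar t) :=
  match t return raw n (ar t) with
  | Leaf => match n return raw n gpoint with 0 => tt | S n => (tt, []) end
  | Node t u =>
      match n return raw n (ar (Node t u)) with
      | 0 => None
      | S n => (None, rmap (join1 (ar t) (root u)) (gen t n)
                 :: snd (rmap (join2 (ar t) (root u)) (gen u (S n)) :
                         raw (S n) (ar (Node t u))))
      end
  end.

Lemma rst_gen t n : rst (gen t n) = root t.
Proof. destruct t, n; reflexivity. Qed.

Lemma gen_node t u n :
  gen (Node t u) (S n) = (None, rmap (join1 (ar t) (root u)) (gen t n)
    :: snd (rmap (join2 (ar t) (root u)) (gen u (S n)) : raw (S n) (ar (Node t u)))).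
Proof. reflexivity. Qed.

Lemma gen_tail t u n Z (f : ghom (ar (Node t u)) Z) :
  rmap (ghom_comp f (join2 (ar t) (root u))) (gen u (S n))
  = (gmap f (Some (root u) : cell (ar (Node t u)) 0),
     map (rmap (fshift f)) (snd (rmap (join2 (ar t) (root u)) (gen u (S n)) :
                         raw (S n) (ar (Node t u))))) :> raw (S n) Z.
Proof.
rewrite <- rmap_comp. cbn [rmap fst snd]. f_equal.
pose proof (rst_gen u (S n)) as E; cbn [rst] in E; rewrite E; reflexivity.
Qed.

Lemma valid_gen t n : valid (gen t n).
Proof.
revert n; induction t as [|t IHt u IHu]; intros [|n]; try exact I.
{ split; constructor. }
rewrite gen_node; apply valid_cons; split; [|split].
- unfold esrc; rewrite rst_rmap, rst_gen; reflexivity.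
- apply valid_rmap, IHt.
- pose proof (valid_rmap (join2 (ar t) (root u)) (IHu (S n))) as V.
  replace (etgt _) with (fst (rmap (join2 (ar t) (root u)) (gen u (S n)) :
                         raw (S n) (ar (Node t u)))); [exact V|].
  pose proof (rst_gen u (S n)) as E; cbn [rst] in E.
  unfold etgt; rewrite rst_rmap, rst_gen; cbn [rmap fst]; rewrite E; reflexivity.
Qed.

(** Only the nesting of lists is kept, so the shape depends on nothing but the image of [r] over the
    terminal globular set. *)
Fixpoint shape n X : raw n X -> tree :=
  match n return raw n X -> tree with
  | 0 => fun _ => Leaf
  | S n => fun r => fold_right (fun e u => Node (@shape n (shift X) e) u) Leaf (snd r)
  end.
Arguments shape {n X} r.

Lemma shape_rmap n X Y (f : ghom X Y) (r : raw n X) : shape (rmap f r) = shape r.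
Proof.
revert X Y f r; induction n as [|n IH]; intros X Y f r; [reflexivity|].
destruct r as [x l]; cbn [rmap shape fst snd]. induction l as [|e l IHl];
  [reflexivity|].
cbn [map fold_right]; f_equal; [apply IH|exact IHl].
Qed.

(** Together with [gen_unique]: paths of a given shape are represented by its pasting diagram. The
    maps for the first edge and for the tail are glued by [copair]; they match at the roots because
    a path is a chain, and at the other vertices by connectedness. *)
Lemma gen_ex n X (r : raw n X) : valid r ->
  exists f : ghom (ar (shape r)) X, rmap f (gen (shape r) n) = r.
Proof.
revert X r; induction n as [|n IH]; intros X r v.
{ exists (gpoint_map r); reflexivity. }
destruct r as [x l]; revert x v; induction l as [|e l IHl]; intros x v.
{ exists (gpoint_map x); reflexivity. }
apply valid_cons in v as [Ex [ve v]].
destruct (IH _ e ve) as [f Ef], (IHl _ v) as [g Eg].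
set (t := shape e) in *; set (u := shape ((etgt e, l) : raw (S n) X)) in *.
assert (Rf : gmap f (root t) = rst e) by (rewrite <- Ef, rst_rmap, rst_gen;
  reflexivity).
assert (Rg : gmap g (root u) = etgt e).
{ pose proof (f_equal rst Eg) as E; rewrite rst_rmap, rst_gen in E; exact E. }
assert (Hs : forall c : cell (ar t) 0, gs (gmap f c : cell X 1) = x).
{ intros c; rewrite (proj1 (ar_connected f c)). rewrite Rf; exact Ex. }
assert (Ht : forall c : cell (ar t) 0, gt (gmap f c : cell X 1) = gmap g (root u)).
{ intros c; rewrite (proj2 (ar_connected f c)), Rf, Rg; reflexivity. }
set (h := copair Hs Ht : ghom (ar (Node t u)) X).
exists h. change (shape _) with (Node t u). rewrite gen_node.
cbn [rmap fst snd]. f_equal. cbn [map]; f_equal.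
- rewrite rmap_comp, <- Ef. apply rmap_ext; reflexivity.
- pose proof (gen_tail n h) as E.
  apply (f_equal (@snd _ _)) in E. etransitivity; [symmetry; exact E|].
  transitivity (snd (rmap g (gen u (S n)) : raw (S n) X)); [|rewrite Eg; reflexivity].
  f_equal; apply rmap_ext; intros [|m] c; reflexivity.
Qed.

Lemma gen_unique n X (r : raw n X) Z (f g : ghom (ar (shape r)) Z) :
  rmap f (gen (shape r) n) = rmap g (gen (shape r) n) -> f = g.
Proof.
revert X r Z f g; induction n as [|n IH]; intros X r Z f g.
{ intros E; apply ghom_eq; intros [|m] []; exact E. }
destruct r as [x l]; revert x f g; induction l as [|e l IHl]; intros x f g E.
{ apply pair_equal_spec in E as [E _]; apply ghom_eq; intros [|m] []; exact E. }
set (t := shape e) in *; set (u := shape ((etgt e, l) : raw (S n) X)) in *.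
change (shape ((x, e :: l) : raw (S n) X)) with (Node t u) in *.
rewrite gen_node in E; cbn [rmap fst snd map] in E.
apply pair_equal_spec in E as [E0 E]; injection E as E1 E2.
rewrite !rmap_comp in E1. apply IH in E1.
(* The gluing vertex is the target of the suspended root, so the first edge determines its image. *)
assert (E3 : gmap f (Some (root u) : cell (ar (Node t u)) 0) = gmap g (Some (root u)
  : cell (ar (Node t u)) 0)).
{ etransitivity; [symmetry; exact (gmap_t f (inl (root t) : cell (ar (Node t u)) 1))|].
  etransitivity; [|exact (gmap_t g (inl (root t) : cell (ar (Node t u)) 1))].
  apply (f_equal gt).
  exact (f_equal (fun h : ghom (ar t) (shift Z) => gmap h (root t)) E1). }
apply join_ext; [exact E0|exact E1|]. apply (IHl (etgt e)).
etransitivity; [exact (gen_tail n f)|]. etransitivity; [|symmetry;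
  exact (gen_tail n g)].
apply pair_equal_spec; split; assumption.
Qed.

Definition TFun : functor GSET GSET := functor_comp omega_forget free_omega.

Section Familial.
Variable F : functor GSET GSET.

(* [a] exhibits [A] as representing the fibre of [F] over the image of [a] in
   [F gterminal]. *)
Definition generic (A : gset) n (a : cell (fob F A) n) : Prop :=
  forall W (w : cell (fob F W) n), fm F (bang W) w = fm F (bang A) a ->
  exists! f : ghom A W, fm F f a = w.

Definition familial (P : gset -> Prop) : Prop :=
  forall Z n (z : cell (fob F Z) n),
  exists A (a : cell (fob F A) n), P A /\ generic a /\ fm F (bang A)
    a = fm F (bang Z) z.

(** Existence without genericity. For the composite [F F] this is the form needed, as it serves to
    make evaluations jointly surjective. *)
Definition covered (P : gset -> Prop) : Prop :=
  forall Z n (z : cell (fob F Z) n),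
  exists A (a : cell (fob F A) n) (f : ghom A Z), P A /\ fm F f a = z.

Lemma fm_bang A B (f : ghom A B) n (a : cell (fob F A) n) :
  fm F (bang B) (fm F f a) = fm F (bang A) a.
Proof. rewrite fm_comp; apply fm_ext; reflexivity. Qed.

Lemma generic_inj A n (a : cell (fob F A) n) W (f g : ghom A W) :
  generic a -> fm F f a = fm F g a -> f = g.
Proof.
intros G E. destruct (G W (fm F f a) (fm_bang f a)) as [h [_ U]].
transitivity h; [symmetry|]; apply U; auto.
Qed.

Lemma familial_covered P : familial P -> covered P.
Proof.
intros H Z n z; destruct (H Z n z) as [A [a [p [G E]]]].
destruct (G Z z (eq_sym E)) as [f [Ef _]]; exists A, a, f; auto.
Qed.

Lemma is_pullback_of_cells (A B Z P : gset) (f : ghom A Z) (g : ghom B Z)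
  (p : ghom P A) (q : ghom P B) :
  (forall n (x : cell P n), gmap f (gmap p x) = gmap g (gmap q x)) ->
  (forall n (a : cell A n) (b : cell B n), gmap f a = gmap g b ->
    exists! z : cell P n, gmap p z = a /\ gmap q z = b) ->
  @is_pullback GSET A B Z P f g p q.
Proof.
intros E U; split; [apply ghom_eq; exact E|]. intros W a b e.
assert (e' : forall n (x : cell W n), gmap f (gmap a x) = gmap g (gmap b x))
  by (intros n x; exact (f_equal (fun h : ghom W Z => gmap h x) e)).
set (u := fun n (x : cell W n) =>
  constructive_indefinite_description _ (U n _ _ (e' n x))).
assert (H : forall n (x : cell W n), gmap p (proj1_sig (u n x)) = gmap a x /\
  gmap q (proj1_sig (u n x)) = gmap b x)
  by (intros n x; exact (proj1 (proj2_sig (u n x)))).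
assert (K : forall n (x : cell W n) z, gmap p z = gmap a x -> gmap q z = gmap b x ->
  proj1_sig (u n x) = z)
  by (intros n x z H1 H2; exact (proj2 (proj2_sig (u n x)) z (conj H1 H2))).
unshelve eexists.
- refine (@GHom W P (fun n x => proj1_sig (u n x)) _ _).
  + intros n x; symmetry; apply K; rewrite <- !gmap_s; f_equal; apply H.
  + intros n x; symmetry; apply K; rewrite <- !gmap_t; f_equal; apply H.
- split; [split; apply ghom_eq; intros; apply H|].
  intros v [v1 v2]; apply ghom_eq; intros n x; apply K.
  + exact (f_equal (fun h : ghom W A => gmap h x) v1).
  + exact (f_equal (fun h : ghom W B => gmap h x) v2).
Qed.

(** Over each point of [F gterminal] the functor is representable, and representables preserve
    pullbacks. Two elements that agree in [F Z] lie over the same point, so they are maps out of the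
    same object. *)
Lemma familial_pullbacks P : familial P -> preserves_pullbacks F.
Proof.
intros H A B Z Q f g p q S.
pose proof S as [Sc Su].
apply is_pullback_of_cells.
- intros n x; fold (fm F p x) (fm F q x).
  change (fm F f (fm F p x) = fm F g (fm F q x)).
  rewrite !fm_comp. apply fm_ext; intros m y.
  exact (f_equal (fun h : ghom Q Z => gmap h y) Sc).
- intros n x y e. change (fm F f x = fm F g y) in e.
  destruct (H A n x) as [D [d [_ [G E]]]].
  destruct (G A x (eq_sym E)) as [h [Eh _]].
  assert (Ey : fm F (bang B) y = fm F (bang D) d).
  { rewrite <- (fm_bang g y), <- e, fm_bang; auto. }
  destruct (G B y Ey) as [k [Ek _]].
  assert (C : ghom_comp f h = ghom_comp g k).
  { apply (generic_inj G). rewrite <- !fm_comp, Eh, Ek; exact e. }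
  destruct (Su D h k C) as [u [[u1 u2] Uu]].
  exists (fm F u d); split.
  + split.
    * change (fm F p (fm F u d) = x). rewrite fm_comp, <- Eh; f_equal; exact u1.
    * change (fm F q (fm F u d) = y). rewrite fm_comp, <- Ek; f_equal; exact u2.
  + intros z [z1 z2]. change (fm F p z = x) in z1; change (fm F q z = y) in z2.
    destruct (G Q z) as [v [Ev _]].
    { rewrite <- (fm_bang p z), z1; auto. }
    rewrite <- Ev; f_equal; apply Uu; split; apply (generic_inj G).
    * rewrite <- fm_comp, Ev, z1; auto.
    * rewrite <- fm_comp, Ev, z2; auto.
Qed.

End Familial.

Lemma cartesian_lift (F G : functor GSET GSET) (phi : nattrans F G) :
  cartesian_nattrans phi -> forall A Z (f : ghom A Z) n
  (z : cell (fob F Z) n) (b : cell (fob G A) n),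
  gmap (nt_app phi Z) z = fm G f b ->
  exists! a : cell (fob F A) n, fm F f a = z /\ gmap (nt_app phi A) a = b.
Proof. intros C A Z f n; exact (is_pullback_cell (C A Z f) (n := n)). Qed.

(** By the pullback squares over terminal maps, each fibre of [F] is carried bijectively onto a
    fibre of [G], so the same object represents it. Its generic element is the lift of that of [G]
    along the classifying map [f]. *)
Lemma familial_cartesian (F G : functor GSET GSET) (phi : nattrans F G) P :
  cartesian_nattrans phi -> familial G P -> familial F P.
Proof.
intros C H Z n z.
destruct (H Z n (gmap (nt_app phi Z) z)) as [A [b [p [Gb Eb]]]].
destruct (Gb _ _ (eq_sym Eb)) as [f [Ef _]].
destruct (cartesian_lift C (eq_sym Ef)) as [a [[Ea Ea'] _]].
exists A, a; split; [exact p|]; split; [|rewrite <- Ea, fm_bang; reflexivity].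
intros W w Ew.
assert (Ew' : fm G (bang W) (gmap (nt_app phi W) w) = fm G (bang A) b).
{ rewrite <- Ea', <- !nt_app_fm, Ew; reflexivity. }
destruct (Gb _ _ Ew') as [g [Eg Ug]]. exists g; split.
- destruct (@cartesian_lift _ _ _ C W gterminal (bang W) n (fm F (bang W) w)
    (gmap (nt_app phi W) w)) as [v [_ Uv]]; [apply nt_app_fm|].
  transitivity v; [symmetry|]; apply Uv; split; auto.
  + rewrite fm_bang; auto.
  + rewrite nt_app_fm, Ea'; exact Eg.
- intros g' Eg'. apply Ug. rewrite <- Ea', <- nt_app_fm, Eg'; reflexivity.
Qed.

(** Two successive lifts: the square of [phi] at [fmap G f] gives [c] in [F G A]; the square of
    [phi] at [f], kept a pullback by [F], then lifts [c] to [F F A]. *)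
Lemma covered_cartesian (F G : functor GSET GSET) (phi : nattrans F G) P :
  cartesian_nattrans phi -> preserves_pullbacks F ->
  covered (functor_comp G G) P -> covered (functor_comp F F) P.
Proof.
intros C hF H Z n z.
set (z' := fm F (nt_app phi Z) z).
destruct (H Z n (gmap (nt_app phi (fob G Z)) z')) as [A [b [f [p Eb]]]].
destruct (@cartesian_lift _ _ _ C _ _ (fmap G (f : hom GSET A Z)) n z' b (eq_sym Eb))
  as [c [[Ec _] _]].
destruct (is_pullback_cell (hF _ _ _ _ _ _ _ _ (C A Z f)) (n := n) (a := z) (b := c))
  as [a [[Ea _] _]]; [symmetry; exact Ec|].
exists A, a, f; split; [exact p|exact Ea].
Qed.

Lemma cartesian_iso (F G : functor GSET GSET) (phi : nattrans F G)
  (psi : nattrans G F) :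
  (forall X n (x : cell (fob F X) n), gmap (nt_app psi X) (gmap (nt_app phi X) x)
    = x) ->
  (forall X n (x : cell (fob G X) n), gmap (nt_app phi X) (gmap (nt_app psi X) x)
    = x) ->
  cartesian_nattrans phi.
Proof.
intros K1 K2 X Y f; apply is_pullback_of_cells.
- intros n x; exact (nt_app_fm phi f x).
- intros n a b e; change (gmap (nt_app phi Y) a = fm G f b) in e.
  exists (gmap (nt_app psi X) b); split; [split; [|apply K2]|].
  + change (fm F f (gmap (nt_app psi X) b) = a).
    rewrite <- nt_app_fm, <- e; apply K1.
  + intros z [_ Ez]. rewrite <- Ez; apply K1.
Qed.

Definition is_tree (A : gset) : Prop := exists t, A = ar t.

(** Elements with the same image over the terminal globular set have the same shape, hence are
    represented by the same pasting diagram. *)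
Lemma familial_T : familial TFun is_tree.
Proof.
intros Z n [r v]. destruct (gen_ex v) as [f Ef].
exists (ar (shape r)), (exist _ (gen (shape r) n) (valid_gen (shape r) n)).
split; [exists (shape r); reflexivity|]. split.
- intros W [w vw] E. apply (f_equal (fun x : tcell gterminal n => shape (proj1_sig
    x))) in E.
  cbn in E. rewrite !shape_rmap in E.
  assert (Er : shape r = shape w) by
    (rewrite E; transitivity (shape (rmap f (gen (shape r) n)));
     [rewrite Ef; reflexivity|apply shape_rmap]).
  pose proof (gen_ex vw) as K; rewrite <- Er in K; destruct K as [g Eg].
  exists g; split; [apply tcell_eq; exact Eg|].
  intros g' Eg'. apply (f_equal (@proj1_sig _ _)) in Eg'.
  apply gen_unique. etransitivity; [exact Eg|symmetry; exact Eg'].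
- apply tcell_eq. etransitivity; [|exact (f_equal (rmap (bang Z)) Ef)].
  rewrite rmap_comp; apply rmap_ext; reflexivity.
Qed.

(** Let [y] be the value of [z] under the multiplication, presented as the image under [f] of a
    generic [a] over a pasting diagram [A], and let [q] be the image of [z] over the terminal
    globular set. Since [q] and [a] agree after multiplication, [eval_lift] along [bang A] gives [b]
    in [T T A] over both. Its image under [f] and [z] have the same [q] and the same value [y], so
    [eval_lift_unique] identifies them. *)
Lemma covered_TT : covered (functor_comp TFun TFun) is_tree.
Proof.
intros Z n [z v].
set (y := ext (A := TO Z) (ghom_id (TG Z)) z : tcell Z n).
destruct (familial_covered familial_T (y : cell (fob TFun Z) n))
  as [A [a [f [p Ea]]]].
assert (N : forall X Y (g : ghom X Y) (w : raw n (TG X)), valid w ->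
  ext (A := TO Y) (ghom_id (TG Y)) (rmap (Tmap g) w)
  = gmap (Tmap g) (ext (A := TO X) (ghom_id (TG X)) w)).
{ intros X Y g w vw. rewrite ext_rmap.
  rewrite <- (@ext_omap n (TG X) (TO X) (TO Y) (Tmap g) (ghom_id (TG X)) w
    (omap_Tmap g) vw).
  f_equal; apply ghom_eq; reflexivity. }
set (q := rmap (Tmap (bang Z)) z).
assert (vq : valid q) by apply valid_rmap, v.
destruct (eval_lift (conduche_Tmap (bang A)) (w := q) (z := a) vq) as [b [vb [Mb Eb]]].
{ etransitivity; [|symmetry; exact (N _ _ (bang Z) z v)].
  change (gmap (Tmap (bang A)) a = gmap (Tmap (bang Z)) y).
  etransitivity; [|exact (f_equal (gmap (Tmap (bang Z))) Ea)].
  symmetry; exact (@fm_bang TFun _ _ f n a). }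
exists A, (exist _ b vb), f. split; [exact p|]. apply tcell_eq.
apply (eval_lift_unique (conduche_Tmap (bang Z))).
- apply (proj2_sig (fm (functor_comp TFun TFun)
    f (exist _ b vb : cell (fob (functor_comp TFun TFun) A) n))).
- exact v.
- change (rmap (Tmap (bang Z)) (rmap (Tmap f) b) = q).
  rewrite rmap_comp, <- Mb. apply rmap_ext; intros m x; apply tcell_eq.
  etransitivity; [apply rmap_comp|]; apply rmap_ext; reflexivity.
- change (ext (A := TO Z) (ghom_id (TG Z)) (rmap (Tmap f) b) = y).
  etransitivity; [exact (N _ _ f b vb)|].
  etransitivity; [exact (f_equal (gmap (Tmap f)) Eb)|exact Ea].
Qed.

(** * Categories of maps into a globular category *)

Definition bij (A B : cat) (F : fctor A B) : Prop :=
  (forall y, exists! x, fo F x = y) /\ (forall g, exists! f, fa F f = g).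

Lemma uniq_inj (S T : Type) (F : S -> T) : (forall y, exists! x, F x = y) ->
  forall x y, F x = F y -> x = y.
Proof.
intros H x y E. destruct (H (F y)) as [z [_ U]].
transitivity z; [symmetry|]; apply U; auto.
Qed.

Lemma bij_inv (A B : cat) (F : fctor A B) : bij F ->
  exists G, fctor_comp F G = fctor_id B /\ fctor_comp G F = fctor_id A.
Proof.
intros [H0 H1].
set (g0 := fun y => constructive_indefinite_description _ (H0 y)).
set (g1 := fun y => constructive_indefinite_description _ (H1 y)).
assert (K0 : forall y, fo F (proj1_sig (g0 y)) = y)
  by (intros y; exact (proj1 (proj2_sig (g0 y)))).
assert (K1 : forall y, fa F (proj1_sig (g1 y)) = y)
  by (intros y; exact (proj1 (proj2_sig (g1 y)))).
pose proof (uniq_inj H0) as I0; pose proof (uniq_inj H1) as I1.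
unshelve eexists.
- refine (@Fctor B A (fun y => proj1_sig (g0 y)) (fun y => proj1_sig (g1 y)) _ _ _ _).
  + intros f; apply I0; rewrite K0, <- fa_dom, K1; reflexivity.
  + intros f; apply I0; rewrite K0, <- fa_cod, K1; reflexivity.
  + intros y; apply I1; rewrite K1, fa_idn, K0; reflexivity.
  + intros g f e e'; apply I1; rewrite K1.
    assert (e'' : dom (fa F (proj1_sig (g1 g))) = cod (fa F (proj1_sig (g1 f))))
      by (rewrite !K1; exact e).
    rewrite (fa_cmp e' e''); apply cmp_eq; symmetry; apply K1.
- split; apply feq_eq; split; cbn; auto.
Qed.

Lemma inv_bij (A B : cat) (F : fctor A B) (G : fctor B A) :
  fctor_comp F G = fctor_id B -> fctor_comp G F = fctor_id A -> bij F.
Proof.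
intros E1 E2; apply eq_feq in E1 as [E10 E11], E2 as [E20 E21]; cbn in *.
split; intros y.
- exists (fo G y); split; [apply E10|]. intros x <-; apply E20.
- exists (fa G y); split; [apply E11|]. intros x <-; apply E21.
Qed.

Lemma bij_epi (A B D : cat) (F : fctor A B) (G H : fctor B D) : bij F ->
  fctor_comp G F = fctor_comp H F -> G = H.
Proof.
intros b E; destruct (bij_inv b) as [K [E1 _]].
rewrite <- (fctor_comp_idr G), <- (fctor_comp_idr H), <- E1.
rewrite !fctor_comp_assoc, E; reflexivity.
Qed.

Lemma bij_cancel (A B D : cat) (G : fctor B D) (F : fctor A B) :
  bij G -> bij (fctor_comp G F) -> bij F.
Proof.
intros [G0 G1] [H0 H1]; pose proof (uniq_inj G0) as I0; pose proof (uniq_inj G1) as I1.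
split; intros y.
- destruct (H0 (fo G y)) as [x [E U]]; exists x; split; [apply I0, E|].
  intros x' <-; apply U; reflexivity.
- destruct (H1 (fa G y)) as [x [E U]]; exists x; split; [apply I1, E|].
  intros x' <-; apply U; reflexivity.
Qed.

Section TwoFunctor.
Variable C : functor2 CAT CAT.

(** The action of [C] is restated at the types [cat], [fctor] and [nt], so that equations of
    functors rewrite without unfolding [CAT]. *)
Definition cob (A : cat) : cat := f2ob C A.
Definition cf (A B : cat) (F : fctor A B) : fctor (cob A) (cob B) :=
  @f2_1 CAT CAT C A B F.
Definition cn (A B : cat) (a : nt A B) : nt (cob A) (cob B) :=
  @f2_2 CAT CAT C A B a.

Lemma cf_id A : cf (fctor_id A) = fctor_id (cob A).
Proof. exact (f2_id C A). Qed.

Lemma cf_comp A B D (G : fctor B D) (F : fctor A B) :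
  cf (fctor_comp G F) = fctor_comp (cf G) (cf F).
Proof. exact (@f2_c1 CAT CAT C A B D G F). Qed.

Lemma cn_src A B (a : nt A B) : nsrc (cn a) = cf (nsrc a).
Proof. exact (fa_dom (f2hom C A B) a). Qed.

Lemma cn_tgt A B (a : nt A B) : ntgt (cn a) = cf (ntgt a).
Proof. exact (fa_cod (f2hom C A B) a). Qed.

Lemma cn_id A B (F : fctor A B) : cn (nt_id F) = nt_id (cf F).
Proof. exact (fa_idn (f2hom C A B) F). Qed.

Lemma cn_hcomp A B D (b : nt B D) (a : nt A B) : cn (hcomp b a) = hcomp (cn b) (cn a).
Proof. exact (@f2_c2 CAT CAT C A B D b a). Qed.

Lemma bij_cf A B (F : fctor A B) : bij F -> bij (cf F).
Proof.
intros b; destruct (bij_inv b) as [G [E1 E2]].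
apply (@inv_bij _ _ (cf F) (cf G)); rewrite <- cf_comp, ?E1, ?E2; apply cf_id.
Qed.

Lemma cf_triangle A B D (G : fctor B D) (F : fctor A B) (H : fctor A D) :
  feq (fctor_comp G F) H -> feq (fctor_comp (cf G) (cf F)) (cf H).
Proof. intros E%feq_eq; rewrite <- cf_comp, E; apply eq_feq; reflexivity. Qed.

Lemma cf_square A B B' D (G : fctor B D) (F : fctor A B) (G' : fctor B' D)
  (F' : fctor A B') : feq (fctor_comp G F) (fctor_comp G' F') ->
  feq (fctor_comp (cf G) (cf F)) (fctor_comp (cf G') (cf F')).
Proof. intros E%feq_eq; rewrite <- !cf_comp, E; apply eq_feq; reflexivity. Qed.

Lemma napp_whiskl A B D (G : fctor B D) (a : nt A B) x :
  napp (hcomp (nt_id G) a) x = fa G (napp a x).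
Proof. cbn; apply cmp_idl'. Qed.

Lemma napp_whiskr A B D (a : nt B D) (F : fctor A B) x :
  napp (hcomp a (nt_id F)) x = napp a (fo F x).
Proof.
cbn. assert (h : dom (napp a (fo F x)) = cod (idn (fo (nsrc a) (fo F x)))) by bdry.
etransitivity; [|exact (cmp_idr' h)]. apply cmp_eq; [reflexivity|apply fa_idn].
Qed.

Lemma napp_cn_whiskl A B D (G : fctor B D) (a : nt A B) x :
  fa (cf G) (napp (cn a) x) = napp (cn (hcomp (nt_id G) a)) x.
Proof. rewrite cn_hcomp, cn_id, napp_whiskl; reflexivity. Qed.

Lemma napp_cn_whiskr A B D (a : nt B D) (F : fctor A B) x :
  napp (cn a) (fo (cf F) x) = napp (cn (hcomp a (nt_id F))) x.
Proof. rewrite cn_hcomp, cn_id, napp_whiskr; reflexivity. Qed.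

End TwoFunctor.

Definition pw_pair (A : gset) (X : gcat) (g f : ghom A (Ar X))
  (e : ghom_comp (Dom X) g = ghom_comp (Cod X) f) n (x : cell A n) :
  gmap (Dom X) (gmap g x) = gmap (Cod X) (gmap f x) :=
  f_equal (fun h : ghom A (Ob X) => gmap h x) e.

(* The category  [A, X]  of the header. *)
Definition pw (A : gset) (X : gcat) : cat.
Proof.
refine (@Cat (ghom A (Ob X)) (ghom A (Ar X)) (ghom_comp (Dom X)) (ghom_comp (Cod X))
  (ghom_comp (Idn X)) (fun g f e => ghom_comp (Cmp X) (gpb_pair (pw_pair e)))
  _ _ _ _ _ _ _).
- intros x; apply ghom_eq; intros; apply dom_idn.
- intros x; apply ghom_eq; intros; apply cod_idn.
- intros g f e; apply ghom_eq; intros; apply dom_cmp.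
- intros g f e; apply ghom_eq; intros; apply cod_cmp.
- intros f e; apply ghom_eq; intros; apply cmp_idl.
- intros f e; apply ghom_eq; intros; apply cmp_idr.
- intros h g f e1 e2 e3 e4; apply ghom_eq; intros; apply cmp_assoc.
Defined.

Definition evx (A : gset) (X : gcat) n (x : cell A n) : fctor (pw A X) (lev X n).
Proof.
refine (@Fctor (pw A X) (lev X n) (fun f => gmap f x) (fun f => gmap f x) _ _ _ _);
  try reflexivity.
intros g f e e'; apply cmp_eq; reflexivity.
Defined.
Arguments evx {A} X {n} x.

Definition pw1 (A : gset) (X Y : gcat) (f : gfun X Y) : fctor (pw A X) (pw A Y).
Proof.
refine (@Fctor (pw A X) (pw A Y) (ghom_comp (Ob1 f)) (ghom_comp (Ar1 f)) _ _ _ _).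
- intros g; apply ghom_eq; intros; apply fa_dom.
- intros g; apply ghom_eq; intros; apply fa_cod.
- intros g; apply ghom_eq; intros; apply fa_idn.
- intros g h e e'; apply ghom_eq; intros; apply fa_cmp.
Defined.
Arguments pw1 A {X Y} f.

Definition pw0 (A B : gset) (g : ghom A B) (X : gcat) : fctor (pw B X) (pw A X).
Proof.
refine (@Fctor (pw B X) (pw A X) (fun f => ghom_comp f g) (fun f => ghom_comp f g)
  _ _ _ _); intros; apply ghom_eq; intros; try reflexivity.
apply cmp_eq; reflexivity.
Defined.

Definition pw2 (A : gset) (X Y : gcat) (a : gmod X Y) : nt (pw A X) (pw A Y).
Proof.
refine (@Nt (pw A X) (pw A Y) (pw1 A (msrc a)) (pw1 A (mtgt a))
  (fun f => ghom_comp (Mod a) f) _ _ _).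
- intros x; apply ghom_eq; intros; cbn. rewrite <- mapp_src; apply napp_dom.
- intros x; apply ghom_eq; intros; cbn. rewrite <- mapp_tgt; apply napp_cod.
- intros f e e'; apply ghom_eq; intros n x; cbn.
  set (y := gmap f x).
  assert (h : dom (napp (mapp a n) (cod y)) = cod (fa (nsrc (mapp a n)) y)) by bdry.
  assert (k : dom (fa (ntgt (mapp a n)) y) = cod (napp (mapp a n) (dom y))) by bdry.
  etransitivity; [|etransitivity; [exact (napp_nat h k)|]]; apply cmp_eq;
    try reflexivity; [rewrite mapp_src|rewrite mapp_tgt]; reflexivity.
Defined.
Arguments pw2 A {X Y} a.

Section Evaluation.
Variables (F : functor GSET GSET) (hF : preserves_pullbacks F).

Definition evF (A : gset) (X : gcat) n (a : cell (fob F A) n) :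
  fctor (pw A X) (icat hF X n).
Proof.
refine (@Fctor (pw A X) (icat hF X n) (fun f => fm F f a) (fun f => fm F f a) _ _ _ _).
- intros f; apply fm_comp.
- intros f; apply fm_comp.
- intros x; symmetry; apply fm_comp.
- intros g f e e'; symmetry; apply (icmp_fm hF (pw_pair e) (x := a)); reflexivity.
Defined.

(** For two layers of [F]: following this functor by the evaluation at a cell of [F F A] leads from
    [[A, X]] to [F F X]. *)
Definition pwF (A : gset) (X : gcat) : fctor (pw A X) (pw (fob F A) (int_obj hF X)).
Proof.
refine (@Fctor (pw A X) (pw (fob F A) (int_obj hF X))
  (fun f => fmap F (f : hom GSET A (Ob X))) (fun f => fmap F (f : hom GSET A (Ar X)))
  _ _ _ _).
- intros f; apply ghom_eq; intros n x; exact (@fm_comp F _ _ _ (Dom X) f n x).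
- intros f; apply ghom_eq; intros n x; exact (@fm_comp F _ _ _ (Cod X) f n x).
- intros f; apply ghom_eq; intros n x; symmetry; exact (@fm_comp F _ _ _ (Idn X) f n x).
- intros g f e e'; apply ghom_eq; intros n x.
  exact (@fa_cmp _ _ (evF X x) g f e (@pw_pair (fob F A) (int_obj hF X) _ _ e' n x)).
Defined.

End Evaluation.
Arguments evF {F} hF {A} X {n} a.

Section Kappa.
Variable C : functor2 CAT CAT.

(* The comparison  kappa : C [A, X] -> [A, C X]. *)
Definition kap (A : gset) (X : gcat) : fctor (cob C (pw A X)) (pw A (glob_obj C X)).
Proof.
unshelve refine (@Fctor (cob C (pw A X)) (pw A (glob_obj C X))
  (fun c => @GHom A (Ob (glob_obj C X)) (fun n x => fo (cf C (evx X x)) c) _ _)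
  (fun c => @GHom A (Ar (glob_obj C X)) (fun n x => fa (cf C (evx X x)) c) _ _)
  _ _ _ _).
- intros n x; refine (feq_fo (cf_triangle C (G := lev_s X n) (F := evx X x)
    (H := evx X _) _) c); split; intros f; exact (gmap_s f x).
- intros n x; refine (feq_fo (cf_triangle C (G := lev_t X n) (F := evx X x)
    (H := evx X _) _) c); split; intros f; exact (gmap_t f x).
- intros n x; refine (feq_fa (cf_triangle C (G := lev_s X n) (F := evx X x)
    (H := evx X _) _) c); split; intros f; exact (gmap_s f x).
- intros n x; refine (feq_fa (cf_triangle C (G := lev_t X n) (F := evx X x)
    (H := evx X _) _) c); split; intros f; exact (gmap_t f x).
- intros f; apply ghom_eq; intros n x; apply fa_dom.
- intros f; apply ghom_eq; intros n x; apply fa_cod.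
- intros f; apply ghom_eq; intros n x; apply fa_idn.
- intros g f e e'; apply ghom_eq; intros n x; apply fa_cmp.
Defined.

Lemma evx_kap A X n (x : cell A n) :
  fctor_comp (evx (glob_obj C X) x) (kap A X) = cf C (evx X x).
Proof. apply feq_eq; split; reflexivity. Qed.

Lemma pw_ext (A : gset) (X : gcat) (D : cat) (G H : fctor D (pw A X)) :
  (forall n (x : cell A n), fctor_comp (evx X x) G = fctor_comp (evx X x) H) -> G = H.
Proof.
intros E; apply feq_eq; split; intros d; apply ghom_eq; intros n x.
- exact (feq_fo (eq_feq (E n x)) d).
- exact (feq_fa (eq_feq (E n x)) d).
Qed.

Lemma kap_pw0 (A B : gset) (g : ghom A B) X :
  fctor_comp (kap A X) (cf C (pw0 g X))
  = fctor_comp (pw0 g (glob_obj C X)) (kap B X).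
Proof.
apply feq_eq; split; intros c; apply ghom_eq; intros n x.
- refine (feq_fo (cf_triangle C (G := evx X x) (F := pw0 g X)
    (H := evx X (gmap g x)) _) c); split; reflexivity.
- refine (feq_fa (cf_triangle C (G := evx X x) (F := pw0 g X)
    (H := evx X (gmap g x)) _) c); split; reflexivity.
Qed.

Lemma kap_pw1 A (X Y : gcat) (f : gfun X Y) :
  fctor_comp (kap A Y) (cf C (pw1 A f))
  = fctor_comp (pw1 A (glob_1 C f)) (kap A X).
Proof.
apply feq_eq; split; intros c; apply ghom_eq; intros n x.
- refine (feq_fo (cf_square C (G := evx Y x) (F := pw1 A f)
    (G' := gf f n) (F' := evx X x) _) c); split; reflexivity.
- refine (feq_fa (cf_square C (G := evx Y x) (F := pw1 A f)
    (G' := gf f n) (F' := evx X x) _) c); split; reflexivity.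
Qed.

Lemma kap_pw2 A (X Y : gcat) (a : gmod X Y) c :
  fa (kap A Y) (napp (cn C (pw2 A a)) c)
  = ghom_comp (Mod (glob_2 C a)) (fo (kap A X) c).
Proof.
apply ghom_eq; intros n x. cbn.
etransitivity; [exact (@napp_cn_whiskl C _ _ _ (evx Y x) (pw2 A a) c)|].
symmetry; etransitivity; [exact (@napp_cn_whiskr C _ _ _ (mapp a n) (evx X x) c)|].
apply (f_equal (fun b => napp (cn C b) c)); symmetry; apply napp_whisker.
- rewrite mapp_src; apply feq_eq; split; reflexivity.
- rewrite mapp_tgt; apply feq_eq; split; reflexivity.
- reflexivity.
Qed.

Definition good (A : gset) : Prop := forall X, bij (kap A X).

End Kappa.

(** * Pullbacks of categories, and invertibility of kappa at pasting diagrams *)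

Definition one_cat : cat.
Proof.
refine (@Cat unit unit (fun _ => tt) (fun _ => tt) (fun _ => tt) (fun _ _ _ => tt)
  _ _ _ _ _ _ _); repeat intros []; reflexivity.
Defined.

Definition one_map (A : cat) (x : obj A) : fctor one_cat A.
Proof.
refine (@Fctor one_cat A (fun _ => x) (fun _ => idn x) _ _ _ _).
- intros; apply dom_idn.
- intros; apply cod_idn.
- reflexivity.
- intros; symmetry; apply cmp_idl'.
Defined.

Inductive iarr := Id0 | Id1 | Step.

(** The fallback [Step] is the composite of the two composable pairs involving [Step]; all other
    pairs that reach it are not composable. *)
Definition two_cat : cat.
Proof.
refine (@Cat bool iarr
  (fun f => match f with Id1 => true | _ => false end)
  (fun f => match f with Id0 => false | _ => true end)
  (fun b : bool => if b then Id1 else Id0)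
  (fun g f _ => match g, f with Id0, Id0 => Id0 | Id1, Id1 => Id1 | _, _ => Step end)
  _ _ _ _ _ _ _).
- intros []; reflexivity.
- intros []; reflexivity.
- intros [] [] e; solve [reflexivity|discriminate e].
- intros [] [] e; solve [reflexivity|discriminate e].
- intros [] e; reflexivity.
- intros [] e; reflexivity.
- intros [] [] [] e1 e2 e3 e4;
  solve [reflexivity|discriminate e1|discriminate e2|discriminate e3|discriminate e4].
Defined.

Definition two_map (A : cat) (f : arr A) : fctor two_cat A.
Proof.
refine (@Fctor two_cat A (fun b : bool => if b then cod f else dom f)
  (fun a => match a with Id0 => idn (dom f) | Id1 => idn (cod f) | Step => f end)
  _ _ _ _).
- intros []; cbn; rewrite ?dom_idn; reflexivity.
- intros []; cbn; rewrite ?cod_idn; reflexivity.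
- intros []; reflexivity.
- intros [] [] e e'; try discriminate e; cbn; symmetry;
    (apply cmp_idl' || apply cmp_idr').
Defined.

(** Elementwise form of pullbacks, in which the squares for [[A, X]] are checked. Preservation by
    [C] is stated with the universal property; probing with [one_cat] and [two_cat] leads back to
    elements. *)
Definition cat_pb (A B Z P : cat) (f : fctor A Z) (g : fctor B Z) (p : fctor P A)
  (q : fctor P B) : Prop :=
  fctor_comp f p = fctor_comp g q /\
  (forall a b, fo f a = fo g b -> exists! z, fo p z = a /\ fo q z = b) /\
  (forall a b, fa f a = fa g b -> exists! z, fa p z = a /\ fa q z = b).

Lemma cat_pb_is_pullback (A B Z P : cat) (f : fctor A Z) (g : fctor B Z)
  (p : fctor P A) (q : fctor P B) :
  cat_pb f g p q -> @is_pullback (under CAT) A B Z P f g p q.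
Proof.
intros [E [H0 H1]]; split; [exact E|]. intros W a b e.
change (fctor_comp f a = fctor_comp g b) in e.
set (u0 := fun x => constructive_indefinite_description _
  (H0 _ _ (feq_fo (eq_feq e) x))).
set (u1 := fun x => constructive_indefinite_description _
  (H1 _ _ (feq_fa (eq_feq e) x))).
assert (P0 : forall x, fo p (proj1_sig (u0 x)) = fo a x /\ fo q (proj1_sig (u0 x))
  = fo b x)
  by (intros x; exact (proj1 (proj2_sig (u0 x)))).
assert (P1 : forall x, fa p (proj1_sig (u1 x)) = fa a x /\ fa q (proj1_sig (u1 x))
  = fa b x)
  by (intros x; exact (proj1 (proj2_sig (u1 x)))).
assert (I0 : forall z z', fo p z = fo p z' -> fo q z = fo q z' -> z = z').
{ intros z z' e1 e2. destruct (H0 _ _ (feq_fo (eq_feq E) z')) as [w [_ U]].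
  transitivity w; [symmetry|]; apply U; split; auto. }
assert (I1 : forall z z', fa p z = fa p z' -> fa q z = fa q z' -> z = z').
{ intros z z' e1 e2. destruct (H1 _ _ (feq_fa (eq_feq E) z')) as [w [_ U]].
  transitivity w; [symmetry|]; apply U; split; auto. }
unshelve eexists.
- refine (@Fctor W P (fun x => proj1_sig (u0 x)) (fun x => proj1_sig (u1 x)) _ _ _ _).
  + intros x; apply I0; rewrite <- fa_dom;
    [rewrite (proj1 (P1 _)), (proj1 (P0 _))|rewrite (proj2 (P1 _)), (proj2 (P0 _))];
    apply fa_dom.
  + intros x; apply I0; rewrite <- fa_cod;
    [rewrite (proj1 (P1 _)), (proj1 (P0 _))|rewrite (proj2 (P1 _)), (proj2 (P0 _))];
    apply fa_cod.
  + intros x; apply I1; rewrite fa_idn;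
    [rewrite (proj1 (P1 _)), (proj1 (P0 _))|rewrite (proj2 (P1 _)), (proj2 (P0 _))];
    apply fa_idn.
  + intros y x h h'; apply I1.
    * rewrite (proj1 (P1 _)).
      assert (k : dom (fa a y) = cod (fa a x)) by bdry.
      assert (k' : dom (fa p (proj1_sig (u1 y))) = cod (fa p (proj1_sig (u1 x))))
        by (rewrite !(proj1 (P1 _)); exact k).
      rewrite (fa_cmp h k), (fa_cmp h' k'); apply cmp_eq; symmetry; apply P1.
    * rewrite (proj2 (P1 _)).
      assert (k : dom (fa b y) = cod (fa b x)) by bdry.
      assert (k' : dom (fa q (proj1_sig (u1 y))) = cod (fa q (proj1_sig (u1 x))))
        by (rewrite !(proj2 (P1 _)); exact k).
      rewrite (fa_cmp h k), (fa_cmp h' k'); apply cmp_eq; symmetry; apply P1.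
- split; [split; apply feq_eq; split; intros x; first [apply P0|apply P1]|].
  intros v [v1 v2]. apply eq_feq in v1 as [v10 v11], v2 as [v20 v21]; cbn in *.
  apply feq_eq; split; intros x.
  + apply I0; [rewrite v10; apply P0|rewrite v20; apply P0].
  + apply I1; [rewrite v11; apply P1|rewrite v21; apply P1].
Qed.

Lemma is_pullback_cat_pb (A B Z P : cat) (f : fctor A Z) (g : fctor B Z)
  (p : fctor P A) (q : fctor P B) :
  @is_pullback (under CAT) A B Z P f g p q -> cat_pb f g p q.
Proof.
intros [E U]; split; [exact E|split].
- intros a b e.
  assert (e' : fctor_comp f (one_map a) = fctor_comp g (one_map b)).
  { apply feq_eq; split; intros []; cbn; [exact e|].
    rewrite !fa_idn, e; reflexivity. }
  destruct (U one_cat (one_map a) (one_map b) e') as [u [[u1 u2] Uu]].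
  exists (fo u tt); split.
  + split; [exact (feq_fo (eq_feq u1) tt)|exact (feq_fo (eq_feq u2) tt)].
  + intros z [z1 z2].
    rewrite (Uu (one_map z)); [reflexivity|].
    split; apply feq_eq; split; intros []; cbn; try assumption;
    rewrite fa_idn; f_equal; assumption.
- intros a b e.
  assert (e' : fctor_comp f (two_map a) = fctor_comp g (two_map b)).
  { assert (d : fo f (dom a) = fo g (dom b)) by (rewrite <- !fa_dom, e; reflexivity).
    assert (c : fo f (cod a) = fo g (cod b)) by (rewrite <- !fa_cod, e; reflexivity).
    apply feq_eq; split; intros []; cbn; rewrite ?fa_idn; congruence. }
  destruct (U two_cat (two_map a) (two_map b) e') as [u [[u1 u2] Uu]].
  exists (fa u Step); split.
  + split; [exact (feq_fa (eq_feq u1) Step)|exact (feq_fa (eq_feq u2) Step)].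
  + intros z [z1 z2].
    rewrite (Uu (two_map z)); [reflexivity|].
    subst a b; split; apply feq_eq; split; intros []; cbn;
    rewrite ?fa_idn, ?fa_dom, ?fa_cod; reflexivity.
Qed.

Lemma bij_pullback (A B Z P A' B' P' : cat)
  (f : fctor A Z) (g : fctor B Z) (p : fctor P A) (q : fctor P B)
  (f' : fctor A' Z) (g' : fctor B' Z) (p' : fctor P' A') (q' : fctor P' B')
  (kA : fctor A A') (kB : fctor B B') (kP : fctor P P') :
  cat_pb f g p q -> cat_pb f' g' p' q' ->
  feq (fctor_comp f' kA) f -> feq (fctor_comp g' kB) g ->
  feq (fctor_comp p' kP) (fctor_comp kA p) -> feq (fctor_comp q' kP)
    (fctor_comp kB q) ->
  bij kA -> bij kB -> bij kP.
Proof.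
intros [E [H0 H1]] [E' [H0' H1']] [ef0 ef1] [eg0 eg1] [ep0 ep1] [eq0 eq1]
  [a0 a1] [b0 b1]; cbn in *.
pose proof (uniq_inj a0) as ia0; pose proof (uniq_inj a1) as ia1.
pose proof (uniq_inj b0) as ib0; pose proof (uniq_inj b1) as ib1.
split; intros y.
- destruct (a0 (fo p' y)) as [a [Ea _]], (b0 (fo q' y)) as [b [Eb _]].
  destruct (H0 a b) as [z [[z1 z2] Uz]].
  { rewrite <- ef0, <- eg0, Ea, Eb; exact (feq_fo (eq_feq E') y). }
  destruct (H0' _ _ (feq_fo (eq_feq E') y)) as [w [_ Uw]].
  exists z; split.
  + transitivity w; [symmetry|]; apply Uw; [|split; reflexivity].
    rewrite ep0, eq0, z1, z2; split; assumption.
  + intros z' <-; apply Uz; split; [apply ia0|apply ib0]; rewrite <- ?ep0, <- ?eq0;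
      auto.
- destruct (a1 (fa p' y)) as [a [Ea _]], (b1 (fa q' y)) as [b [Eb _]].
  destruct (H1 a b) as [z [[z1 z2] Uz]].
  { rewrite <- ef1, <- eg1, Ea, Eb; exact (feq_fa (eq_feq E') y). }
  destruct (H1' _ _ (feq_fa (eq_feq E') y)) as [w [_ Uw]].
  exists z; split.
  + transitivity w; [symmetry|]; apply Uw; [|split; reflexivity].
    rewrite ep1, eq1, z1, z2; split; assumption.
  + intros z' <-; apply Uz; split; [apply ia1|apply ib1]; rewrite <- ?ep1, <- ?eq1;
      auto.
Qed.

Definition gshift (X : gcat) : gcat :=
  {| lev := fun n => lev X (S n); lev_s := fun n => lev_s X (S n);
     lev_t := fun n => lev_t X (S n); lev_ss := fun n => lev_ss X (S n);
     lev_tt := fun n => lev_tt X (S n) |}.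

Definition jres1 (A B : gset) (b : cell B 0) (X : gcat) :
  fctor (pw (join A b) X) (pw A (gshift X)).
Proof.
refine (@Fctor (pw (join A b) X) (pw A (gshift X))
  (fun f => ghom_comp (fshift f) (join1 A b))
  (fun f => ghom_comp (fshift f) (join1 A b)) _ _ _ _);
  intros; apply ghom_eq; intros; try reflexivity.
apply cmp_eq; reflexivity.
Defined.

Lemma join_ex (A B : gset) (a : cell A 0) (b : cell B 0) Z
  (conn : forall (f : ghom A (shift Z)) c,
    gs (gmap f c : cell Z 1) = gs (gmap f a : cell Z 1) /\
    gt (gmap f c : cell Z 1) = gt (gmap f a : cell Z 1))
  (f : ghom A (shift Z)) (g : ghom B Z) :
  gt (gmap f a : cell Z 1) = gmap g b ->
  exists! h : ghom (join A b) Z,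
    ghom_comp (fshift h) (join1 A b) = f /\ ghom_comp h (join2 A b) = g.
Proof.
intros E.
assert (Hs : forall c : cell A 0, gs (gmap f c : cell Z 1) = gs (gmap f a : cell Z 1))
  by (intros c; apply conn).
assert (Ht : forall c : cell A 0, gt (gmap f c : cell Z 1) = gmap g b)
  by (intros c; rewrite (proj2 (conn f c)); exact E).
exists (copair Hs Ht); split.
- split; apply ghom_eq; [reflexivity|]. intros [|n] c; reflexivity.
- intros h [<- <-]; apply join_ext.
  + exact (gmap_s h (inl a : cell (join A b) 1)).
  + apply ghom_eq; reflexivity.
  + apply ghom_eq; intros [|n] c; reflexivity.
Qed.

(** By connectedness, the higher cells indexed by [A] share one source and one target vertex. The
    source is the image of the new vertex, and matching the target with [b] is a single condition in
    [X_0]. *)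
Lemma join_pb (A B : gset) (a : cell A 0) (b : cell B 0) (X : gcat) :
  (forall Z (f : ghom A (shift Z)) c,
    gs (gmap f c : cell Z 1) = gs (gmap f a : cell Z 1) /\
    gt (gmap f c : cell Z 1) = gt (gmap f a : cell Z 1)) ->
  cat_pb (fctor_comp (lev_t X 0) (evx (gshift X) a)) (evx X b)
    (jres1 A b X) (pw0 (join2 A b) X).
Proof.
intros conn; split; [|split].
- apply feq_eq; split; intros f; exact (gmap_t f (inl a : cell (join A b) 1)).
- intros f g; exact (@join_ex A B a b (Ob X) (conn (Ob X)) f g).
- intros f g; exact (@join_ex A B a b (Ar X) (conn (Ar X)) f g).
Qed.

Section Good.
Variable C : functor2 CAT CAT.
Hypothesis hC : preserves_pullbacks (under_functor C).

Lemma cat_pb_cf (A B Z P : cat) (f : fctor A Z) (g : fctor B Z) (p : fctor P A)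
  (q : fctor P B) : cat_pb f g p q -> cat_pb (cf C f) (cf C g) (cf C p) (cf C q).
Proof.
intros H; apply is_pullback_cat_pb.
exact (hC (cat_pb_is_pullback H)).
Qed.

(** [C] preserves the pullback of [join_pb], and the same lemma at [glob_obj C X] gives a pullback
    over the same category [C X_0], since [gshift] commutes with [glob_obj C] definitionally. Kappa
    compares the two and is invertible on both legs. *)
Lemma good_join (A B : gset) (a : cell A 0) (b : cell B 0) :
  (forall Z (f : ghom A (shift Z)) c,
    gs (gmap f c : cell Z 1) = gs (gmap f a : cell Z 1) /\
    gt (gmap f c : cell Z 1) = gt (gmap f a : cell Z 1)) ->
  good C A -> good C B -> good C (join A b).
Proof.
intros conn gA gB X.
refine (@bij_pullback _ _ _ _ _ _ _ _ _ _ _ _ _ _ _ (kap C A (gshift X)) (kap C B X)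
  (kap C (join A b) X) (cat_pb_cf (join_pb (a := a) b X conn))
  (join_pb (a := a) b (glob_obj C X) conn) _ _ _ _ (gA (gshift X)) (gB X)).
- exact (cf_triangle C (G := lev_t X 0) (F := evx (gshift X) a)
    (eq_feq eq_refl)).
- split; reflexivity.
- split; intros c; apply ghom_eq; intros n x; symmetry.
  + refine (feq_fo (cf_triangle C (G := evx (gshift X) x) (F := jres1 A b X)
      (H := evx X (inl x : cell (join A b) (S n))) _) c); split; reflexivity.
  + refine (feq_fa (cf_triangle C (G := evx (gshift X) x) (F := jres1 A b X)
      (H := evx X (inl x : cell (join A b) (S n))) _) c); split; reflexivity.
- apply eq_feq; symmetry; apply kap_pw0.
Qed.

(** Here [A] represents [n]-cells, so [[A, X]] is [X_n], and kappa is the identity of [C X_n] up to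
    these isomorphisms. *)
Lemma good_generic (A : gset) n (a : cell A n) :
  @generic (functor_id GSET) A n a -> good C A.
Proof.
intros G X.
assert (H : forall Z (z : cell Z n), exists! f : ghom A Z, gmap f a = z).
{ intros Z z; apply (G Z z); cbn. destruct (gmap (bang Z) z); reflexivity. }
assert (K : forall Y : gcat, bij (evx Y a)) by (intros Y; split; intros z; apply H).
apply (bij_cancel (K (glob_obj C X))). rewrite evx_kap; apply bij_cf, K.
Qed.

Lemma good_gpoint : good C gpoint.
Proof.
apply (@good_generic gpoint 0 tt). intros W w _.
exists (gpoint_map w); split; [reflexivity|].
intros f <-; apply ghom_eq; intros [|n] []; reflexivity.
Qed.

Lemma good_tree A : is_tree A -> good C A.
Proof.
intros [t ->]; induction t as [|t IHt u IHu]; [apply good_gpoint|].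
apply (good_join (A := ar t) (B := ar u) (a := root t)); auto.
intros Z f c; apply ar_connected.
Qed.

End Good.

(** * The distributive law *)

Section Lambda.
Variables (C : functor2 CAT CAT) (F : functor GSET GSET) (hF : preserves_pullbacks F).
Hypothesis fam : familial F (good C).
Let CG := glob_obj C.

Lemma evF_pw0 A B (g : ghom A B) X n (a : cell (fob F A) n) :
  fctor_comp (evF hF X a) (pw0 g X) = evF hF X (fm F g a).
Proof. apply feq_eq; split; intros f; symmetry; apply fm_comp. Qed.

Lemma generic_cover (X : gcat) n (q : cell (fob F gterminal) n) :
  exists A (a : cell (fob F A) n), good C A /\ generic a /\ fm F (bang A) a = q.
Proof.
destruct (fam q) as [A [a [p [G E]]]]; exists A, a; split; [exact p|split; [exact G|]].
rewrite E. etransitivity; [|apply fm_id]. apply fm_ext; intros m x; destruct x;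
  reflexivity.
Qed.

(* Through the generic element in the same fibre, an element of  F (C X)  comes from
   a unique element of some  C [A, X]. *)
Lemma lam_ex_o X n (z : obj (icat hF (CG X) n)) :
  exists w : obj (cob C (icat hF X n)),
  forall A (a : cell (fob F A) n) c,
    fo (evF hF (CG X) a) (fo (kap C A X) c) = z -> fo (cf C (evF hF X a)) c = w.
Proof.
destruct (generic_cover X (fm F (bang _) z)) as [A [a [gA [G E]]]].
destruct (G _ z (eq_sym E)) as [f [Ef _]].
destruct (proj1 (gA X) f) as [c [Ec _]].
exists (fo (cf C (evF hF X a)) c); intros B b d Ed.
destruct (G B b) as [g [Eg _]].
{ rewrite E, <- Ed. symmetry; apply fm_bang. }
(* Restriction along [g] moves [d] to the generic arity. There kappa is injective and [a] is
   generic, so it is enough to compare values in [F (C X)]. *)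
assert (K : fo (cf C (pw0 g X)) d = c).
{ apply (uniq_inj (proj1 (gA X))). apply (generic_inj G).
  transitivity z; [|rewrite Ec; symmetry; exact Ef].
  etransitivity; [apply (f_equal (fun h : ghom A (Ob (CG X)) => fm F h a));
    exact (feq_fo (eq_feq (kap_pw0 C g X)) d)|].
  etransitivity; [symmetry; apply fm_comp|].
  etransitivity; [apply f_equal; exact Eg|exact Ed]. }
rewrite <- K, <- Eg.
exact (eq_sym (feq_fo (cf_triangle C (eq_feq (evF_pw0 g X a))) d)).
Qed.

Lemma lam_ex_a X n (z : arr (icat hF (CG X) n)) :
  exists w : arr (cob C (icat hF X n)),
  forall A (a : cell (fob F A) n) c,
    fa (evF hF (CG X) a) (fa (kap C A X) c) = z -> fa (cf C (evF hF X a)) c = w.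
Proof.
destruct (generic_cover X (fm F (bang _) z)) as [A [a [gA [G E]]]].
destruct (G _ z (eq_sym E)) as [f [Ef _]].
destruct (proj2 (gA X) f) as [c [Ec _]].
exists (fa (cf C (evF hF X a)) c); intros B b d Ed.
destruct (G B b) as [g [Eg _]].
{ rewrite E, <- Ed. symmetry; apply fm_bang. }
assert (K : fa (cf C (pw0 g X)) d = c).
{ apply (uniq_inj (proj2 (gA X))). apply (generic_inj G).
  transitivity z; [|rewrite Ec; symmetry; exact Ef].
  etransitivity; [apply (f_equal (fun h : ghom A (Ar (CG X)) => fm F h a));
    exact (feq_fa (eq_feq (kap_pw0 C g X)) d)|].
  etransitivity; [symmetry; apply fm_comp|].
  etransitivity; [apply f_equal; exact Eg|exact Ed]. }
rewrite <- K, <- Eg.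
exact (eq_sym (feq_fa (cf_triangle C (eq_feq (evF_pw0 g X a))) d)).
Qed.

Definition lam_o X n z := proj1_sig (constructive_indefinite_description _ (@lam_ex_o
  X n z)).
Definition lam_a X n z := proj1_sig (constructive_indefinite_description _ (@lam_ex_a
  X n z)).

Lemma lam_oE X n A (a : cell (fob F A) n) c :
  lam_o (fo (evF hF (CG X) a) (fo (kap C A X) c)) = fo (cf C (evF hF X a)) c.
Proof.
unfold lam_o; destruct constructive_indefinite_description as [w H]; symmetry.
apply (H A a c eq_refl).
Qed.

Lemma lam_aE X n A (a : cell (fob F A) n) c :
  lam_a (fa (evF hF (CG X) a) (fa (kap C A X) c)) = fa (cf C (evF hF X a)) c.
Proof.
unfold lam_a; destruct constructive_indefinite_description as [w H]; symmetry.
apply (H A a c eq_refl).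
Qed.

Lemma cover_o X n (z : obj (icat hF (CG X) n)) : exists A (a : cell (fob F A) n) c,
  good C A /\ z = fo (evF hF (CG X) a) (fo (kap C A X) c).
Proof.
destruct (fam z) as [A [a [gA [G E]]]].
destruct (G _ z (eq_sym E)) as [f [Ef _]].
destruct (proj1 (gA X) f) as [c [Ec _]].
exists A, a, c; split; [exact gA|]. rewrite Ec; symmetry; exact Ef.
Qed.

(** A single [a] has to serve all arrows over [q]. Composable arrows have the same image in
    [F gterminal], so both are values at this [a], and injectivity on objects makes their preimages
    composable; this is how [lam] preserves composition. *)
Lemma cover_a X n (q : cell (fob F gterminal) n) :
  exists A (a : cell (fob F A) n), good C A /\
  (forall c c', fo (evF hF (CG X) a) (fo (kap C A X) c)
                = fo (evF hF (CG X) a) (fo (kap C A X) c') -> c = c') /\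
  (forall z : arr (icat hF (CG X) n), fm F (bang (Ar (CG X))) z = q ->
     exists c, z = fa (evF hF (CG X) a) (fa (kap C A X) c)).
Proof.
destruct (generic_cover X q) as [A [a [gA [G E]]]].
exists A, a; split; [exact gA|split].
- intros c c' e; apply (uniq_inj (proj1 (gA X))), (generic_inj G), e.
- intros z Ez; destruct (G _ z (eq_trans Ez (eq_sym E))) as [f [Ef _]].
  destruct (proj2 (gA X) f) as [c [Ec _]].
  exists c; rewrite Ec; symmetry; exact Ef.
Qed.

Definition lam X n : fctor (icat hF (CG X) n) (cob C (icat hF X n)).
Proof.
refine (@Fctor (icat hF (CG X) n) (cob C (icat hF X n)) (@lam_o X n) (@lam_a X n)
  _ _ _ _).
- intros z; destruct (cover_a X (fm F (bang _) z)) as [A [a [gA [_ H]]]].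
  destruct (H z eq_refl) as [c ->].
  rewrite lam_aE, !fa_dom; symmetry; apply lam_oE.
- intros z; destruct (cover_a X (fm F (bang _) z)) as [A [a [gA [_ H]]]].
  destruct (H z eq_refl) as [c ->].
  rewrite lam_aE, !fa_cod; symmetry; apply lam_oE.
- intros z; destruct (cover_o z) as [A [a [c [gA ->]]]].
  rewrite lam_oE, <- !fa_idn; apply lam_aE.
- intros y z e.
  destruct (cover_a X (fm F (bang _) z)) as [A [a [gA [I H]]]].
  assert (Ey : fm F (bang (Ar (CG X))) y = fm F (bang (Ar (CG X))) z).
  { cbn in e. transitivity (fm F (bang _) (fm F (Dom (CG X)) y)); [symmetry;
      apply fm_bang|].
    rewrite e; apply fm_bang. }
  destruct (H z eq_refl) as [c Ec], (H y Ey) as [d Ed].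
  assert (e1 : dom d = cod c).
  { apply I. rewrite <- !fa_dom, <- !fa_cod, <- Ed, <- Ec; exact e. }
  intros e'.
  assert (e2 : dom (fa (kap C A X) d) = cod (fa (kap C A X) c))
    by (rewrite fa_dom, fa_cod, e1; reflexivity).
  assert (e3 : dom (fa (evF hF (CG X) a) (fa (kap C A X) d))
               = cod (fa (evF hF (CG X) a) (fa (kap C A X) c)))
                 by (rewrite <- Ed, <- Ec; exact e).
  assert (e4 : dom (fa (cf C (evF hF X a)) d) = cod (fa (cf C (evF hF X a)) c))
    by (rewrite fa_dom, fa_cod, e1; reflexivity).
  transitivity (lam_a (fa (evF hF (CG X) a) (fa (kap C A X) (cmp d c e1)))).
  { f_equal. symmetry.
    etransitivity; [apply f_equal; exact (@fa_cmp _ _ (kap C A X) d c e1 e2)|].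
    etransitivity; [exact (@fa_cmp _ _ (evF hF (CG X) a) _ _ e2 e3)|].
    apply cmp_eq; symmetry; assumption. }
  rewrite lam_aE, (fa_cmp e1 e4); apply cmp_eq; symmetry;
    [rewrite Ed|rewrite Ec]; apply lam_aE.
Defined.

Lemma lamE X n A (a : cell (fob F A) n) :
  fctor_comp (lam X n) (fctor_comp (evF hF (CG X) a) (kap C A X)) = cf C (evF hF X a).
Proof. apply feq_eq; split; intros c; [apply lam_oE|apply lam_aE]. Qed.

Lemma lam_epi X n (D : cat) (G H : fctor (icat hF (CG X) n) D) :
  (forall A (a : cell (fob F A) n), good C A ->
    fctor_comp G (fctor_comp (evF hF (CG X) a) (kap C A X))
    = fctor_comp H (fctor_comp (evF hF (CG X) a) (kap C A X))) -> G = H.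
Proof.
intros E; apply feq_eq; split; intros z.
- destruct (cover_o z) as [A [a [c [gA ->]]]]. exact (feq_fo (eq_feq (E A a gA)) c).
- destruct (cover_a X (fm F (bang _) z)) as [A [a [gA [_ K]]]].
  destruct (K z eq_refl) as [c ->]. exact (feq_fa (eq_feq (E A a gA)) c).
Qed.

Lemma lam_s X n :
  fctor_comp (cf C (icat_s hF X n)) (lam X (S n))
  = fctor_comp (lam X n) (icat_s hF (CG X) n).
Proof.
apply lam_epi; intros A a _; rewrite <- !fctor_comp_assoc.
transitivity (cf C (evF hF X (gs (X := fob F A) a))).
- rewrite lamE, <- cf_comp. f_equal; apply feq_eq; split; intros f; apply gmap_s.
- rewrite <- lamE; f_equal; apply feq_eq; split; intros c; symmetry; apply gmap_s.
Qed.

Lemma lam_t X n :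
  fctor_comp (cf C (icat_t hF X n)) (lam X (S n))
  = fctor_comp (lam X n) (icat_t hF (CG X) n).
Proof.
apply lam_epi; intros A a _; rewrite <- !fctor_comp_assoc.
transitivity (cf C (evF hF X (gt (X := fob F A) a))).
- rewrite lamE, <- cf_comp. f_equal; apply feq_eq; split; intros f; apply gmap_t.
- rewrite <- lamE; f_equal; apply feq_eq; split; intros c; symmetry; apply gmap_t.
Qed.

Definition lam_fun X : gfun (int_obj hF (CG X)) (glob_obj C (int_obj hF X)) :=
  @GFun (int_obj hF (CG X)) (glob_obj C (int_obj hF X)) (lam X) (lam_s X) (lam_t X).

Lemma evF_pw1 A (X Y : gcat) (f : gfun X Y) n (a : cell (fob F A) n) :
  fctor_comp (int_1_lev hF f n) (evF hF X a) = fctor_comp (evF hF Y a) (pw1 A f).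
Proof. apply feq_eq; split; intros g; apply fm_comp. Qed.

Lemma lam_nat1 (X Y : gcat) (f : gfun X Y) n :
  fctor_comp (lam Y n) (int_1_lev hF (glob_1 C f) n)
  = fctor_comp (cf C (int_1_lev hF f n)) (lam X n).
Proof.
apply lam_epi; intros A a _; rewrite <- !fctor_comp_assoc, lamE, <- cf_comp.
rewrite evF_pw1, cf_comp, <- lamE, <- !fctor_comp_assoc. f_equal.
rewrite fctor_comp_assoc, evF_pw1, <- fctor_comp_assoc. f_equal.
symmetry; apply kap_pw1.
Qed.

Lemma lam_nat2 (X Y : gcat) (a : gmod X Y) n :
  hcomp (nt_id (lam Y n)) (int_2_lev hF (glob_2 C a) n)
  = hcomp (cn C (int_2_lev hF a n)) (nt_id (lam X n)).
Proof.
apply napp_whisker.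
- rewrite cn_src; exact (lam_nat1 (msrc a) n).
- rewrite cn_tgt; exact (lam_nat1 (mtgt a) n).
- intros z; destruct (cover_o z) as [A [b [c [_ ->]]]].
  transitivity (fa (cf C (evF hF Y b)) (napp (cn C (pw2 A a)) c)).
  + etransitivity; [|apply lam_aE]. apply (f_equal (fa (lam Y n))).
    etransitivity; [apply (fm_comp (Mod (glob_2 C a)))|].
    apply (f_equal (fun h : ghom A (Ar (CG Y)) => fm F h b)).
    symmetry; apply kap_pw2.
  + etransitivity; [|apply f_equal; symmetry; apply lam_oE].
    rewrite napp_cn_whiskl.
    etransitivity; [|symmetry; apply napp_cn_whiskr].
    apply (f_equal (fun d => napp (cn C d) c)), napp_whisker.
    * apply feq_eq; split; intros f; symmetry; apply fm_comp.
    * apply feq_eq; split; intros f; symmetry; apply fm_comp.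
    * intros f; symmetry; apply fm_comp.
Qed.

Definition lam_nat : nat2 (functor2_comp (int_functor hF) (glob_functor C))
  (functor2_comp (glob_functor C) (int_functor hF)).
Proof.
refine (@Nat2 GCAT GCAT (functor2_comp (int_functor hF) (glob_functor C))
  (functor2_comp (glob_functor C) (int_functor hF)) lam_fun _ _).
- intros X Y f; apply gfun_eq; intros n; apply lam_nat1.
- intros X Y a; apply gmod_eq.
  + apply gfun_eq; intros n; apply lam_nat1.
  + apply gfun_eq; intros n; apply lam_nat1.
  + intros n; apply lam_nat2.
Defined.

End Lambda.

(** * Cartesianness of the unit, and globes *)

Lemma reta_lift n A Z (f : ghom A Z) (r : raw n A) (z : cell Z n) : valid r ->
  rmap f r = reta z -> exists a, reta a = r /\ gmap f a = z.
Proof.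
revert A Z f r z; induction n as [|n IH]; intros A Z f r z v.
{ intros E; exists r; split; [reflexivity|exact E]. }
destruct r as [x [|e [|e' l]]]; cbn [rmap reta fst snd map];
  intros [_ E]%pair_equal_spec;
  try discriminate E.
injection E as E. apply valid_cons in v as [<- [v _]].
destruct (IH _ _ (fshift f) e z v E) as [a [<- <-]].
exists a; split; [|reflexivity]. cbn [reta]. f_equal.
unfold esrc; rewrite rst_reta; apply s0_shift.
Qed.

Lemma reta_inj n X (x y : cell X n) : reta x = reta y -> x = y.
Proof.
revert X x y; induction n as [|n IH]; intros X x y E; [exact E|].
cbn [reta] in E. apply pair_equal_spec in E as [_ E]; injection E as E.
exact (IH (shift X) x y E).
Qed.

Lemma cartesian_free_unit : cartesian_nattrans free_unit.
Proof.
intros X Y f; apply is_pullback_of_cells.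
- intros n x; apply tcell_eq; exact (reta_rmap f x).
- intros n y [r v] e; apply (f_equal (@proj1_sig _ _)) in e.
  destruct (reta_lift (f := f) v (eq_sym e)) as [x [Ex Ef]].
  exists x; split; [split; [exact Ef|apply tcell_eq, Ex]|].
  intros x' [_ E]. apply (f_equal (@proj1_sig _ _)) in E.
  apply reta_inj; etransitivity; [exact Ex|symmetry; exact E].
Qed.

(* Globes, obtained from the pasting diagrams of the cells in the image of the unit. *)
Lemma globe_ex n : exists A (u : cell A n), @generic (functor_id GSET) A n u.
Proof.
destruct (familial_cartesian cartesian_free_unit familial_T (Z := gterminal) (n := n)
  tt)
  as [A [u [_ [G _]]]]; exists A, u; exact G.
Qed.

Lemma generic_id_bij A n (u : cell A n) : @generic (functor_id GSET) A n u ->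
  forall X, bij (evx X u).
Proof.
intros G X.
assert (H : forall Z (z : cell Z n), exists! f : ghom A Z, gmap f u = z).
{ intros Z z; apply (G Z z); cbn. destruct (gmap (bang Z) z); reflexivity. }
split; intros z; apply H.
Qed.

(** * The axioms of the distributive law *)

Section Law.
Variables (C : monad2 CAT) (M : monad GSET).
Let K := m2fun C.
Let F := mfun M.
Variables (hF : preserves_pullbacks F) (fam : familial F (good K)).
Hypothesis cov : covered (functor_comp F F) (good K).

Definition cunit (A : cat) : fctor A (cob K A) := n2app (m2unit C) A.
Definition cmult (A : cat) : fctor (cob K (cob K A)) (cob K A) := n2app (m2mult C) A.

Lemma cunit_nat A B (f : fctor A B) :
  fctor_comp (cunit B) f = fctor_comp (cf K f) (cunit A).
Proof. exact (n2nat1 (m2unit C) (f : obj (thom CAT A B))). Qed.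

Lemma cmult_nat A B (f : fctor A B) :
  fctor_comp (cmult B) (cf K (cf K f)) = fctor_comp (cf K f) (cmult A).
Proof. exact (n2nat1 (m2mult C) (f : obj (thom CAT A B))). Qed.

Lemma kap_cunit A X :
  fctor_comp (kap K A X) (cunit (pw A X))
  = pw1 A (n2app (glob_unit C) X : gfun X (glob_obj K X)).
Proof.
apply feq_eq; split; intros f; apply ghom_eq; intros n x; symmetry.
- exact (feq_fo (eq_feq (cunit_nat (evx X x))) f).
- exact (feq_fa (eq_feq (cunit_nat (evx X x))) f).
Qed.

Lemma kap_cmult A X :
  fctor_comp (kap K A X) (cmult (pw A X))
  = fctor_comp (pw1 A (n2app (glob_mult C) X : gfun (glob_obj K (glob_obj K X))
    (glob_obj K X)))
      (fctor_comp (kap K A (glob_obj K X)) (cf K (kap K A X))).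
Proof.
apply feq_eq; split; intros c; apply ghom_eq; intros n x.
- etransitivity; [symmetry; exact (feq_fo (eq_feq (cmult_nat (evx X x))) c)|].
  apply (f_equal (fo (cmult (lev X n)))).
  symmetry; exact (feq_fo (cf_triangle K (eq_feq (evx_kap K X x))) c).
- etransitivity; [symmetry; exact (feq_fa (eq_feq (cmult_nat (evx X x))) c)|].
  apply (f_equal (fa (cmult (lev X n)))).
  symmetry; exact (feq_fa (cf_triangle K (eq_feq (evx_kap K X x))) c).
Qed.

(** A cell [z] of [F (Ob X)] is the value at the identity of the evaluation with [A := Ob X] and
    [a := z]; similarly for arrows. *)
Lemma evF_epi X n (D : cat) (G H : fctor (icat hF X n) D) :
  (forall A (a : cell (fob F A) n),
    fctor_comp G (evF hF X a) = fctor_comp H (evF hF X a)) -> G = H.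
Proof.
intros E; apply feq_eq; split; intros z.
- pose proof (feq_fo (eq_feq (E (Ob X) z)) (ghom_id (Ob X))) as Q.
  change (fo G (fm F (ghom_id (Ob X)) z) = fo H (fm F (ghom_id (Ob X)) z)) in Q.
  rewrite fm_id in Q; exact Q.
- pose proof (feq_fa (eq_feq (E (Ar X) z)) (ghom_id (Ar X))) as Q.
  change (fa G (fm F (ghom_id (Ar X)) z) = fa H (fm F (ghom_id (Ar X)) z)) in Q.
  rewrite fm_id in Q; exact Q.
Qed.

Lemma lam_unit_S X n :
  fctor_comp (lam hF fam X n)
    (int_1_lev hF (n2app (glob_unit C) X : gfun X (glob_obj K X)) n)
  = cunit (icat hF X n).
Proof.
apply evF_epi; intros A a.
rewrite <- fctor_comp_assoc, evF_pw1, <- kap_cunit, !fctor_comp_assoc.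
rewrite <- (fctor_comp_assoc (lam hF fam X n)), lamE. symmetry; apply cunit_nat.
Qed.

(** For the globe [A] with universal cell [u], [X_n] is [[A, X]], and the unit of [Cat_monad]
    becomes the evaluation at the image of [u] under the unit of [M]. The equation defining lambda
    at that cell is the claim. *)
Lemma lam_unit_T X n :
  fctor_comp (lam hF fam X n) (int_unit_lev hF (glob_obj K X) n)
  = cf K (int_unit_lev hF X n).
Proof.
destruct (globe_ex n) as [A [u G]].
apply (bij_epi (bij_cf K (generic_id_bij G X))).
rewrite <- cf_comp.
transitivity (cf K (evF hF X (gmap (nt_app (munit M) A) u))).
- rewrite <- (lamE hF fam), <- fctor_comp_assoc; f_equal.
  apply feq_eq; split; intros c;
  [exact (nt_app_fm (munit M) (fo (kap K A X) c) u)
  |exact (nt_app_fm (munit M) (fa (kap K A X) c) u)].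
- f_equal; apply feq_eq; split; intros f; symmetry; exact (nt_app_fm (munit M) f u).
Qed.

Lemma lam_mult_S X n :
  fctor_comp (lam hF fam X n)
    (int_1_lev hF (n2app (glob_mult C) X : gfun (glob_obj K (glob_obj K X))
      (glob_obj K X)) n)
  = fctor_comp (cmult (icat hF X n))
      (fctor_comp (cf K (lam hF fam X n)) (lam hF fam (glob_obj K X) n)).
Proof.
(* Two applications of [C] call for kappa twice: at [C X], and then [C] of kappa at [X], which is
   invertible because [A] is good. *)
apply (lam_epi fam); intros A a gA. apply (bij_epi (bij_cf K (gA X))).
transitivity (fctor_comp (cf K (evF hF X a)) (cmult (pw A X))).
- rewrite <- !fctor_comp_assoc, (fctor_comp_assoc (int_1_lev _ _ _)), evF_pw1.
  rewrite <- !fctor_comp_assoc, <- kap_cmult, <- (lamE hF fam), <- !fctor_comp_assoc.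
  reflexivity.
- rewrite <- !fctor_comp_assoc, (fctor_comp_assoc (evF _ _ _)).
  rewrite (fctor_comp_assoc (lam hF fam (glob_obj K X) n)), lamE, <- !cf_comp, lamE.
  symmetry; apply cmult_nat.
Qed.

(** The equation defining lambda at all cells of [fob F A] simultaneously: at [x], both sides are
    [C] of the evaluation at [x]. It carries kappa past the inner layer of [F]. *)
Lemma lam_pwF A X :
  fctor_comp (pw1 (fob F A) (lam_fun hF fam X)) (fctor_comp (pwF hF A (glob_obj K X))
    (kap K A X))
  = fctor_comp (kap K (fob F A) (int_obj hF X)) (cf K (pwF hF A X)).
Proof.
apply pw_ext; intros n x.
transitivity (cf K (evF hF X x)).
- rewrite <- (lamE hF fam); apply feq_eq; split; reflexivity.
- apply feq_eq; split; intros c; symmetry.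
  + refine (feq_fo (cf_triangle K (G := evx (int_obj hF X) x) (F := pwF hF A X)
      (H := evF hF X x) _) c); split; reflexivity.
  + refine (feq_fa (cf_triangle K (G := evx (int_obj hF X) x) (F := pwF hF A X)
      (H := evF hF X x) _) c); split; reflexivity.
Qed.

Lemma FF_epi X n (D : cat) (G H : fctor (icat hF (int_obj hF (glob_obj K X)) n) D) :
  (forall A (b : cell (fob F (fob F A)) n),
    fctor_comp G (fctor_comp (evF hF (int_obj hF (glob_obj K X)) b)
      (fctor_comp (pwF hF A (glob_obj K X)) (kap K A X)))
    = fctor_comp H (fctor_comp (evF hF (int_obj hF (glob_obj K X)) b)
      (fctor_comp (pwF hF A (glob_obj K X)) (kap K A X)))) -> G = H.
Proof.
intros E; apply feq_eq; split; intros z.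
- destruct (cov z) as [A [b [f [gA Ez]]]].
  destruct (proj1 (gA X) f) as [c [Ec _]].
  pose proof (feq_fo (eq_feq (E A b)) c) as Q; cbn in Q.
  rewrite <- Ez, <- Ec; exact Q.
- destruct (cov z) as [A [b [f [gA Ez]]]].
  destruct (proj2 (gA X) f) as [c [Ec _]].
  pose proof (feq_fa (eq_feq (E A b)) c) as Q; cbn in Q.
  rewrite <- Ez, <- Ec; exact Q.
Qed.

Lemma mult_evF X n A (b : cell (fob F (fob F A)) n) :
  fctor_comp (int_mult_lev hF X n) (fctor_comp (evF hF (int_obj hF X) b) (pwF hF A X))
  = evF hF X (gmap (nt_app (mmult M) A) b).
Proof.
apply feq_eq; split; intros f; exact (nt_app_fm (mmult M) f b).
Qed.

(** For [b] in [F F A], precomposition with [ev_b], [pwF] and kappa turns both sides into [C] of the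
    evaluation at the image of [b] under the multiplication; [cov] makes these precompositions
    jointly faithful. *)
Lemma lam_mult_T X n :
  fctor_comp (lam hF fam X n) (int_mult_lev hF (glob_obj K X) n)
  = fctor_comp (cf K (int_mult_lev hF X n))
      (fctor_comp (lam hF fam (int_obj hF X) n) (int_1_lev hF (lam_fun hF fam X) n)).
Proof.
apply FF_epi; intros A b.
transitivity (cf K (evF hF X (gmap (nt_app (mmult M) A) b))).
- rewrite <- (lamE hF fam), <- mult_evF, <- !fctor_comp_assoc; reflexivity.
- rewrite <- mult_evF, !cf_comp, <- (lamE hF fam), <- !fctor_comp_assoc, <- lam_pwF.
  do 2 f_equal.
  rewrite !fctor_comp_assoc; do 2 f_equal. symmetry; apply evF_pw1.
Qed.

Definition lam_law : distributive_law (glob_monad C) (Cat_monad hF).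
Proof.
refine (@DistributiveLaw GCAT (glob_monad C) (Cat_monad hF) (lam_nat hF fam) _ _ _ _);
  intros X; apply gfun_eq; intros n.
- apply lam_unit_S.
- apply lam_unit_T.
- apply lam_mult_S.
- apply lam_mult_T.
Defined.

End Law.

(** * Transfer from the explicit free omega-category to [R0] *)

Lemma familial_weaken F (P Q : gset -> Prop) :
  (forall A, P A -> Q A) -> familial F P -> familial F Q.
Proof.
intros I H Z n z; destruct (H Z n z) as [A [a [p E]]]; exists A, a; auto.
Qed.

Lemma covered_weaken F (P Q : gset -> Prop) :
  (forall A, P A -> Q A) -> covered F P -> covered F Q.
Proof.
intros I H Z n z; destruct (H Z n z) as [A [a [f [p E]]]]; exists A, a, f; auto.
Qed.

Definition free_comparison (L L' : left_adjoint omega_forget) :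
  nattrans (functor_comp omega_forget (ladj L)) (functor_comp omega_forget (ladj L')).
Proof.
refine (@Nattrans GSET GSET (functor_comp omega_forget (ladj L))
  (functor_comp omega_forget (ladj L'))
  (fun X => wmap (nt_app (adjoint_comparison L L') X)) _).
intros X Y f. exact (f_equal (@wmap _ _) (nt_nat (adjoint_comparison L L') f)).
Defined.

Lemma free_comparisonK (L L' : left_adjoint omega_forget) X n
  (x : cell (wset (fob (ladj L) X)) n) :
  gmap (nt_app (free_comparison L' L) X) (gmap (nt_app (free_comparison L L') X) x) = x.
Proof.
exact (f_equal (fun h : omega_fun _ _ => gmap (wmap h) x) (adjoint_comparisonK L L' X)).
Qed.

Lemma cartesian_free_comparison (L L' : left_adjoint omega_forget) :
  cartesian_nattrans (free_comparison L L').
Proof.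
apply (@cartesian_iso _ _ (free_comparison L L') (free_comparison L' L));
  intros X n x; apply free_comparisonK.
Qed.

Theorem theorem7p13
  (C : monad2 CAT)
  (hC : preserves_pullbacks (under_functor (m2fun C)))
  (L : left_adjoint omega_forget)
  (R0 : monad GSET)
  (phi0 : cartesian_monad_morphism R0 (free_omega_monad L)) :
  exists hR0 : preserves_pullbacks (mfun R0),
    inhabited (distributive_law (glob_monad C) (Cat_monad hR0)).
Proof.
(* The left adjoint [L] is arbitrary: its comparison with [free_adjoint] is invertible, hence
   cartesian, and carries both properties over. *)
assert (famL : familial (mfun (free_omega_monad L)) is_tree)
  by exact (familial_cartesian (cartesian_free_comparison L free_adjoint) familial_T).
assert (covL : covered (functor_comp (mfun (free_omega_monad L))
                          (mfun (free_omega_monad L))) is_tree)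
  by exact (covered_cartesian (cartesian_free_comparison L free_adjoint)
              (familial_pullbacks famL) covered_TT).
(* The same transfers along [phi0]; preservation of pullbacks by [R0], the witness of the
   existential, follows from representability of the fibres. *)
pose proof (familial_cartesian (mm_cartesian phi0) famL) as famR.
pose proof (familial_pullbacks famR) as hR.
pose proof (covered_cartesian (mm_cartesian phi0) hR covL) as covR.
exists hR; constructor.
apply (@lam_law C R0 hR).
- exact (familial_weaken (good_tree hC) famR).
- exact (covered_weaken (good_tree hC) covR).
Qed.
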